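(* Every $g$-map graph on $n$ vertices has tree-independence number $\mathcal{O}(\sqrt{gn})$. A tree decomposition witnessing this can be computed in $\mathsf{poly}(n,g)$ time.
   Context: All graphs are finite and simple; $\alpha$ is the independence number. The Euler genus of an orientable surface with $h$ handles is $2h$, that of a nonorientable surface with $c$ cross-caps is $c$; the Euler genus of a graph is the minimum Euler genus of a surface in which it embeds. $g$-map graph: start with a graph $G_0$ embedded in a surface of Euler genus $g$, with each face labeled a nation or a lake; $G$ is the graph whose vertices are the nations, two vertices being adjacent iff the corresponding faces share a vertex of $G_0$. Equivalently, there is a bipartite graph $H$ of Euler genus at most $g$ with bipartition $(X,Y)$, called a witness of $G$, such that $V(G)=X$ and two distinct vertices of $X$ are adjacent in $G$ iff they have a common neighbor in $Y$. For the algorithmic part, $G$ is given together with a witness $H$. A tree decomposition of $G$ is a pair $(T,\{X_t\}_{t\in V(T)})$ with $T$ a tree and bags $X_t\subseteq V(G)$ such that every vertex is in some bag, both endpoints of every edge lie in a common bag, and for each $u\in V(G)$ the nodes $t$ with $u\in X_t$ induce a connected subgraph of $T$. Its independence number is $\max_t\alpha(G[X_t])$; the tree-independence number of $G$ is the minimum independence number of a tree decomposition of $G$. The implicit constant is absolute; for $g=0$ the bound $\mathcal{O}(\sqrt{gn})$ is to be read as $\mathcal{O}(\sqrt{n})$ (i.e. $\mathcal{O}(\sqrt{(g+1)n})$ in general).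
   Formalization: The running time is poly(n,g) times (|Y|+1), where Y is the second side of the given witness H: |Y| is not bounded in n and g, so merely reading H can exceed poly(n,g); the bound is poly(n,g) whenever |Y| is polynomial in n and g. *)

(* Defs.v *)
From HB Require Import structures.
From mathcomp Require Import all_boot all_order all_algebra.
From mathcomp Require Import boolp reals.

Set Implicit Arguments.
Unset Strict Implicit.
Unset Printing Implicit Defensive.

(** ** Graphs, trees, tree decompositions *)

Record sgraph (V : finType) := SGraph {
  adj :> rel V;
  adj_sym : symmetric adj;
  adj_irr : irreflexive adj }.

Definition stable (V : finType) (G : sgraph V) (A : {set V}) : bool :=
  [forall u in A, forall v in A, ~~ G u v].

(* The independence number of the induced subgraph G[S]. *)
Definition alpha (V : finType) (G : sgraph V) (S : {set V}) : nat :=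
  \max_(A : {set V} | (A \subset S) && stable G A) #|A|.

(* [ucycle T p] with [size p = 2] is an edge traversed back and forth. *)
Definition is_tree (N : finType) (T : sgraph N) : Prop :=
  [/\ 0 < #|N|,
      forall s t : N, connect T s t
    & forall p : seq N, ucycle T p -> size p <= 2].

Definition tree_decomposition (V N : finType) (G : sgraph V)
    (T : sgraph N) (X : N -> {set V}) : Prop :=
  [/\ is_tree T,
      forall v : V, exists t : N, v \in X t,
      forall u v : V, G u v -> exists t : N, u \in X t /\ v \in X t
    & forall (u : V) (s t : N), u \in X s -> u \in X t ->
        connect [rel a b | [&& T a b, u \in X a & u \in X b]] s t].

Definition td_alpha (V N : finType) (G : sgraph V) (X : N -> {set V}) : nat :=
  \max_(t : N) alpha G (X t).

Definition has_td_alpha (V : finType) (G : sgraph V) (k : nat) : Prop :=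
  exists (N : finType) (T : sgraph N) (X : N -> {set V}),
    tree_decomposition G T X /\ td_alpha G X = k.

Definition unit_graph : sgraph unit :=
  @SGraph unit (fun _ _ => false) (fun _ _ => erefl) (fun _ => erefl).

Lemma has_td_alpha_ex (V : finType) (G : sgraph V) :
  exists k, `[< has_td_alpha G k >].
Proof.
exists (td_alpha G (fun _ : unit => [set: V])); apply/asboolP.
exists unit, unit_graph, (fun _ : unit => [set: V]); split=> //; split.
- split; first by rewrite card_unit.
  + by move=> [] []; apply: connect0.
  + by move=> [|[] [|[] p]] // /andP[].
- by move=> v; exists tt; rewrite inE.
- by move=> u v _; exists tt; rewrite !inE.
- by move=> u [] [] _ _; apply: connect0.
Qed.

Definition tree_alpha (V : finType) (G : sgraph V) : nat :=
  ex_minn (has_td_alpha_ex G).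

(** ** Surfaces and Euler genus *)

(* A closed connected surface, orientable or not, presented by a finite cell
   decomposition.  Its flags are the (vertex, edge, face) corners; [flip i]
   changes the i-dimensional cell of a flag and keeps the other two.  Loops,
   parallel edges and faces of any length are allowed.  Cells are the orbits
   of the flags under the two flips that fix that cell. *)
Record surface := Surface {
  flag : finType;
  flip0 : flag -> flag;
  flip1 : flag -> flag;
  flip2 : flag -> flag;
  flip0K : involutive flip0;
  flip1K : involutive flip1;
  flip2K : involutive flip2;
  flip0_neq : forall x, flip0 x != x;
  flip1_neq : forall x, flip1 x != x;
  flip2_neq : forall x, flip2 x != x;
  flip02C : forall x, flip0 (flip2 x) = flip2 (flip0 x);
  flip02_neq : forall x, flip0 (flip2 x) != x;
  flag_inhabited : 0 < #|flag|;
  flag_connected : forall x y,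
    connect [rel a b | [|| b == flip0 a, b == flip1 a | b == flip2 a]] x y }.

Definition vertex_rel (S : surface) : rel (flag S) :=
  [rel a b | (b == flip1 a) || (b == flip2 a)].
Definition edge_rel (S : surface) : rel (flag S) :=
  [rel a b | (b == flip0 a) || (b == flip2 a)].
Definition face_rel (S : surface) : rel (flag S) :=
  [rel a b | (b == flip0 a) || (b == flip1 a)].

Definition euler_char (S : surface) : int :=
  ((n_comp (@vertex_rel S) predT)%:Z - (n_comp (@edge_rel S) predT)%:Z
   + (n_comp (@face_rel S) predT)%:Z)%R.

(* 2 - (2 - 2h) = 2h with h handles, 2 - (2 - c) = c with c cross-caps. *)
Definition surface_genus (S : surface) : int := (2%:Z - euler_char S)%R.

(* The graph is a subgraph of the 1-skeleton of the cell decomposition; the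
   vertex v is sent to the vertex cell of the flag [f v].  The faces of the
   graph itself need not be discs, and the graph may be disconnected: the
   decomposition can have further vertices and edges. *)
Definition embeds (V : finType) (G : sgraph V) (S : surface) : Prop :=
  exists f : V -> flag S,
    (forall u v, connect (@vertex_rel S) (f u) (f v) -> u = v) /\
    (forall u v, G u v -> exists x : flag S,
       connect (@vertex_rel S) (f u) x /\
       connect (@vertex_rel S) (f v) (flip0 x)).

Definition euler_genus_le (V : finType) (G : sgraph V) (g : nat) : Prop :=
  exists S : surface, (surface_genus S <= g%:Z)%R /\ embeds G S.

(** ** Map graphs *)

Definition witness (X Y : finType) (g : nat)
    (G : sgraph X) (H : sgraph (X + Y)%type) : Prop :=
  [/\ forall x x' : X, ~~ H (inl x) (inl x'),
      forall y y' : Y, ~~ H (inr y) (inr y'),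
      euler_genus_le H g
    & forall x x' : X, G x x' =
        (x != x') && [exists y : Y, H (inl x) (inr y) && H (inl x') (inr y)]].

Definition map_graph (g : nat) (X : finType) (G : sgraph X) : Prop :=
  exists (Y : finType) (H : sgraph (X + Y)%type), witness g G H.

(** ** Running time: unit-cost random access machine *)

(* Structured programs over finitely many named registers and an unbounded
   memory, all cells holding natural numbers.  The only arithmetic is addition
   and truncated subtraction (no multiplication), so that unit cost is
   polynomially related to Turing machine time. *)
Inductive cmd : Type :=
| Skip
| Const (x k : nat)       (* x := k *)
| Add (x y z : nat)       (* x := y + z *)
| Sub (x y z : nat)       (* x := y - z *)
| Read (x y : nat)        (* x := mem[y] *)
| Write (x y : nat)       (* mem[x] := y *)
| Seq (p q : cmd)
| If (x : nat) (p q : cmd)    (* p if x <> 0, else q *)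
| While (x : nat) (p : cmd).  (* loop as long as x <> 0 *)

Record state := State { reg : nat -> nat; mem : nat -> nat }.

Definition upd (f : nat -> nat) (a b : nat) : nat -> nat :=
  fun i => if i == a then b else f i.

Definition set_reg (s : state) (x a : nat) : state :=
  State (upd (reg s) x a) (mem s).

(* [exec p s t s'] : from s, program p halts in state s' after t steps. *)
Inductive exec : cmd -> state -> nat -> state -> Prop :=
| ExSkip s : exec Skip s 1 s
| ExConst s x k : exec (Const x k) s 1 (set_reg s x k)
| ExAdd s x y z : exec (Add x y z) s 1 (set_reg s x (reg s y + reg s z))
| ExSub s x y z : exec (Sub x y z) s 1 (set_reg s x (reg s y - reg s z))
| ExRead s x y : exec (Read x y) s 1 (set_reg s x (mem s (reg s y)))
| ExWrite s x y :
    exec (Write x y) s 1 (State (reg s) (upd (mem s) (reg s x) (reg s y)))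
| ExSeq p q s1 s2 s3 t1 t2 :
    exec p s1 t1 s2 -> exec q s2 t2 s3 -> exec (Seq p q) s1 (t1 + t2) s3
| ExIfT x p q s s' t :
    reg s x != 0 -> exec p s t s' -> exec (If x p q) s t.+1 s'
| ExIfF x p q s s' t :
    reg s x == 0 -> exec q s t s' -> exec (If x p q) s t.+1 s'
| ExWhileF x p s : reg s x == 0 -> exec (While x p) s 1 s
| ExWhileT x p s1 s2 s3 t1 t2 :
    reg s1 x != 0 -> exec p s1 t1 s2 -> exec (While x p) s2 t2 s3 ->
    exec (While x p) s1 (t1 + t2).+1 s3.

Definition init_state (input : seq nat) : state :=
  State (fun=> 0) (nth 0 input).

Definition has_output (s : state) (output : seq nat) : Prop :=
  forall i, i < size output -> mem s i = nth 0 output i.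

(* n, |Y| = m, the adjacency matrix of G, the Y-by-X adjacency matrix of H;
   matrices row by row. *)
Definition encode_input (n m : nat)
    (G : sgraph 'I_n) (H : sgraph ('I_n + 'I_m)%type) : seq nat :=
  n :: m :: [seq nat_of_bool (G u v) | u <- enum 'I_n, v <- enum 'I_n]
    ++ [seq nat_of_bool (H (inr y) (inl x)) | y <- enum 'I_m, x <- enum 'I_n].

(* The number k of nodes, the adjacency matrix of T, the node-by-vertex
   incidence matrix of the bags. *)
Definition encode_td (n k : nat)
    (T : sgraph 'I_k) (X : 'I_k -> {set 'I_n}) : seq nat :=
  k :: [seq nat_of_bool (T s t) | s <- enum 'I_k, t <- enum 'I_k]
    ++ [seq nat_of_bool (v \in X t) | t <- enum 'I_k, v <- enum 'I_n].

(* Main.v *)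
Require Import Defs.
From mathcomp Require Import all_boot all_order all_algebra.
From mathcomp Require Import boolp reals.
From mathcomp Require Import zify lra.

(* Keep only the lakes that join a pair of nations for the first time.  The bipartite graph
   of nations and kept lakes has O(n^2) vertices and still lies on the surface, so, by
   Euler's formula, it has no K_{3,q} minor for q > 2g + 2.  As in the separator theorem of
   Alon, Seymour and Thomas, grow two connected clusters A and B next to the component b
   holding more than half of the nations.  If b contains a short path between them, the path
   becomes a leaf; leaves meeting A, B and b form a K_{3,q} minor, so there are few of them.
   Otherwise some layer of b around A holds few nations and can be cut.  This gives every
   connected piece with k nations a balanced separator of O(sqrt(gk)) vertices.

   Removing separators repeatedly yields a tree; the bag of a node consists of the nations
   lying in, or on a lake of, the separators of its ancestors.  Each vertex of a separator
   accounts for a clique of the bag, so the independence number of the bag is a geometric sum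
   of the sizes of these separators, that is O(sqrt(gn)).  Surfaces matter only through the
   excluded minor: the algorithm never sees an embedding. *)

Set Implicit Arguments.
Unset Strict Implicit.
Unset Printing Implicit Defensive.

(** * Counting orbits *)

Lemma odd_card_involution (T : finType) (h : T -> T) (A : {set T}) :
  involutive h -> (forall x, h x != x) -> (forall x, x \in A -> h x \in A) ->
  ~~ odd #|A|.
Proof.
move=> hK hN; move: {2}#|A| (leqnn #|A|) => n.
elim: n A => [|n IHn] A; first by rewrite leqn0 => /eqP ->.
case: (set_0Vmem A) => [->|[x xA] leA hA]; first by rewrite cards0.
have hxA : h x \in A :\ x by rewrite !inE hN hA.
rewrite (cardsD1 x A) xA (cardsD1 (h x) (A :\ x)) hxA /= negbK.
apply: IHn.
  by move: leA; rewrite (cardsD1 x A) xA (cardsD1 (h x) (A :\ x)) hxA; lia.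
move=> y; rewrite !inE => /and3P[yhx yx yA].
by rewrite (inj_eq (can_inj hK)) yx hA // andbT; apply: contraNneq yhx => <-; rewrite hK.
Qed.

Section Link.
Variable T : finType.
Implicit Types (e : rel T) (l : seq (T * T)).

Definition link e l : rel T :=
  [rel x y | [|| e x y, (x, y) \in l | (y, x) \in l]].

Lemma link_sym e l : symmetric e -> symmetric (link e l).
Proof. by move=> se x y; rewrite /link /= se [in RHS](orbC ((y, x) \in l)). Qed.

Lemma connect_ind e (P : T -> Prop) x y :
  (forall a b, e a b -> P a -> P b) -> connect e x y -> P x -> P y.
Proof.
move=> He /connectP[p pp ->]; elim: p x pp => //= z p IHp x /andP[xz pz] Px.
by apply: IHp pz _; apply: He Px.
Qed.

Lemma connect_link1 e a b x y : symmetric e ->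
  connect (link e [:: (a, b)]) x y ->
  connect e x y \/ (connect e a x \/ connect e b x) /\ (connect e a y \/ connect e b y).
Proof.
move=> se cxy.
pose P z := connect e x z \/
  (connect e a x \/ connect e b x) /\ (connect e a z \/ connect e b z).
apply: (connect_ind (P := P) _ cxy); last by left; exact: connect0.
rewrite {}/P; have cs := sym_connect_sym se.
move=> u v; rewrite /link /= !inE => /or3P[uv|/eqP[-> ->]|/eqP[-> ->]].
- have cuv := connect1 uv.
  case=> [xu|[ax [au|bu]]]; first by left; exact: connect_trans xu cuv.
  + by right; split=> //; left; exact: connect_trans au cuv.
  + by right; split=> //; right; exact: connect_trans bu cuv.
- case=> [xu|[ax _]]; right; split=> //; try by right; exact: connect0.
  by left; rewrite cs.
- case=> [xu|[ax _]]; right; split=> //; try by left; exact: connect0.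
  by right; rewrite cs.
Qed.

Lemma n_comp_link1 e a b : symmetric e ->
  n_comp e T <= n_comp (link e [:: (a, b)]) T + 1.
Proof.
move=> se; set e' := link _ _.
have cs := sym_connect_sym se; have cs' := sym_connect_sym (link_sym [:: (a, b)] se).
pose A := [set x | roots e x & x != fingraph.root e b].
have leA : n_comp e T <= #|A| + 1.
  apply: leq_trans (_ : #|A :|: [set fingraph.root e b]| <= _).
    by apply/subset_leq_card/subsetP => x; rewrite !inE andbT => ->; rewrite orNb.
  by apply: leq_trans (leq_card_setU _ _) _; rewrite cards1.
apply: leq_trans leA _; rewrite leq_add2r.
rewrite -(@card_in_imset _ _ (fingraph.root e') A) => [|x y].
  by apply/subset_leq_card/subsetP=> _ /imsetP[x _ ->]; rewrite !inE andbT roots_root.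
rewrite !inE => /andP[/eqP rx xb] /andP[/eqP ry yb] /(fingraph.rootP cs') /(connect_link1 se) H.
have nb z : fingraph.root e z = z -> z != fingraph.root e b -> connect e b z -> False.
  by move=> rz zb /(fingraph.rootP cs) Eb; rewrite -rz Eb eqxx in zb.
suff /(fingraph.rootP cs) : connect e x y by rewrite rx ry.
case: H => // -[[ax|/nb-/(_ rx xb)//] [ay|/nb-/(_ ry yb)//]].
by rewrite cs in ax; exact: connect_trans ax ay.
Qed.

Lemma n_comp_link e l : symmetric e -> n_comp e T <= n_comp (link e l) T + size l.
Proof.
move=> se; elim: l => [|[a b] l IHl].
  by rewrite addn0 (@eq_n_comp _ e (link e [::])) //; apply: eq_connect => x y; rewrite /link /= !orbF.
apply: leq_trans IHl _; rewrite /= addnS -addSn leq_add2r.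
apply: leq_trans (n_comp_link1 a b (link_sym l se)) _; rewrite addn1 ltnS.
rewrite (@eq_n_comp _ (link (link e l) [:: (a, b)]) (link e ((a, b) :: l))) //.
apply: eq_connect => x y; rewrite /link /= !inE -!orbA; congr (_ || _).
by rewrite orbCA orbA orbC -!orbA; do ![case: (_ == _) | case: (_ \in _)].
Qed.

Lemma connect_closedP e (A : pred T) x y : connect e x y ->
  (forall u v, e u v -> A u -> A v) -> A x -> A y.
Proof. by move=> cxy HA; apply: (connect_ind (P := A)) cxy => u v; apply: HA. Qed.

End Link.

(** * Euler characteristic and K_{3,q} *)

Lemma n_comp_lt (T : finType) (e e' : rel T) x y :
  symmetric e -> symmetric e' -> subrel e (connect e') ->
  connect e' x y -> ~~ connect e x y -> n_comp e' T < n_comp e T.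
Proof.
move=> se se' sub cxy ncxy.
have cs := sym_connect_sym se; have cs' := sym_connect_sym se'.
have csub := connect_sub sub.
pose r := fingraph.root e; pose A := [set r z | z in [set z | roots e' z]].
have inA z : r z \in A -> r z = r (fingraph.root e' z).
  case/imsetP=> w; rewrite inE => /eqP rw E; rewrite [LHS]E; congr r.
  rewrite -{1}rw; apply/(fingraph.rootP cs'); rewrite cs'.
  by apply: csub; apply/(fingraph.rootP cs).
have cardA : #|A| = n_comp e' T.
  rewrite card_in_imset => [|z w]; first by apply: eq_card => z; rewrite !inE andbT.
  rewrite !inE => /eqP rz /eqP rw /(fingraph.rootP cs) /csub /(fingraph.rootP cs').
  by rewrite rz rw.
have subA : A \subset roots e.
  by apply/subsetP => _ /imsetP[z _ ->]; rewrite inE roots_root.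
have [w rw wA] : exists2 w, roots e w & w \notin A.
  have [xA|] := boolP (r x \in A); last by exists (r x); rewrite ?roots_root.
  have [yA|] := boolP (r y \in A); last by exists (r y); rewrite ?roots_root.
  case/negP: ncxy; apply/(fingraph.rootP cs); rewrite -/r (inA _ xA) (inA _ yA).
  by congr r; apply/(fingraph.rootP cs').
rewrite -cardA; apply: proper_card; apply/properP; split.
  by apply/subsetP=> z /(subsetP subA) rz; rewrite inE andbT.
by exists w; rewrite ?inE ?andbT.
Qed.

Lemma uniq_map_rem (T : eqType) (U : eqType) (h : T -> U) (s : seq T) :
  (forall x, x \in s -> h x \notin map h (rem x s)) -> uniq (map h s).
Proof.
elim: s => //= a s IHs H; have := H a (mem_head a s); rewrite /= eqxx => Ha.
rewrite Ha IHs // => x xs; have := H x; rewrite inE xs orbT => /(_ isT) /=.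
have [ax|] := eqVneq a x; first by move: Ha; rewrite ax map_f.
by rewrite /= inE negb_or => _ /andP[].
Qed.

Section EulerBound.
Variable S : surface.
Local Notation Fl := (flag S).
Local Notation f0 := (@flip0 S).
Local Notation f1 := (@flip1 S).
Local Notation f2 := (@flip2 S).
Local Notation vr := (@vertex_rel S).
Local Notation er := (@edge_rel S).
Local Notation fr := (@face_rel S).

Lemma eq_flipC (h : Fl -> Fl) x y : involutive h -> (y == h x) = (x == h y).
Proof. by move=> hK; apply/eqP/eqP => ->; rewrite hK. Qed.

Lemma vertex_sym : symmetric vr.
Proof.
by move=> x y; rewrite /vertex_rel /= (eq_flipC x y (@flip1K S)) (eq_flipC x y (@flip2K S)).
Qed.

Lemma edge_sym : symmetric er.
Proof.
by move=> x y; rewrite /edge_rel /= (eq_flipC x y (@flip0K S)) (eq_flipC x y (@flip2K S)).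
Qed.

Lemma face_sym : symmetric fr.
Proof.
by move=> x y; rewrite /face_rel /= (eq_flipC x y (@flip0K S)) (eq_flipC x y (@flip1K S)).
Qed.

Definition edge_of (x : Fl) : Fl := fingraph.root er x.

Lemma edge_ofP x y : edge_of x = edge_of y -> y \in [:: x; f0 x; f2 x; f0 (f2 x)].
Proof.
move/(fingraph.rootP (sym_connect_sym edge_sym)) => cxy.
have C u : f2 (f0 u) = f0 (f2 u) by rewrite flip02C.
pose A y := [|| y == x, y == f0 x, y == f2 x | y == f0 (f2 x)].
suff: A y by rewrite !inE.
apply: (connect_closedP (A := A) cxy); last by rewrite /A eqxx.
have K0 := @flip0K S; have K2 := @flip2K S.
move=> u v /orP[]/eqP -> /or4P[]/eqP ->; apply/or4P.
- by constructor 2.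
- by rewrite K0; constructor 1.
- by constructor 4.
- by rewrite K0; constructor 3.
- by constructor 3.
- by rewrite C; constructor 4.
- by rewrite K2; constructor 1.
- by rewrite C K2; constructor 2.
Qed.

Lemma edge_of0 x : edge_of (f0 x) = edge_of x.
Proof.
apply/(fingraph.rootP (sym_connect_sym edge_sym))/connect1.
by rewrite /edge_rel /= flip0K eqxx.
Qed.

Lemma edge_of2 x : edge_of (f2 x) = edge_of x.
Proof.
apply/(fingraph.rootP (sym_connect_sym edge_sym))/connect1.
by rewrite /edge_rel /= flip2K eqxx orbT.
Qed.

Definition one_sided (Q R : {set Fl}) := [set y in Q | (y \in R) && (f2 y \notin R)].

(* Around each vertex cell the sides in and out of R alternate an even number of times. *)
Lemma even_one_sided (Q R : {set Fl}) :
  (forall x, x \in Q -> f1 x \in Q) -> (forall x, x \in Q -> f2 x \in Q) ->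
  (forall x, x \in R -> f1 x \in R) -> ~~ odd #|one_sided Q R|.
Proof.
move=> Q1 Q2 R1.
have eQR : ~~ odd #|Q :&: R|.
  apply: (odd_card_involution (@flip1K S) (@flip1_neq S)) => x.
  by rewrite !inE => /andP[/Q1-> /R1->].
have eI : ~~ odd #|[set y in Q :&: R | f2 y \in R]|.
  apply: (odd_card_involution (@flip2K S) (@flip2_neq S)) => x.
  by rewrite !inE flip2K => /andP[/andP[/Q2-> ->] ->].
move: eQR; rewrite -(cardsID [set y | f2 y \in R] (Q :&: R)).
rewrite (_ : (Q :&: R) :&: [set y | f2 y \in R] = [set y in Q :&: R | f2 y \in R]);
  last by apply/setP => y; rewrite !inE.
rewrite (_ : (Q :&: R) :\: [set y | f2 y \in R] = one_sided Q R);
  last by apply/setP => y; rewrite !inE [RHS]andbA andbC.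
by rewrite oddD (negbTE eI).
Qed.

Lemma even_one_sidedD (Q R : {set Fl}) (D : {pred Fl}) :
  (forall x, x \in Q -> f1 x \in Q) -> (forall x, x \in Q -> f2 x \in Q) ->
  (forall x, x \in R -> f0 x \in R) -> (forall x, x \in R -> f1 x \in R) ->
  (forall x, x \in one_sided Q R -> x \notin D -> (f0 x \in Q) && (f0 x \notin D)) ->
  ~~ odd #|one_sided Q R :&: [set x in D]|.
Proof.
move=> Q1 Q2 R0 R1 HD; have := even_one_sided Q1 Q2 R1.
rewrite -(cardsID [set x in D] (one_sided Q R)) oddD.
rewrite (negbTE (_ : ~~ odd #|_ :\: _|)) ?addbF //.
apply: (odd_card_involution (@flip0K S) (@flip0_neq S)) => x.
rewrite !inE => /and4P[xD xQ xR x2R].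
have xO : x \in one_sided Q R by rewrite inE xQ xR.
case/andP: (HD x xO xD) => -> ->; rewrite R0 //=.
by apply: contra x2R => /R0; rewrite flip02C flip0K.
Qed.

Section Model.
Variables (q : nat) (B : 'I_3 + 'I_q -> {set Fl}).
Local Notation I := ('I_3 + 'I_q)%type.
Hypothesis q_gt0 : 0 < q.
Hypothesis B_disj : forall i j x y, x \in B i -> y \in B j -> connect vr x y -> i = j.
Hypothesis B_conn : forall i x y, x \in B i -> y \in B i ->
  connect [rel a b | vr a b || [&& b == f0 a, a \in B i & b \in B i]] x y.
Hypothesis B_adj : forall a l, [exists x, (x \in B (inl a)) && (f0 x \in B (inr l))].

Definition joined (M : seq Fl) : rel Fl := link vr [seq (x, f0 x) | x <- M].

Lemma joined_sym M : symmetric (joined M).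
Proof. exact/link_sym/vertex_sym. Qed.

Lemma connect_joined M : connect_sym (joined M).
Proof. exact/sym_connect_sym/joined_sym. Qed.

Lemma vertex_joined M : subrel vr (joined M).
Proof. by move=> x y; rewrite /joined /link /= => ->. Qed.

Lemma joined_mem M x : x \in M -> joined M x (f0 x).
Proof. by move=> xM; rewrite /joined /link /= (map_f (fun x => (x, f0 x)) xM) orbT. Qed.

Lemma joined_cons M x : joined (x :: M) =2 link (joined M) [:: (x, f0 x)].
Proof.
move=> y z; rewrite /joined /link /= !inE -!orbA; congr (_ || _).
by do ![case: (_ == _) | case: (_ \in _)].
Qed.

Lemma joined_perm M M' : M =i M' -> joined M =2 joined M'.
Proof.
move=> eM y z; rewrite /joined /link /=.
by rewrite !(eq_mem_map (fun x => (x, f0 x)) eM).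
Qed.

Lemma joined_edge M x y : edge_of x = edge_of y -> connect (joined M) x (f0 x) ->
  connect (joined M) y (f0 y).
Proof.
have sC := connect_joined M; have C u : f2 (f0 u) = f0 (f2 u) by rewrite flip02C.
have c2 u : connect (joined M) u (f2 u).
  by apply/connect1/vertex_joined; rewrite /vertex_rel /= eqxx orbT.
have K0 := @flip0K S.
have c02 : connect (joined M) x (f0 x) -> connect (joined M) (f2 x) (f0 (f2 x)).
  move=> cx; apply: connect_trans (_ : connect _ _ x) _; first by rewrite sC c2.
  by apply: connect_trans cx _; rewrite -C c2.
move=> /edge_ofP; rewrite !inE => /or4P[]/eqP -> // cx.
- by rewrite K0 sC.
- by rewrite K0 sC c02.
Qed.

Definition forest (M : seq Fl) : Prop :=
  n_comp (joined M) Fl + size M = n_comp vr Fl /\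
  (forall i j x y, x \in B i -> y \in B j -> connect (joined M) x y -> i = j).

Lemma n_comp_joined M : n_comp vr Fl <= n_comp (joined M) Fl + size M.
Proof. by have := n_comp_link [seq (x, f0 x) | x <- M] vertex_sym; rewrite size_map. Qed.

Lemma ex_max_forest : exists M, forest M /\ forall M', forest M' -> size M' <= size M.
Proof.
pose P n := `[< exists M, forest M /\ size M = n >].
have exP : exists n, P n.
  exists 0; apply/asboolP; exists [::]; split=> //.
  have e : joined [::] =2 vr by move=> x y; rewrite /joined /link /= !orbF.
  split; first by rewrite addn0 (@eq_n_comp _ _ vr) //; apply: eq_connect.
  by move=> i j x y Bx By; rewrite (eq_connect e); apply: B_disj.
have ubP n : P n -> n <= n_comp vr Fl by move=> /asboolP[M [[<- _] <-]]; apply: leq_addl.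
have [n /asboolP[M [fM sM]] maxn] := ex_maxnP exP ubP.
exists M; split=> // M' fM'; rewrite sM; apply: maxn.
by apply/asboolP; exists M'.
Qed.

Section Forest.
Variable M : seq Fl.
Hypothesis fM : forest M.
Hypothesis maxM : forall M', forest M' -> size M' <= size M.
Local Notation J := (joined M).
Let cs := connect_joined M.

Lemma forest_max x : connect J x (f0 x) \/ exists i j y z,
  [/\ i <> j, y \in B i, z \in B j, connect J x y & connect J (f0 x) z].
Proof.
have [|nc] := boolP (connect J x (f0 x)); [by left | right].
apply: contrapT => H; suff: forest (x :: M) by move/maxM; rewrite ltnn.
have eJ := joined_cons M x; have ecJ := eq_connect eJ.
split.
  apply/eqP; rewrite eqn_leq n_comp_joined andbT -fM.1 /= addnS -addSn leq_add2r.
  apply: (@n_comp_lt _ J _ x (f0 x)) => //; try exact: joined_sym.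
    move=> y z yz; rewrite ecJ; apply/connect1; rewrite /link /=.
    by move: yz => ->.
  by apply/connect1/joined_mem/mem_head.
move=> i j y z By Bz; rewrite ecJ => /(connect_link1 (joined_sym M)).
case=> [|[cy cz]]; first exact: fM.2 By Bz.
apply: contrapT => nij.
case: cy cz => cy [] cz.
- by apply: nij; apply: fM.2 By Bz _; apply: connect_trans _ cz; rewrite cs.
- by apply: H; exists i, j, y, z.
- by apply: H; exists j, i, z, y; split=> // eij; apply: nij.
- by apply: nij; apply: fM.2 By Bz _; apply: connect_trans _ cz; rewrite cs.
Qed.

Lemma forest_cover x : exists i, [exists y in B i, connect J x y].
Proof.
apply: contrapT => H.
have nH i y : y \in B i -> ~~ connect J x y.
  by move=> By; apply/negP => c; apply: H; exists i; apply/existsP; exists y; rewrite By.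
have all y : connect J x y.
  apply: (connect_closedP (A := connect J x) (flag_connected x y)); last exact: connect0.
  move=> u v uv cu; case/or3P: uv => /eqP ->.
  - case: (forest_max u) => [cu0|[i [j [z [w [_ Bz _ cz _]]]]]]; first exact: connect_trans cu cu0.
    by have := nH _ _ Bz; rewrite (connect_trans cu cz).
  - by apply: connect_trans cu (connect1 (vertex_joined _ _)); rewrite /vertex_rel /= eqxx.
  - by apply: connect_trans cu (connect1 (vertex_joined _ _)); rewrite /vertex_rel /= eqxx orbT.
have /existsP[y /andP[By _]] := B_adj ord0 (Ordinal q_gt0).
by have := nH _ _ By; rewrite all.
Qed.

Lemma forest_class i x y : x \in B i -> y \in B i -> connect J x y.
Proof.
move=> Bx By; apply: (connect_ind (P := connect J x) _ (B_conn Bx By)); last exact: connect0.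
move=> u v /orP[uv|/and3P[/eqP -> Bu Bv]] cu.
  exact: connect_trans cu (connect1 (vertex_joined _ uv)).
case: (forest_max u) => [cu0|[j [k [z [w [njk Bz Bw cz cw]]]]]].
  exact: connect_trans cu cu0.
by case: njk; rewrite -(fM.2 _ _ _ _ Bu Bz cz) -(fM.2 _ _ _ _ Bv Bw cw).
Qed.

Definition color (x : Fl) : I :=
  odflt (inl ord0) [pick i | [exists y in B i, connect J x y]].

Lemma colorP x : exists2 y, y \in B (color x) & connect J x y.
Proof.
rewrite /color; case: pickP => [i /existsP[y /andP[]]|H]; first by exists y.
by have [i] := forest_cover x; rewrite H.
Qed.

Lemma color_eq x y : (color x == color y) = connect J x y.
Proof.
have [u Bu cu] := colorP x; have [v Bv cv] := colorP y.
apply/eqP/idP => [E|c].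
  apply: connect_trans cu _; rewrite cs; apply: connect_trans cv _.
  by apply: forest_class Bv _; rewrite -E.
apply: fM.2 Bu Bv _; apply: connect_trans (connect_trans c cv).
by rewrite cs.
Qed.

Lemma colorB i x : x \in B i -> color x = i.
Proof. by move=> Bx; have [u Bu cu] := colorP x; apply: esym; apply: fM.2 Bx Bu cu. Qed.

Lemma n_comp_forest : n_comp J Fl <= q + 3.
Proof.
have -> : q + 3 = #|{: I}| by rewrite card_sum !card_ord addnC.
have -> : n_comp J Fl = #|[set x | roots J x]|.
  by apply: eq_card => x; rewrite !inE andbT.
rewrite -(@card_in_imset _ _ color) ?max_card // => x y.
rewrite !inE => /eqP rx /eqP ry /eqP; rewrite color_eq => /(fingraph.rootP cs).
by rewrite rx ry.
Qed.

Lemma bridge x : x \in M -> ~~ connect (joined (rem x M)) x (f0 x).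
Proof.
move=> xM; apply/negP => c; set M' := rem x M.
have eM : M =i x :: M' by apply: perm_mem; apply: perm_to_rem.
have := n_comp_joined M'; rewrite -fM.1 size_rem //.
rewrite (@eq_n_comp _ J (joined M')) //; last first.
  move=> y z; rewrite (eq_connect (joined_perm eM)) (eq_connect (joined_cons M' x)).
  have sJ := joined_sym M'; have cJ := connect_joined M'.
  apply/idP/idP => [/(connect_link1 sJ)|cyz].
    have to v : connect (joined M') x v \/ connect (joined M') (f0 x) v ->
        connect (joined M') x v by case=> // /(connect_trans c).
    by case=> [//|[/to cy /to]]; apply: connect_trans; rewrite cJ.
  by apply: connect_sub cyz => u v uv; apply/connect1; rewrite /link /= uv.
by case: (M) xM => //= a l _; lia.
Qed.

Lemma forest_edges_uniq : uniq (map edge_of M).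
Proof.
apply: uniq_map_rem => x xM; apply/mapP => -[y yM' E].
by have := bridge xM; rewrite (joined_edge (esym E)) //; apply/connect1/joined_mem.
Qed.

Definition cross (p : 'I_3 * 'I_q) : Fl := xchoose (existsP (B_adj p.1 p.2)).

Lemma color_flip2 x : color (f2 x) = color x.
Proof.
apply/eqP; rewrite color_eq cs; apply/connect1/vertex_joined.
by rewrite /vertex_rel /= eqxx orbT.
Qed.

Lemma color_cross p : color (cross p) = inl p.1.
Proof. by apply: colorB; have /andP[] := xchooseP (existsP (B_adj p.1 p.2)). Qed.

Lemma color_cross0 p : color (f0 (cross p)) = inr p.2.
Proof. by apply: colorB; have /andP[] := xchooseP (existsP (B_adj p.1 p.2)). Qed.

Lemma edge_cross p x : edge_of x = edge_of (cross p) ->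
  (x = cross p \/ x = f2 (cross p)) /\ color x = inl p.1 \/
  (x = f0 (cross p) \/ x = f2 (f0 (cross p))) /\ color x = inr p.2.
Proof.
move=> E; have := edge_ofP (esym E); rewrite !inE => /or4P[]/eqP ->.
- by left; rewrite color_cross; split=> //; left.
- by right; rewrite color_cross0; split=> //; left.
- by left; rewrite color_flip2 color_cross; split=> //; right.
- by rewrite flip02C; right; rewrite color_flip2 color_cross0; split=> //; right.
Qed.

Lemma edge_cross_inj : injective (edge_of \o cross).
Proof.
move=> [a l] [b k] /= E; have := color_cross (a, l); have := color_cross0 (a, l).
case: (edge_cross E) => -[_ ->] //= _ [->].
have E0 : edge_of (f0 (cross (a, l))) = edge_of (cross (b, k)) by rewrite edge_of0.
by have := color_cross0 (a, l); case: (edge_cross E0) => -[_ ->] //= [->].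
Qed.

Lemma cross_notin_forest p : edge_of (cross p) \notin map edge_of M.
Proof.
apply/mapP => -[y yM E].
have : connect J (cross p) (f0 (cross p)).
  by apply: joined_edge (esym E) _; apply/connect1/joined_mem.
by rewrite -color_eq color_cross color_cross0.
Qed.

Definition drawn : seq Fl := M ++ map cross (enum {: 'I_3 * 'I_q}).

Lemma drawn_uniq : uniq (map edge_of drawn).
Proof.
rewrite map_cat cat_uniq forest_edges_uniq -map_comp map_inj_uniq ?enum_uniq; last exact: edge_cross_inj.
rewrite andbT; apply/hasPn => _ /mapP[p _ ->]; exact: cross_notin_forest.
Qed.

Definition undrawn : seq Fl := enum [set x | roots er x & x \notin map edge_of drawn].

Lemma size_undrawn : size undrawn + (size M + 3 * q) = n_comp er Fl.
Proof.
have -> : size M + 3 * q = size (map edge_of drawn).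
  by rewrite size_map size_cat size_map -cardE card_prod !card_ord.
rewrite -cardE -(card_uniqP drawn_uniq) addnC.
have -> : n_comp er Fl = #|[set x | roots er x]|.
  by apply: eq_card => x; rewrite !inE andbT.
rewrite -(cardsID [set x in map edge_of drawn] [set x | roots er x]); congr addn.
  apply: eq_card => x; rewrite !inE andb_idl // => /mapP[y _ ->].
  exact/roots_root/sym_connect_sym/edge_sym.
by apply: eq_card => x; rewrite !inE andbC.
Qed.

Definition region_rel : rel Fl := link fr [seq (x, f2 x) | x <- undrawn].

Lemma region_sym : symmetric region_rel.
Proof. exact/link_sym/face_sym. Qed.

Lemma n_comp_region : n_comp fr Fl <= n_comp region_rel Fl + size undrawn.
Proof. by have := n_comp_link [seq (x, f2 x) | x <- undrawn] face_sym; rewrite size_map. Qed.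

Let csr := sym_connect_sym region_sym.

Fact region_key : unit. Proof. by []. Qed.
Definition region z : {set Fl} := locked_with region_key [set y | connect region_rel z y].

Lemma in_region z y : (y \in region z) = connect region_rel z y.
Proof. by rewrite /region locked_withE inE. Qed.

Lemma region0 z x : (f0 x \in region z) = (x \in region z).
Proof.
rewrite !in_region -!(csr _ z); apply: (same_connect csr); apply/connect1.
by rewrite /region_rel /link /face_rel /= flip0K eqxx.
Qed.

Lemma region1 z x : (f1 x \in region z) = (x \in region z).
Proof.
rewrite !in_region -!(csr _ z); apply: (same_connect csr); apply/connect1.
by rewrite /region_rel /link /face_rel /= flip1K eqxx orbT.
Qed.

Lemma region2_edge z x y : edge_of x = edge_of y ->
  (f2 x \in region z) = (x \in region z) -> (f2 y \in region z) = (y \in region z).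
Proof.
have C u : f2 (f0 u) = f0 (f2 u) by rewrite flip02C.
have K2 := @flip2K S.
move=> /edge_ofP; rewrite !inE => /or4P[]/eqP -> // E.
- by rewrite C !region0.
- by rewrite K2.
- by rewrite C K2 !region0.
Qed.

Lemma region2 z x : edge_of x \notin map edge_of drawn -> (f2 x \in region z) = (x \in region z).
Proof.
move=> nx; apply: (@region2_edge _ (edge_of x)).
  by rewrite {1}/edge_of root_root //; exact/sym_connect_sym/edge_sym.
rewrite !in_region -!(csr _ z); apply: (same_connect csr); rewrite csr; apply/connect1.
rewrite /region_rel /link /= (map_f (fun x => (x, f2 x))) ?orbT //.
rewrite mem_enum inE nx andbT; exact/roots_root/sym_connect_sym/edge_sym.
Qed.

Definition unbalanced z : {set 'I_3 * 'I_q} :=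
  [set p | (f2 (cross p) \in region z) != (cross p \in region z)].

Lemma one_sided_drawn z Q x : x \in one_sided Q (region z) -> edge_of x \in map edge_of drawn.
Proof.
rewrite inE => /and3P[_ xR x2R]; apply: contraTT x2R => /(region2 z) ->.
by rewrite xR.
Qed.

Lemma joined_closed M' (Q : {set Fl}) : (forall u v, u \in Q -> joined M' u v -> v \in Q) ->
  (forall x, x \in Q -> f1 x \in Q) * (forall x, x \in Q -> f2 x \in Q).
Proof.
move=> H; split=> x xQ; apply: H xQ (vertex_joined _ _);
  by rewrite /vertex_rel /= eqxx ?orbT.
Qed.

(* If no crossing edge is one-sided, neither is a forest edge [x0]: the component of
   [x0] in the forest without [x0] has an even number of one-sided edge ends. *)
Lemma unbalanced_neq0 z : region z != setT -> unbalanced z != set0.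
Proof.
apply: contraNneq => U0.
have bal p : (f2 (cross p) \in region z) = (cross p \in region z).
  by apply/eqP; move/setP/(_ p): U0; rewrite !inE => /negbFE.
have balM x0 : x0 \in M -> (f2 x0 \in region z) = (x0 \in region z).
  move=> x0M; apply/eqP; apply: contraT => nb.
  set M' := rem x0 M; pose Q := [set y | connect (joined M') x0 y].
  have clQ u v : u \in Q -> joined M' u v -> v \in Q.
    by rewrite !inE => cu uv; apply: connect_trans cu (connect1 uv).
  have [Q1 Q2] := joined_closed clQ.
  have x0Q : x0 \in Q by rewrite inE connect0.
  have nQ : f0 x0 \notin Q by rewrite inE bridge.
  have nQ2 : f2 (f0 x0) \notin Q.
    by apply: contra nQ => /Q2; rewrite flip2K.
  have nQ02 : f0 (f2 x0) \notin Q by rewrite flip02C.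
  have R0 x : x \in region z -> f0 x \in region z by rewrite region0.
  have R1 x : x \in region z -> f1 x \in region z by rewrite region1.
  have : ~~ odd #|one_sided Q (region z) :&: [set x in [pred y | edge_of y == edge_of x0]]|.
    apply: even_one_sidedD => // x xO; rewrite !inE edge_of0 => nx; rewrite nx andbT.
    have := one_sided_drawn xO; rewrite map_cat mem_cat => /orP[/mapP[y yM E]|/mapP[y /mapP[p _ ->] E]].
      have yM' : y \in M'.
        have : y \in x0 :: M' by rewrite -(perm_mem (perm_to_rem x0M)).
        by rewrite inE => /predU1P[yx|//]; rewrite E yx eqxx in nx.
      move: xO; rewrite inE => /andP[]; rewrite !inE => cx _.
      apply: connect_trans cx _; apply: joined_edge (esym E) _.
      exact/connect1/joined_mem.
    have := region2_edge (esym E) (bal p); move: xO.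
    by rewrite inE => /and3P[_ xR x2R] e; rewrite e xR in x2R.
  suff -> : one_sided Q (region z) :&: [set x in [pred y | edge_of y == edge_of x0]] =
      [set if x0 \in region z then x0 else f2 x0] by rewrite cards1.
  apply/setP => y; rewrite !inE; apply/idP/eqP => [/andP[/and3P[cy yR y2R] /eqP E]|->].
    have yQ : y \in Q by rewrite inE.
    have := edge_ofP (esym E); rewrite !inE => /or4P[]/eqP yE.
    - by rewrite yE in yR *; rewrite yR.
    - by rewrite yE (negbTE nQ) in yQ.
    - have : x0 \notin region z by move: y2R; rewrite yE flip2K.
      by rewrite yE => /negbTE ->.
    - by rewrite yE (negbTE nQ02) in yQ.
  have := nb; case: ifP => [x0R|x0R].
    by rewrite connect0 eqxx x0R andbT eqb_id.
  by rewrite flip2K edge_of2 eqxx x0R andbT /= eqbF_neg negbK => ->; have := Q2 _ x0Q; rewrite inE => ->.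
have R2 x : (f2 x \in region z) = (x \in region z).
  have [|/region2 //] := boolP (edge_of x \in map edge_of drawn).
  rewrite map_cat mem_cat => /orP[/mapP[y yM E]|/mapP[y /mapP[p _ ->] E]].
    exact: region2_edge (esym E) (balM _ yM).
  exact: region2_edge (esym E) (bal p).
apply/eqP/setP => x; rewrite in_setT.
apply: (connect_closedP (A := mem (region z)) (flag_connected z x)); last by rewrite /= in_region connect0.
by move=> u v /or3P[]/eqP -> /=; rewrite ?R2 ?region0 ?region1.
Qed.

Lemma unbalanced_step z i x p : x \in region z -> f2 x \notin region z -> color x = i ->
  edge_of x = edge_of (cross p) -> exists y p',
  [/\ y \in region z, f2 y \notin region z, color y = i, edge_of y = edge_of (cross p') & y != x].
Proof.
move=> xR x2R cx E; pose Q := [set y | color y == i].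
have clQ u v : u \in Q -> joined M u v -> v \in Q.
  by rewrite !inE => /eqP <- uv; rewrite eq_sym color_eq connect1.
have [Q1 Q2] := joined_closed clQ.
have R0 u : u \in region z -> f0 u \in region z by rewrite region0.
have R1 u : u \in region z -> f1 u \in region z by rewrite region1.
pose D : {pred Fl} := [pred y | edge_of y \notin map edge_of M].
have ev : ~~ odd #|one_sided Q (region z) :&: [set y in D]|.
  apply: even_one_sidedD => // y yO; rewrite !inE negbK edge_of0 => /[dup] yM ->; rewrite andbT.
  move: yO yM; rewrite inE => /andP[]; rewrite inE => /eqP <- _ /mapP[m mM Em].
  by rewrite eq_sym color_eq; apply: joined_edge (esym Em) _; apply/connect1/joined_mem.
have xO : x \in one_sided Q (region z) :&: [set y in D].
  by rewrite in_setI [_ \in one_sided _ _]inE xR x2R !inE cx eqxx E cross_notin_forest.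
have [y] : exists y, y \in (one_sided Q (region z) :&: [set y in D]) :\ x.
  apply/set0Pn; apply: contraNneq ev => D0.
  by rewrite (cardsD1 x) xO D0 cards0.
rewrite in_setD1 in_setI => /and3P[yx yO yD].
have := one_sided_drawn yO; rewrite map_cat mem_cat; move: yD; rewrite !inE => /negbTE -> /= /mapP[_ /mapP[p' _ ->] E'].
move: yO; rewrite [_ \in one_sided _ _]inE => /and3P[]; rewrite inE => /eqP cy yR y2R.
by exists y, p'.
Qed.

Lemma unbalancedP z x p : edge_of x = edge_of (cross p) -> x \in region z ->
  f2 x \notin region z -> p \in unbalanced z.
Proof.
move=> E xR x2R; rewrite [_ \in _]inE; apply: contraNneq x2R => e.
by rewrite (region2_edge (esym E) e).
Qed.

Lemma unbalanced_side z p : p \in unbalanced z -> exists x,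
  [/\ x = cross p \/ x = f2 (cross p), x \in region z & f2 x \notin region z].
Proof.
rewrite [_ \in unbalanced _]inE; have [cR|cR] := boolP (cross p \in region z) => H.
  by exists (cross p); split=> //; [left | move: H; case: (_ \in _)].
by exists (f2 (cross p)); rewrite flip2K; split=> //; [right | move: H; case: (_ \in _)].
Qed.

Lemma unbalanced_left z a l : (a, l) \in unbalanced z -> exists2 l', l' != l & (a, l') \in unbalanced z.
Proof.
case/unbalanced_side=> x [Hx xR x2R].
have cx : color x = inl a by case: Hx => ->; rewrite ?color_flip2 color_cross.
have ex : edge_of x = edge_of (cross (a, l)) by case: Hx => ->; rewrite ?edge_of2.
have [y [[a' l'] [yR y2R cy ey yx]]] := unbalanced_step xR x2R cx ex.
case: (edge_cross ey) => -[]; rewrite cy //= => Hy [Ea]; rewrite -{a'}Ea in ey Hy *.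
exists l'; last exact: unbalancedP ey yR y2R.
apply: contraNneq yx => El; rewrite El in Hy; apply/eqP.
have : y = x \/ y = f2 x by case: Hx Hy => -> [] ->; rewrite ?flip2K; auto.
by case=> // yE; rewrite -yE yR in x2R.
Qed.

Lemma unbalanced_right z a l : (a, l) \in unbalanced z -> exists2 a', a' != a & (a', l) \in unbalanced z.
Proof.
case/unbalanced_side=> x [Hx xR x2R].
have cx : color (f0 x) = inr l.
  by case: Hx => ->; rewrite ?flip02C ?color_flip2 color_cross0.
have ex : edge_of (f0 x) = edge_of (cross (a, l)) by rewrite edge_of0; case: Hx => ->; rewrite ?edge_of2.
have xR0 : f0 x \in region z by rewrite region0.
have x2R0 : f2 (f0 x) \notin region z by rewrite -flip02C region0.
have [y [[a' l'] [yR y2R cy ey yx]]] := unbalanced_step xR0 x2R0 cx ex.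
case: (edge_cross ey) => -[]; rewrite cy //= => Hy [El]; rewrite -{l'}El in ey Hy *.
exists a'; last exact: unbalancedP ey yR y2R.
apply: contraNneq yx => Ea; rewrite Ea in Hy; apply/eqP.
have : y = f0 x \/ y = f2 (f0 x).
  by case: Hx Hy => -> [] ->; rewrite ?[f0 (f2 _)]flip02C ?flip2K; auto.
by case=> // yE; rewrite -yE yR in x2R0.
Qed.

Lemma unbalanced_ge4 z : region z != setT -> 4 <= #|unbalanced z|.
Proof.
move/unbalanced_neq0/set0Pn => -[[a l] U1].
have [l' nl U2] := unbalanced_left U1; have [a' na U3] := unbalanced_right U1.
have [l'' nl'' U4] := unbalanced_left U3.
pose s := [:: (a, l); (a, l'); (a', l); (a', l'')].
have us : uniq s.
  by rewrite /= !inE !xpair_eqE !eqxx /= !(eq_sym a) (negbTE na) !(eq_sym l) (negbTE nl) (negbTE nl'') !andbF.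
rewrite -[4]/(size s) -(card_uniqP us); apply/subset_leq_card/subsetP => p.
by rewrite 4!inE => /or4P[]/eqP ->.
Qed.

Lemma region_count : 1 < n_comp region_rel Fl -> 4 * n_comp region_rel Fl <= 6 * q.
Proof.
move=> gt1; have roots_card : n_comp region_rel Fl = #|[set z | roots region_rel z]|.
  by apply: eq_card => x; rewrite !inE andbT.
have properR z : region z != setT.
  apply: contraTneq gt1 => RT; rewrite -leqNgt roots_card.
  apply/card_le1P => x; rewrite inE => /eqP rx y; rewrite !inE.
  apply/eqP/eqP => [ry|->//].
  have : x \in region z by rewrite RT inE.
  have : y \in region z by rewrite RT inE.
  by rewrite !in_region => /(fingraph.rootP csr) + /(fingraph.rootP csr); rewrite rx ry => -> ->.
apply: (@leq_trans (\sum_(z in [set z | roots region_rel z]) #|unbalanced z|)).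
  rewrite roots_card mulnC -sum_nat_const; apply: leq_sum => z _; exact: unbalanced_ge4.
rewrite (eq_bigr (fun z => \sum_(p in unbalanced z) 1)); last by move=> z _; rewrite sum1_card.
rewrite (exchange_big_dep predT) //=.
apply: (@leq_trans (\sum_(p : 'I_3 * 'I_q) 2)); last first.
  by rewrite sum_nat_const card_prod !card_ord; lia.
apply: leq_sum => p _; rewrite sum1_card.
pose r := fingraph.root region_rel.
apply: leq_trans (_ : #|[set r (cross p); r (f2 (cross p))]| <= _); last by rewrite cards2; case: (_ != _).
apply/subset_leq_card/subsetP => z; rewrite inE => /andP[]; rewrite inE => /eqP rz /unbalanced_side[x [Hx + _]].
rewrite in_region => /(fingraph.rootP csr); rewrite rz => ->.
by rewrite !inE /r; case: Hx => ->; rewrite eqxx ?orbT.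
Qed.

End Forest.

Lemma K3_euler_char : (q%:Z <= 6 - 2 * euler_char S)%R.
Proof.
have [M [fM maxM]] := ex_max_forest.
have cV := fM.1; have := n_comp_forest fM maxM.
have := size_undrawn fM maxM; have := n_comp_region M.
have := @region_count M fM maxM; rewrite /euler_char.
set u := size (undrawn M); set F := n_comp fr _; set E := n_comp er _.
set V := n_comp vr _ in cV *; set r := n_comp (region_rel M) _; set j := n_comp (joined M) _ in cV *.
by case: (ltnP 1 r) => [_ /(_ isT)|] *; lia.
Qed.

End Model.
End EulerBound.

Section InducedConnectivity.
Variables (V : finType) (E : rel V).
Implicit Types (A B D : {set V}) (u v w : V).

Definition within D : rel V := [rel a b | [&& a \in D, b \in D & E a b]].
Definition connected D : Prop := {in D &, forall u v, connect (within D) u v}.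
Definition touch A B : bool := [exists u in A, [exists v in B, E u v]].

Lemma touchP A B : reflect (exists u v, [/\ u \in A, v \in B & E u v]) (touch A B).
Proof.
apply: (iffP existsP) => [[u /andP[uA /existsP[v /andP[vB uv]]]]|[u [v [uA vB uv]]]].
  by exists u, v.
by exists u; rewrite uA; apply/existsP; exists v; rewrite vB.
Qed.

Definition K3_model A B D (ls : seq {set V}) : Prop :=
  [/\ connected A, connected B, connected D,
      forall l, l \in ls -> [/\ connected l, touch A l, touch B l & touch D l]
    & pairwise (fun P Q : {set V} => [disjoint P & Q]) [:: A, B, D & ls]].

Definition K3_bound (q : nat) : Prop := forall A B D ls, K3_model A B D ls -> size ls <= q.

Lemma connected_nbr D u w v : connected D -> u \in D -> w \in D -> E w v ->
  exists z, E u z.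
Proof.
move=> cD uD wD wv; have /connectP[[|z p] /=] := cD u w uD wD.
  by move=> _ <-; exists v.
by case/andP=> /and3P[_ _ uz] _ _; exists z.
Qed.

End InducedConnectivity.

Section Drawing.
Variables (V : finType) (E : rel V) (S : surface) (f : V -> flag S) (g : nat).
Hypothesis E_sym : symmetric E.
Hypothesis S_genus : (surface_genus S <= g%:Z)%R.
Local Notation vr := (@vertex_rel S).
Hypothesis f_edge : forall u v, E u v -> exists x,
  connect vr (f u) x /\ connect vr (f v) (flip0 x).
(* Isolated vertices of [E] may be drawn anywhere. *)
Hypothesis f_inj : forall u u' v v', E u v -> E u' v' -> connect vr (f u) (f u') -> u = u'.

Lemma K3_bound_genus : K3_bound E (2 * g + 2).
Proof.
move=> A B D ls [cA cB cD Hls dis]; set q := size ls.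
have [->//|q_gt0] := posnP q.
have cv := sym_connect_sym (@vertex_sym S).
set bs := [:: A, B, D & ls] in dis *.
pose idx (i : 'I_3 + 'I_q) : nat := match i with inl a => a | inr l => l.+3 end.
pose W i := nth set0 bs (idx i).
have idx_lt i : idx i < size bs by case: i => -[i /= Hi]; rewrite -/q; lia.
have idx_inj i j : idx i = idx j -> i = j.
  by case: i j => -[i Hi] [] [j Hj] /= Eij; try (by lia); congr (_ _); apply: val_inj => /=; lia.
have disj i j u : u \in W i -> u \in W j -> i = j.
  move=> ui uj; apply: idx_inj; apply/eqP; apply: contraT; rewrite neq_ltn.
  have P k l : idx k < idx l -> u \in W k -> u \in W l -> False.
    move=> kl uk ul; have /(pairwiseP set0)/(_ _ _ (idx_lt k) (idx_lt l) kl)/= := dis.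
    by move=> /pred0P/(_ u) /=; rewrite [u \in _]uk [u \in _]ul.
  by case/orP=> /P H; [case: (H ui uj) | case: (H uj ui)].
have Wr (l : 'I_q) : W (inr l) \in ls by rewrite /W /bs /= mem_nth.
have cW i : connected E (W i).
  case: i => [[[|[|[|a]]] Ha]|l] //; by case: (Hls _ (Wr l)).
have adj (a : 'I_3) l : touch E (W (inl a)) (W (inr l)).
  by have [_ tA tB tD] := Hls _ (Wr l); case: a => [[|[|[|a]]] Ha].
have nbr i u : u \in W i -> exists v, E u v.
  case: i => [a|l] uW.
    have /touchP[w [v [wW _ wv]]] := adj a (Ordinal q_gt0).
    exact: connected_nbr (cW _) uW wW wv.
  have /touchP[w [v [_ vW wv]]] := adj ord0 l.
  by apply: connected_nbr (cW _) uW vW _; rewrite E_sym; exact: wv.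
pose Bf i := [set x | [exists u in W i, connect vr (f u) x]].
have BfP i x : reflect (exists2 u, u \in W i & connect vr (f u) x) (x \in Bf i).
  rewrite inE; apply: (iffP existsP) => [[u /andP[]]|[u uW ux]]; first by exists u.
  by exists u; rewrite uW.
have Bd i j x y : x \in Bf i -> y \in Bf j -> connect vr x y -> i = j.
  move=> /BfP[u ui ux] /BfP[v vj vy] xy.
  have [u' uu'] := nbr _ _ ui; have [v' vv'] := nbr _ _ vj.
  have uv : u = v.
    apply: f_inj uu' vv' _; apply: connect_trans ux (connect_trans xy _).
    by rewrite cv.
  by apply: disj ui _; rewrite uv.
have BfS i x y : x \in Bf i -> connect vr x y -> y \in Bf i.
  by move=> /BfP[u uW ux] xy; apply/BfP; exists u => //; apply: connect_trans xy.
have Ba (a : 'I_3) (l : 'I_q) : [exists x, (x \in Bf (inl a)) && (flip0 x \in Bf (inr l))].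
  have /touchP[u [v [uW vW /f_edge[x [ux vx]]]]] := adj a l.
  by apply/existsP; exists x; apply/andP; split; apply/BfP; [exists u | exists v].
have := K3_euler_char q_gt0 Bd _ Ba; suff Bc i x y : x \in Bf i -> y \in Bf i ->
  connect [rel a b | vr a b || [&& b == flip0 a, a \in Bf i & b \in Bf i]] x y.
  by move=> /(_ Bc); move: S_genus; rewrite /surface_genus; lia.
set R := [rel a b | _].
have vR : subrel (connect vr) (connect R).
  by apply: connect_sub => a b ab; apply/connect1; rewrite /R /= -[_ || _]/(vr a b || _) ab.
move=> /BfP[u uW ux] /BfP[v vW vy].
have cR : connect_sym R.
  apply: sym_connect_sym => a b; rewrite /R /=.
  rewrite -[(_ || _) || _]/(vr a b || _) -[in RHS]/(vr b a || _) vertex_sym.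
  by rewrite (eq_flipC a b (@flip0K S)) [(b \in _) && _]andbC.
apply: connect_trans (_ : connect R x (f u)) _; first by rewrite cR; apply: vR.
apply: connect_trans (vR _ _ vy).
apply: (connect_ind (P := fun w => connect R (f u) (f w)) _ (cW i u v uW vW)); last exact: connect0.
move=> a b /and3P[aW bW ab] ua; apply: connect_trans ua _.
have [z [az bz]] := f_edge ab.
apply: connect_trans (vR _ _ az) _; apply: connect_trans (_ : connect R z (flip0 z)) _; last first.
  by rewrite cR; apply: vR.
apply/connect1; rewrite /R /= eqxx.
have -> : z \in Bf i by apply/BfP; exists a.
by have -> : flip0 z \in Bf i by [apply/BfP; exists b]; rewrite orbT.
Qed.

End Drawing.

Section Separator.
Variables (V : finType) (E : rel V) (X : {set V}).
Hypothesis E_sym : symmetric E.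
Hypothesis E_X : forall u v, E u v -> (u \in X) || (v \in X).
Implicit Types (A B C D F L P Q U W Z : {set V}) (u v w : V) (ls : seq {set V}).

Local Notation connected := (connected E).
Local Notation touch := (touch E).
Local Notation within := (within E).

Definition comp D v : {set V} :=
  [set u | [&& v \in D, u \in D & connect (within D) v u]].
Definition nb D : {set V} := [set v | [exists u in D, E u v]].

Lemma in_comp D v u : (u \in comp D v) = [&& v \in D, u \in D & connect (within D) v u].
Proof. by rewrite inE. Qed.

Lemma nbP D v : reflect (exists2 u, u \in D & E u v) (v \in nb D).
Proof.
rewrite inE.
apply: (iffP existsP) => [[u /andP[]]|[u uD uv]]; first by exists u.
by exists u; rewrite uD.
Qed.

Opaque comp nb.

Lemma touch_sym A B : touch A B = touch B A.
Proof.
by apply/touchP/touchP => -[u [v [uA vB uv]]]; exists v, u; rewrite E_sym.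
Qed.

Lemma within_sym D : connect_sym (within D).
Proof. by apply: sym_connect_sym => u v; rewrite /within /= E_sym andbCA. Qed.

Lemma connect_withinS D D' u v : D \subset D' -> connect (within D) u v -> connect (within D') u v.
Proof.
move=> /subsetP sDD'; apply: connect_sub => a b /and3P[aD bD ab].
by apply/connect1; rewrite /within /= !sDD'.
Qed.

Lemma connected0 : connected set0.
Proof. by move=> u v; rewrite inE. Qed.

Lemma connected1 v : connected [set v].
Proof. by move=> a b; rewrite !inE => /eqP-> /eqP->; apply: connect0. Qed.

Lemma connected_hub D w :
  (forall v, v \in D -> connect (within D) w v) -> connected D.
Proof.
move=> H u v uD vD; apply: connect_trans (H v vD).
by rewrite within_sym; apply: H.
Qed.

Lemma connectedU A B : connected A -> connected B ->
  (touch A B \/ A = set0 \/ B = set0) -> connected (A :|: B).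
Proof.
move=> cA cB [/touchP[a [b [aA bB ab]]]|[->|->]]; rewrite ?set0U ?setU0 //.
apply: (@connected_hub _ a) => v; rewrite inE => /orP[vA|vB].
  exact: connect_withinS (subsetUl _ _) (cA _ _ aA vA).
apply: connect_trans (connect_withinS (subsetUr _ _) (cB _ _ bB vB)).
by apply/connect1; rewrite /within /= !inE aA bB orbT.
Qed.

Lemma connected_nbU A B : connected A -> B \subset nb A -> connected (A :|: B).
Proof.
move=> cA /subsetP BA; case: (set_0Vmem A) => [A0|[a aA]].
  suff -> : B = set0 by rewrite setU0.
  apply/setP => v; rewrite inE; apply/negP => /BA/nbP[u]; rewrite A0 inE //.
apply: (@connected_hub _ a) => v; rewrite inE => /orP[vA|/[dup] vB /BA/nbP[u uA uv]].
  exact: connect_withinS (subsetUl _ _) (cA _ _ aA vA).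
apply: connect_trans (connect_withinS (subsetUl _ _) (cA _ _ aA uA)) _.
by apply/connect1; rewrite /within /= !inE uA vB orbT.
Qed.

Lemma comp_sub D v : comp D v \subset D.
Proof. by apply/subsetP => u; rewrite in_comp => /and3P[]. Qed.

Lemma comp_id D v : v \in D -> v \in comp D v.
Proof. by move=> vD; rewrite in_comp vD connect0. Qed.

Lemma comp_closed D v u w : u \in comp D v -> w \in D -> E u w -> w \in comp D v.
Proof.
rewrite 2!in_comp => /and3P[-> uD vu] wD uw; rewrite wD /=.
by apply: connect_trans vu (connect1 _); rewrite /within /= uD wD.
Qed.

Lemma closed_connect_within D F u v : (forall a b, a \in F -> b \in D -> E a b -> b \in F) ->
  u \in F -> connect (within D) u v -> v \in F.
Proof.
move=> H uF cuv; apply: (connect_ind (P := fun x => x \in F) _ cuv uF) => a b /and3P[_ bD ab] aF.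
exact: H aF bD ab.
Qed.

Lemma comp_connected D v : connected (comp D v).
Proof.
have [vD|vD] := boolP (v \in D); last first.
  suff -> : comp D v = set0 by exact: connected0.
  by apply/setP => u; rewrite in_comp inE (negbTE vD).
apply: (@connected_hub _ v) => u; rewrite in_comp => /and3P[_ uD vu].
pose F := [set x | connect (within (comp D v)) v x].
suff : u \in F by rewrite inE.
have : u \in F :&: comp D v; last by rewrite inE => /andP[->].
apply: closed_connect_within vu; last by rewrite in_setI inE in_comp connect0 vD connect0.
move=> a b; rewrite in_setI inE => /andP[va aC] bD ab.
have bC := comp_closed aC bD ab; rewrite in_setI bC andbT inE.
by apply: connect_trans va (connect1 _); rewrite /within /= aC bC.
Qed.

Lemma comp_max D F v : connected F -> F \subset D -> v \in F -> F \subset comp D v.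
Proof.
move=> cF sFD vF; apply/subsetP => u uF; rewrite in_comp !(subsetP sFD) //=.
exact: connect_withinS sFD (cF _ _ vF uF).
Qed.

Lemma comp_eq D u v : u \in comp D v -> comp D u = comp D v.
Proof.
move=> uv; have : u \in D by apply: (subsetP (comp_sub D v)).
move=> uD; have vD : v \in D by move: uv; rewrite in_comp => /and3P[].
have vu : v \in comp D u by move: uv; rewrite 2!in_comp within_sym => /and3P[-> -> ->].
apply/eqP; rewrite eqEsubset !(comp_max (@comp_connected _ _) (comp_sub _ _)) //.
Qed.

(* The unique component of [D] holding more than half of the vertices of [X] in [C]. *)
Definition heavy C D : {set V} :=
  [set v in D | #|C :&: X| < 2 * #|comp D v :&: X|].

Lemma in_heavy C D v : (v \in heavy C D) = (v \in D) && (#|C :&: X| < 2 * #|comp D v :&: X|).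
Proof. by rewrite inE. Qed.

Lemma heavyP C D v : D \subset C -> v \in heavy C D ->
  heavy C D = comp D v /\ #|C :&: X| < 2 * #|heavy C D :&: X|.
Proof.
move=> sDC vh; suff e : heavy C D = comp D v.
  by rewrite e; split=> //; move: vh; rewrite in_heavy => /andP[].
have [vD hv] : v \in D /\ #|C :&: X| < 2 * #|comp D v :&: X| by apply/andP; rewrite -in_heavy.
apply/setP => u; apply/idP/idP => [|uv]; last first.
  by rewrite in_heavy (comp_eq uv) hv (subsetP (comp_sub _ _) _ uv).
rewrite in_heavy => /andP[uD hu]; apply: contraT => nuv.
have dis : [disjoint comp D u & comp D v].
  apply/pred0P => w /=; apply/negP => /andP[wu wv]; case/negP: nuv.
  by rewrite -(comp_eq wv) (comp_eq wu) comp_id.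
have : #|(comp D u :|: comp D v) :&: X| <= #|C :&: X|.
  apply/subset_leq_card/setSI; apply: subset_trans sDC.
  by rewrite subUset !comp_sub.
rewrite setIUl cardsU.
suff -> : comp D u :&: X :&: (comp D v :&: X) = set0 by rewrite cards0; lia.
apply/setP => w; rewrite !in_setI in_set0; apply/negP => /andP[/andP[wu _] /andP[wv _]].
by move/pred0P/(_ w): dis; rewrite /= wu wv.
Qed.

(** * Growing a cluster by layers of [X] *)

Definition grow_start A P : {set V} :=
  [set v in P | (v \notin X) && (v \in nb A)].
Definition grow_layer A P F : {set V} :=
  [set v in P | (v \in X) && (v \in nb (A :|: F))].
Definition grow_step A P F : {set V} :=
  (F :|: grow_layer A P F :|:
    [set v in P | (v \notin X) && (v \in nb (grow_layer A P F))]).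
Definition grow A P j : {set V} :=
  (iter j (grow_step A P) (grow_start A P)).
Definition reached A B P r : bool := touch (grow A P r) B.

Lemma in_grow_start A P v : (v \in grow_start A P) = [&& v \in P, v \notin X & v \in nb A].
Proof. by rewrite inE. Qed.

Lemma in_grow_layer A P F v :
  (v \in grow_layer A P F) = [&& v \in P, v \in X & v \in nb (A :|: F)].
Proof. by rewrite inE. Qed.

Lemma in_grow_step A P F v : (v \in grow_step A P F) = [|| v \in F, v \in grow_layer A P F |
  [&& v \in P, v \notin X & v \in nb (grow_layer A P F)]].
Proof. by rewrite 2!in_setU -orbA; congr [|| _, _ | _]; rewrite inE. Qed.

Lemma grow_stepE A P F : grow_step A P F = F :|: grow_layer A P F :|:
  [set v in P | (v \notin X) && (v \in nb (grow_layer A P F))].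
Proof. by []. Qed.

Lemma growE0 A P : grow A P 0 = grow_start A P.
Proof. by []. Qed.

Lemma growES A P j : grow A P j.+1 = grow_step A P (grow A P j).
Proof. by []. Qed.

Opaque heavy grow_start grow_layer grow_step grow.

Lemma nbS A B : A \subset B -> nb A \subset nb B.
Proof.
move=> /subsetP sAB; apply/subsetP => v /nbP[u uA uv]; apply/nbP.
by exists u => //; apply: sAB.
Qed.

Lemma grow_layerS A P P' F F' : P \subset P' -> F \subset F' ->
  grow_layer A P F \subset grow_layer A P' F'.
Proof.
move=> /subsetP sP sF; apply/subsetP => v; rewrite 2!in_grow_layer => /and3P[/sP-> ->] /=.
exact/subsetP/nbS/setUS.
Qed.

Lemma grow_stepS A P P' F F' : P \subset P' -> F \subset F' ->
  grow_step A P F \subset grow_step A P' F'.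
Proof.
move=> sP sF; have sZ := grow_layerS A sP sF.
apply/subsetP => v vG; rewrite in_grow_step in vG; rewrite in_grow_step.
case/or3P: vG => [/(subsetP sF)->//|/(subsetP sZ)->|].
  by rewrite orbT.
by case/and3P=> /(subsetP sP)-> -> /(subsetP (nbS sZ))->; rewrite !orbT.
Qed.

Lemma growS A P P' j : P \subset P' -> grow A P j \subset grow A P' j.
Proof.
move=> sP; elim: j => [|j IHj]; last by rewrite 2!growES; exact: grow_stepS.
by apply/subsetP => v; rewrite 2!growE0 2!in_grow_start => /and3P[/(subsetP sP)-> -> ->].
Qed.

Lemma grow_sub A P j : grow A P j \subset P.
Proof.
elim: j => [|j IHj]; apply/subsetP => v; first by rewrite growE0 in_grow_start => /andP[].
rewrite growES in_grow_step => /or3P[/(subsetP IHj)//||]; last by case/andP.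
by rewrite in_grow_layer => /andP[].
Qed.

Lemma grow_succ A P j : grow A P j \subset grow A P j.+1.
Proof. by apply/subsetP => v vG; rewrite growES in_grow_step vG. Qed.

Lemma grow_mono A P i j : i <= j -> grow A P i \subset grow A P j.
Proof.
move=> /subnK <-; elim: (j - i) => [//|k IHk].
exact: subset_trans IHk (grow_succ _ _ _).
Qed.

Lemma growY A P j v : v \in P -> v \notin X -> v \in nb (A :|: grow A P j) -> v \in grow A P j.
Proof.
move=> vP vX /nbP[u]; rewrite in_setU => /orP[uA|uG] uv.
  apply: (subsetP (grow_mono A P (leq0n j))); rewrite growE0 in_grow_start vP vX.
  by apply/nbP; exists u.
have uX : u \in X by have := E_X uv; rewrite (negbTE vX) orbF.
elim: j uG => [|j IHj]; first by rewrite growE0 in_grow_start uX andbF.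
move=> uj; rewrite growES in_grow_step in uj.
case/or3P: uj => [/IHj|uZ|]; last by rewrite uX andbF.
  by apply: (subsetP (grow_succ A P j)).
rewrite growES.
by rewrite in_grow_step vP vX (_ : v \in nb _) ?orbT //; apply/nbP; exists u.
Qed.

Lemma growX A P j v : v \in P -> v \in X -> v \in nb (A :|: grow A P j) -> v \in grow A P j.+1.
Proof. by move=> vP vX nv; rewrite growES in_grow_step in_grow_layer vP vX nv orbT. Qed.

Lemma grow_layer_sub A P j : grow_layer A P (grow A P j) \subset grow A P j.+1.
Proof. by apply/subsetP => v vZ; rewrite growES in_grow_step vZ orbT. Qed.

Lemma grow_connected A P j : connected A -> connected (A :|: grow A P j).
Proof.
move=> cA; elim: j => [|j IHj].
  by apply: connected_nbU => //; apply/subsetP => v; rewrite growE0 in_grow_start => /and3P[].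
rewrite growES grow_stepE !setUA; apply: connected_nbU; last first.
  apply/subsetP => v; rewrite in_set => /and3P[_ _]; apply/subsetP/nbS.
  exact: subsetUr.
by apply: connected_nbU => //; apply/subsetP => v; rewrite in_grow_layer => /and3P[].
Qed.

Lemma grow_path A P j v : v \in grow A P j -> exists Q,
  [/\ Q \subset P, connected Q, #|Q| <= j.*2.+1, touch A Q
    & v \in Q /\ (v \in grow A Q j)].
Proof.
have base w i : w \in P -> w \in nb A -> (w \notin X) || (0 < i) -> exists Q,
    [/\ Q \subset P, connected Q, #|Q| <= 1, touch A Q & w \in Q /\ (w \in grow A Q i)].
  move=> wP /nbP[u uA uw] wi; exists [set w]; rewrite sub1set wP cards1; split=> //.
  - exact: connected1.
  - by apply/touchP; exists u, w; rewrite inE.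
  - rewrite in_set1 eqxx; split=> //; have [wX|wX] := boolP (w \in X).
      case: i wi => [|i]; [by rewrite wX | move=> _].
      by apply: growX; rewrite ?in_set1 //; apply/nbP; exists u; rewrite ?in_setU ?uA.
    by apply: growY; rewrite ?in_set1 //; apply/nbP; exists u; rewrite ?in_setU ?uA.
have ext w u Q i m : w \in P -> E u w -> u \in Q -> Q \subset P -> connected Q ->
    #|Q| <= m -> touch A Q -> u \in grow A Q i -> w \in X \/ w \notin X ->
    [/\ w |: Q \subset P, connected (w |: Q), #|w |: Q| <= m.+1, touch A (w |: Q)
      & w \in w |: Q /\ u \in grow A (w |: Q) i].
  move=> wP uw uQ sQ cQ mQ tQ uG _; split.
  - by rewrite subUset sub1set wP.
  - rewrite setUC; apply: connected_nbU => //; rewrite sub1set.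
    by apply/nbP; exists u.
  - by rewrite cardsU1; case: (w \notin Q) => /=; lia.
  - by case/touchP: tQ => a [b [aA bQ ab]]; apply/touchP; exists a, b; rewrite inE bQ orbT.
  - by rewrite setU11; split=> //; apply: subsetP (growS A i (subsetUr _ _)) _ uG.
have layer i w : (forall u, u \in grow A P i -> exists Q,
      [/\ Q \subset P, connected Q, #|Q| <= i.*2.+1, touch A Q
        & u \in Q /\ (u \in grow A Q i)]) ->
    w \in grow_layer A P (grow A P i) -> exists Q,
      [/\ Q \subset P, connected Q, #|Q| <= i.*2.+2, touch A Q
        & w \in Q /\ (w \in grow_layer A Q (grow A Q i))].
  move=> IH wZ; rewrite in_grow_layer in wZ.
  have /and3P[wP wX /nbP[u /setUP[uA|uG] uw]] := wZ.
    exists [set w]; rewrite sub1set wP cards1; split=> //; try lia.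
    - exact: connected1.
    - by apply/touchP; exists u, w; rewrite inE.
    - rewrite in_set1 eqxx; split=> //; rewrite in_grow_layer in_set1 eqxx wX.
      by apply/nbP; exists u; rewrite // in_setU uA.
  have [Q [sQ cQ mQ tQ [uQ uGQ]]] := IH u uG.
  have [sQ' cQ' mQ' tQ' [wQ' uG']] := ext w u Q i _ wP uw uQ sQ cQ mQ tQ uGQ (or_introl wX).
  exists (w |: Q); split; [exact: sQ'|exact: cQ'|exact: mQ'|exact: tQ'|split; first exact: wQ'].
  by rewrite in_grow_layer wQ' wX; apply/nbP; exists u; rewrite // in_setU uG' orbT.
elim: j v => [|j IHj] v.
  move=> v0; rewrite growE0 in_grow_start in v0; case/and3P: v0 => vP vX nv.
  by apply: base; rewrite ?vX.
move=> vj; rewrite growES in_grow_step in vj; case/or3P: vj => [vG|vZ|].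
- have [Q [sQ cQ mQ tQ [vQ vGQ]]] := IHj v vG; exists Q; split; [exact: sQ|exact: cQ|lia|exact: tQ|split; first exact: vQ].
  apply: subsetP (grow_succ _ _ _) _ vGQ.
- have [Q [sQ cQ mQ tQ [vQ vGQ]]] := layer j v IHj vZ; exists Q; split; [exact: sQ|exact: cQ|lia|exact: tQ|split; first exact: vQ].
  apply: subsetP (grow_layer_sub _ _ _) _ vGQ.
case/and3P=> vP vX /nbP[u uZ uv].
have [Q [sQ cQ mQ tQ [uQ uGQ]]] := layer j u IHj uZ.
have uGQ' : u \in grow A Q j.+1 by apply: subsetP (grow_layer_sub _ _ _) _ uGQ.
have [sQ' cQ' mQ' tQ' [wQ' uG']] := ext v u Q j.+1 _ vP uv uQ sQ cQ mQ tQ uGQ' (or_intror vX).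
exists (v |: Q); split; [exact: sQ'|exact: cQ'|exact: mQ'|exact: tQ'|split; first exact: wQ'].
by apply: growY => //; apply/nbP; exists u; rewrite // in_setU uG' orbT.
Qed.

Lemma reached_path A B P r : reached A B P r -> exists Q,
  [/\ Q \subset P, connected Q, #|Q| <= r.*2.+1, touch A Q & touch Q B /\ reached A B Q r].
Proof.
case/touchP => u [v [/grow_path[Q [sQ cQ mQ tQ [uQ uG]]] vB uv]].
by exists Q; split=> //; split; apply/touchP; exists u, v.
Qed.

Lemma reachedS A B P P' r : P \subset P' -> reached A B P r -> reached A B P' r.
Proof.
move=> sP /touchP[u [v [uG vB uv]]]; apply/touchP; exists u, v; split=> //.
exact: subsetP (growS A r sP) _ uG.
Qed.

(* A vertex set from which no vertex can be deleted while [B] stays within reach is a path. *)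
Lemma reached_min A B P r : reached A B P r -> (forall v, v \in P -> ~~ reached A B (P :\ v) r) ->
  [/\ connected P, #|P| <= r.*2.+1, touch A P & touch B P].
Proof.
move=> /reached_path[Q [sQ cQ mQ tQ [tQB rQ]]] minP.
suff <- : Q = P by split=> //; rewrite touch_sym.
apply/eqP; rewrite eqEsubset sQ; apply/subsetP => v vP.
apply: contraT => vQ; case/negP: (minP v vP); apply: reachedS rQ.
by rewrite subsetD1 sQ.
Qed.

(** * Cutting between two clusters *)

Section Cut.
Variables (A B P : {set V}) (j : nat).
Hypothesis j_gt0 : 0 < j.
Hypothesis nreach : ~~ reached A B P j.

Definition cut_far : {set V} :=
  [set u | [exists b, (b \in nb B) && (u \in comp (P :\: grow A P j.-1) b)]].
Definition cut_set : {set V} := cut_far :&: grow A P j :&: X.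

Lemma in_cut_set u : (u \in cut_set) = [&& u \in cut_far, u \in grow A P j & u \in X].
Proof. by rewrite 2!in_setI andbA. Qed.

Lemma cut_farP u : reflect (exists2 b, b \in nb B & u \in comp (P :\: grow A P j.-1) b)
  (u \in cut_far).
Proof.
rewrite inE; apply: (iffP existsP) => [[b /andP[]]|[b bB ub]]; first by exists b.
by exists b; rewrite bB.
Qed.

Opaque cut_far.

Lemma cut_far_sub : cut_far \subset P :\: grow A P j.-1.
Proof. by apply/subsetP => u /cut_farP[b _]; apply/subsetP/comp_sub. Qed.

Lemma cut_far_closed u w : u \in cut_far -> w \in P -> E u w -> w \notin cut_far ->
  w \in grow A P j.-1.
Proof.
move=> /cut_farP[b bB ub] wP uw; apply: contraNT => wG; apply/cut_farP; exists b => //.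
by apply: comp_closed ub _ uw; rewrite inE wG.
Qed.

Lemma cut_far_nb u : u \in P -> u \in nb B -> u \in cut_far.
Proof.
move=> uP uB; apply/cut_farP; exists u => //; apply: comp_id; rewrite inE uP andbT.
apply: contra nreach => uG; have /nbP[b bB bu] := uB.
apply/touchP; exists u, b; rewrite E_sym; split=> //.
exact: subsetP (grow_mono A P (leq_pred j)) _ uG.
Qed.

Lemma cut_set_grow u w : u \in cut_far -> w \in A :|: grow A P j.-1 -> E u w -> u \in cut_set.
Proof.
move=> uF wG uw; have := subsetP cut_far_sub _ uF; rewrite in_setD => /andP[uG uP].
have nu : u \in nb (A :|: grow A P j.-1) by apply/nbP; exists w; rewrite // E_sym.
rewrite !in_setI uF; have [uX|uX] := boolP (u \in X).
  by rewrite andbT -(prednK j_gt0); apply: growX.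
by rewrite (growY uP uX nu) in uG.
Qed.

Lemma cut_set_nb u w : u \in cut_far -> w \in P -> w \notin cut_far -> E u w -> u \in cut_set.
Proof.
move=> uF wP wF uw; apply: (cut_set_grow uF _ uw).
by rewrite in_setU (cut_far_closed uF wP uw wF) orbT.
Qed.

Lemma cut_far_connected : connected B -> connected (B :|: cut_far).
Proof.
move=> cB; case: (set_0Vmem B) => [B0|[b0 b0B]].
  suff -> : cut_far = set0 by rewrite setU0.
  by apply/setP => u; rewrite [RHS]inE; apply/negP => /cut_farP[b /nbP[c]]; rewrite B0 inE.
apply: (@connected_hub _ b0) => v; rewrite inE => /orP[vB|/cut_farP[c /[dup] cBn /nbP[b bB bc] vc]].
  exact: connect_withinS (subsetUl _ _) (cB _ _ b0B vB).
have cc : c \in comp (P :\: grow A P j.-1) c.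
  by apply: comp_id; move: vc; rewrite in_comp => /and3P[].
have sc : comp (P :\: grow A P j.-1) c \subset cut_far.
  by apply/subsetP => u uc; apply/cut_farP; exists c.
apply: connect_trans (connect_withinS (subsetUl _ _) (cB _ _ b0B bB)) _.
apply: connect_trans (_ : connect _ b c) _.
  by apply/connect1; rewrite /within /= !in_setU bB (subsetP sc _ cc) ?orbT.
apply: connect_withinS (@comp_connected _ c _ _ cc vc).
exact: subset_trans sc (subsetUr _ _).
Qed.

Lemma cut_near_connected : connected A -> connected (A :|: grow A P j.-1 :|: cut_set).
Proof.
move=> cA; apply: connected_nbU; first exact: grow_connected.
apply/subsetP => v; rewrite !in_setI => /andP[/andP[vF vG] vX].
have := subsetP cut_far_sub _ vF; rewrite inE => /andP[vG' vP].
rewrite -(prednK j_gt0) growES in_grow_step (negbTE vG') vX andbF orbF in vG.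
by rewrite in_grow_layer in vG; case/and3P: vG.
Qed.

End Cut.

Lemma ex_small_layer A P C r : 0 < r -> P \subset C -> exists j,
  [/\ 0 < j, j <= r & r * #|(grow A P j :\: grow A P j.-1) :&: X| <= #|C :&: X| ].
Proof.
move=> r_gt0 sPC; apply: contrapT => H.
have big j : 0 < j -> j <= r -> #|C :&: X| < r * #|(grow A P j :\: grow A P j.-1) :&: X|.
  by move=> j0 jr; rewrite ltnNge; apply/negP => le; apply: H; exists j.
have sum k : k <= r -> k * #|C :&: X| + k <= r * #|grow A P k :&: X|.
  elim: k => [//|k IHk] kr; have := IHk (ltnW kr); have := big k.+1 isT kr; rewrite /=.
  have -> : #|grow A P k.+1 :&: X| = #|grow A P k :&: X| + #|(grow A P k.+1 :\: grow A P k) :&: X|.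
    rewrite -(cardsID (grow A P k) (grow A P k.+1 :&: X)); congr (_ + _); apply: eq_card => v.
      by rewrite !in_setI; have := subsetP (grow_succ A P k) v; case: (v \in grow A P k) => [/(_ isT)->|_]; rewrite ?andbT ?andbF.
    by rewrite !inE andbA.
  by rewrite /= mulnDr mulSn; lia.
have := sum r (leqnn r); have : #|grow A P r :&: X| <= #|C :&: X|.
  by apply/subset_leq_card/setSI; apply: subset_trans (grow_sub _ _ _) sPC.
by move=> le; have := leq_mul (leqnn r) le; lia.
Qed.

End Separator.

(** * Clusters *)

Section Clusters.
Variables (V : finType) (E : rel V) (X : {set V}).
Hypothesis E_sym : symmetric E.
Hypothesis E_X : forall u v, E u v -> (u \in X) || (v \in X).
Variables (q r K : nat) (C : {set V}).
Hypothesis K3q : K3_bound E q.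
Hypothesis r_gt0 : 0 < r.
Hypothesis K_layer : forall z, r * z <= #|C :&: X| -> z <= K.
Hypothesis K_leaves : q * r.*2.+1 <= K.
Hypothesis K_leaf : r.*2.+1 <= K.
Implicit Types (A B D F L P Q U W Z b : {set V}) (u v w : V) (ls : seq {set V}).

Local Notation connected := (connected E).
Local Notation touch := (touch E).
Local Notation nb := (nb E).
Local Notation comp := (comp E).
Local Notation heavy := (heavy E X C).
Local Notation grow := (grow E X).
Local Notation reached := (reached E X).

Lemma heavy_facts D : D \subset C -> heavy D != set0 ->
  [/\ heavy D \subset D, connected (heavy D), #|C :&: X| < 2 * #|heavy D :&: X|
    & forall v, v \in D -> v \in nb (heavy D) -> v \in heavy D].
Proof.
move=> sDC /set0Pn[v vh]; have [e big] := heavyP E_sym sDC vh.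
split=> //; rewrite e; [exact: comp_sub | exact: comp_connected |].
by move=> w wD /nbP[u uc uw]; apply: comp_closed uc wD uw.
Qed.

Lemma touch_nb A B : touch A B = (A :&: nb B != set0).
Proof.
apply/touchP/set0Pn => [[u [v [uA vB uv]]]|[u]].
  by exists u; rewrite in_setI uA; apply/nbP; exists v => //; rewrite E_sym.
by rewrite in_setI => /andP[uA /nbP[v vB vu]]; exists u, v; rewrite E_sym.
Qed.

Lemma disjoint_in (A B : {set V}) v : [disjoint A & B] -> v \in A -> v \in B -> False.
Proof. by move/pred0P/(_ v) => /= H vA vB; rewrite vA vB in H. Qed.

Lemma disjointI A B : (forall v, v \in A -> v \in B -> False) -> [disjoint A & B].
Proof. by move=> H; apply/pred0P => v /=; apply/negP => /andP[vA /(H v vA)]. Qed.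

Lemma in_bigcup ls v : reflect (exists2 l, l \in ls & v \in l) (v \in \bigcup_(l <- ls) l).
Proof.
elim: ls => [|l ls IHls]; first by rewrite big_nil in_set0; constructor; case.
rewrite big_cons in_setU; apply: (iffP orP) => [[vl|/IHls[l' l's vl']]|[l']].
- by exists l; rewrite ?mem_head.
- by exists l'; rewrite ?inE ?l's ?orbT.
- by rewrite inE => /predU1P[->|l's vl']; [left | right; apply/IHls; exists l'].
Qed.

Lemma connected_bigU A ls : connected A ->
  (forall l, l \in ls -> connected l /\ touch A l) -> connected (A :|: \bigcup_(l <- ls) l).
Proof.
move=> cA; elim: ls => [|l ls IHls] H; first by rewrite big_nil setU0.
rewrite big_cons setUCA; have [cl tl] := H l (mem_head _ _).
apply: connectedU => //; first by apply: IHls => k ks; apply: H; rewrite inE ks orbT.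
left; move/touchP: tl => [u [v [uA vl uv]]]; apply/touchP; exists v, u.
by rewrite in_setU uA E_sym.
Qed.

Definition leaf_ok A B b l : Prop :=
  [/\ connected l, #|l| <= r.*2.+1, touch A l /\ touch B l
    & [/\ [disjoint A & l], [disjoint B & l] & [disjoint b & l]]].

Record clusters A B ls b : Prop := Clusters {
  cl_sub : b \subset C;
  cl_conn : connected b;
  cl_big : #|C :&: X| < 2 * #|b :&: X|;
  cl_A : connected A;
  cl_B : connected B;
  cl_AB : [disjoint A & B];
  cl_Ab : [disjoint A & b];
  cl_Bb : [disjoint B & b];
  cl_ls : forall l, l \in ls -> leaf_ok A B b l;
  cl_pw : pairwise (fun P Q : {set V} => [disjoint P & Q]) ls;
  cl_nb : forall v, v \in C -> v \notin b -> v \in nb b ->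
    [|| v \in A, v \in B | v \in \bigcup_(l <- ls) l];
  cl_kA : #|A :&: nb b| <= K;
  cl_kB : #|B :&: nb b| <= K }.

Lemma clusters_swap A B ls b : clusters A B ls b -> clusters B A ls b.
Proof.
case=> sub conn big cA cB AB Ab Bb Hls pw nbb kA kB; split=> //; first by rewrite disjoint_sym.
  by move=> l /Hls[? ? [? ?] [? ? ?]]; split.
by move=> v vC vb vn; rewrite orbCA; apply: nbb.
Qed.

(* The leaves touching [b] span a K_{3,q} minor with [A], [B] and [b]. *)
Lemma clusters_leaves A B ls b : clusters A B ls b ->
  #|(\bigcup_(l <- ls) l) :&: nb b| <= q * r.*2.+1.
Proof.
move=> [_ cb _ cA cB AB Ab Bb Hls pw _ _ _]; pose ls' := [seq l <- ls | touch b l].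
have sls l : l \in ls' -> touch b l /\ l \in ls by rewrite mem_filter => /andP.
have : size ls' <= q.
  apply: (K3q (A := A) (B := B) (D := b)); split=> //.
    by move=> l /sls[tl /Hls[cl _ [tA tB] _]].
  rewrite !pairwise_cons /= AB Ab Bb /=; apply/and4P; split; try apply/allP => l /sls[_ /Hls[_ _ _ []]] //.
  exact: subseq_pairwise (filter_subseq _ _) pw.
move=> sz; apply: leq_trans (leq_mul sz (leqnn _)).
apply: leq_trans (_ : #|\bigcup_(l <- ls') l| <= _).
  apply/subset_leq_card/subsetP => v; rewrite in_setI => /andP[/in_bigcup[l lls vl] vn].
  apply/in_bigcup; exists l => //; rewrite mem_filter lls andbT touch_sym // touch_nb.
  by apply/set0Pn; exists v; rewrite in_setI vl.
have : forall l, l \in ls' -> #|l| <= r.*2.+1 by move=> l /sls[_ /Hls[]].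
elim: ls' {sls sz} => [|l ls' IHl] H; first by rewrite big_nil cards0.
rewrite big_cons mulSn; apply: leq_trans (leq_card_setU _ _) (leq_add (H _ (mem_head _ _)) (IHl _)).
by move=> k ks; apply: H; rewrite inE ks orbT.
Qed.

Lemma clusters_boundary A B ls b : clusters A B ls b -> #|(C :&: nb b) :\: b| <= 3 * K.
Proof.
move=> cl; have := clusters_leaves cl; have := cl_kA cl; have := cl_kB cl.
set lv := \bigcup_(l <- ls) l => kB kA kL.
apply: leq_trans (_ : #|(A :&: nb b) :|: (B :&: nb b) :|: (lv :&: nb b)| <= _).
  apply/subset_leq_card/subsetP => v; rewrite in_setD in_setI => /and3P[vb vC vn].
  rewrite 2!in_setU 3!in_setI vn !andbT -orbA.
  exact: cl_nb cl v vC vb vn.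
apply: leq_trans (leq_card_setU _ _) _.
have [le _] := leq_card_setU (A :&: nb b) (B :&: nb b); lia.
Qed.

Lemma clusters_merge A B ls b : clusters A B ls b -> ~~ touch A b ->
  clusters (A :|: \bigcup_(l <- ls) l) B [::] b.
Proof.
move=> cl nt; have kL := clusters_leaves cl.
case: cl => sub conn big cA cB AB Ab Bb Hls pw nbb kA kB; split=> //.
- by apply: connected_bigU => // l /Hls[? _ [] ? _ _].
- apply: disjointI => v /setUP[vA|/in_bigcup[l /Hls[_ _ _ [_ dB _]] vl]] vB.
    exact: disjoint_in AB vA vB.
  exact: disjoint_in dB vB vl.
- apply: disjointI => v /setUP[vA|/in_bigcup[l /Hls[_ _ _ [_ _ db]] vl]] vb.
    exact: disjoint_in Ab vA vb.
  exact: disjoint_in db vb vl.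
- move=> v vC vb vn; have := nbb v vC vb vn; rewrite big_nil in_set0 orbF in_setU.
  by case/or3P=> ->; rewrite ?orbT.
- rewrite setIUl (_ : A :&: nb b = set0) ?set0U; last by apply/eqP; rewrite touch_nb negbK in nt.
  exact: leq_trans kL K_leaves.
Qed.

Section Move.
Variables (A B b W : {set V}) (ls : seq {set V}).
Hypothesis cl : clusters A B ls b.
Local Notation b' := (heavy (b :\: W)).
Hypothesis b'_neq0 : b' != set0.

Let sDC : b :\: W \subset C.
Proof. exact: subset_trans (subsetDl _ _) (cl_sub cl). Qed.

Lemma move_sub : b' \subset b.
Proof. by have [s _ _ _] := heavy_facts sDC b'_neq0; apply: subset_trans s (subsetDl _ _). Qed.

Lemma move_nW v : v \in b' -> v \in W -> False.
Proof.
have [/subsetP s _ _ _] := heavy_facts sDC b'_neq0.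
by move=> /s; rewrite in_setD => /andP[/negP nW _] /nW.
Qed.

Lemma move_nb v : v \in b -> v \notin b' -> v \in nb b' -> v \in W.
Proof.
have [_ _ _ H] := heavy_facts sDC b'_neq0.
by move=> vb vb' vn; apply: contraNT vb' => vW; apply: H vn; rewrite in_setD vW.
Qed.

Lemma move_nbS : nb b' \subset nb b.
Proof. exact: nbS move_sub. Qed.

Lemma move_disjoint D : [disjoint D & b] -> [disjoint D & b'].
Proof.
move=> dD; apply: disjointI => v vD vb'.
exact: disjoint_in dD vD (subsetP move_sub _ vb').
Qed.

Lemma move_card D : #|D :&: nb b| <= K -> #|D :&: nb b'| <= K.
Proof. by apply: leq_trans; apply/subset_leq_card/setIS/move_nbS. Qed.

Lemma move_boundary v : v \in C -> v \notin b' -> v \in nb b' -> v \notin W ->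
  [|| v \in A, v \in B | v \in \bigcup_(l <- ls) l].
Proof.
move=> vC vb' vn vW; have vb : v \notin b.
  by apply: contra vW => vb; apply: move_nb vb vb' vn.
exact: cl_nb cl v vC vb (subsetP move_nbS _ vn).
Qed.

Lemma move_restart v : ls = [::] -> ~~ touch A b -> v \in b -> W = [set v] ->
  clusters [set v] B [::] b'.
Proof.
move=> ls0 nt vb Wv; have [s c bg H] := heavy_facts sDC b'_neq0.
have Bb := cl_Bb cl.
split=> //.
- exact: subset_trans s sDC.
- exact: connected1.
- exact: cl_B cl.
- by apply: disjointI => u /set1P -> vB; exact: disjoint_in Bb vB vb.
- apply: disjointI => u /set1P -> /move_nW; apply; rewrite Wv; exact: set11.
- exact: move_disjoint Bb.
- move=> u uC ub un; rewrite big_nil in_set0 orbF; have [->|uv] := eqVneq u v; first by rewrite set11.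
  have : u \notin W by rewrite Wv in_set1.
  move=> /(move_boundary uC ub un); rewrite ls0 big_nil in_set0 orbF => /orP[uA|->]; last by rewrite orbT.
  case/negP: nt; rewrite touch_nb; apply/set0Pn; exists u; rewrite in_setI uA.
  exact: subsetP move_nbS _ un.
- apply: leq_trans (leq_trans (subset_leq_card (subsetIl _ _)) _) K_leaf.
  by rewrite cards1.
- exact: move_card (cl_kB cl).
Qed.

Lemma move_leaf : connected W -> #|W| <= r.*2.+1 -> touch A W -> touch B W -> W \subset b ->
  clusters A B (W :: ls) b'.
Proof.
move=> cW kW tA tB sW; have [s c bg H] := heavy_facts sDC b'_neq0.
case: (cl) => sub conn big cA cB AB Ab Bb Hls pw nbb kA kB; split=> //.
- exact: subset_trans s sDC.
- exact: move_disjoint Ab.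
- exact: move_disjoint Bb.
- move=> l; rewrite inE => /predU1P[->|/Hls[cl' kl [tAl tBl] [dA dB db]]].
    split=> //; split.
    + by apply: disjointI => v vA /(subsetP sW); apply: disjoint_in Ab vA.
    + by apply: disjointI => v vA /(subsetP sW); apply: disjoint_in Bb vA.
    + by apply: disjointI => v; apply: move_nW.
  split=> //; split=> //.
  by rewrite disjoint_sym; apply: move_disjoint; rewrite disjoint_sym.
- rewrite pairwise_cons pw andbT; apply/allP => l /Hls[_ _ _ [_ _ db]].
  by apply: disjointI => v /(subsetP sW); apply: disjoint_in db.
- move=> v vC vb vn; rewrite big_cons in_setU.
  have [vW|vW] := boolP (v \in W); first by rewrite !orbT.
  exact: move_boundary.
- exact: move_card kA.
- exact: move_card kB.
Qed.

Lemma move_extend D : connected (A :|: D) -> D \subset b -> W \subset D -> r * #|W| <= #|C :&: X| ->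
  [disjoint D & b'] -> (forall v, v \in A :|: D -> v \in nb b' -> v \in W) ->
  clusters (A :|: D) B ls b'.
Proof.
move=> cD sD sW kW dD HW; have [s c bg H] := heavy_facts sDC b'_neq0.
case: (cl) => sub conn big cA cB AB Ab Bb Hls pw nbb kA kB; split=> //.
- exact: subset_trans s sDC.
- apply: disjointI => v /setUP[vA|/(subsetP sD) vb] vB; first exact: disjoint_in AB vA vB.
  exact: disjoint_in Bb vB vb.
- apply: disjointI => v /setUP[vA|vD]; last exact: disjoint_in dD vD.
  exact: disjoint_in (move_disjoint Ab) vA.
- exact: move_disjoint Bb.
- move=> l /Hls[cl' kl [tAl tBl] [dA dB db]]; split=> //; split=> //.
  + by move/touchP: tAl => [u [v [uA vl uv]]]; apply/touchP; exists u, v; rewrite in_setU uA.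
  + apply: disjointI => v /setUP[vA|/(subsetP sD) vb]; first exact: disjoint_in dA vA.
    exact: disjoint_in db vb.
  + by rewrite disjoint_sym; apply: move_disjoint; rewrite disjoint_sym.
- move=> v vC vb vn; have [vW|vW] := boolP (v \in W).
    by rewrite in_setU (subsetP sW) ?orbT.
  by have := move_boundary vC vb vn vW; rewrite in_setU -orbA => /or3P[]->; rewrite ?orbT.
- apply: leq_trans (K_layer kW); apply/subset_leq_card/subsetP => v.
  by rewrite in_setI => /andP[vD vn]; apply: HW.
- exact: move_card kB.
Qed.

End Move.

Section CutMove.
Variables (A B b : {set V}) (ls : seq {set V}) (j : nat).
Hypothesis cl : clusters A B ls b.
Hypotheses (j_gt0 : 0 < j) (nreach : ~~ reached A B b j).
Hypothesis j_small : r * #|(grow A b j :\: grow A b j.-1) :&: X| <= #|C :&: X|.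
Local Notation U := (cut_far E X A B b j).
Local Notation W := (cut_set E X A B b j).
Local Notation b' := (heavy (b :\: W)).
Hypothesis b'_neq0 : b' != set0.

Let sDC : b :\: W \subset C.
Proof. exact: subset_trans (subsetDl _ _) (cl_sub cl). Qed.

Lemma cut_set_small : r * #|W| <= #|C :&: X|.
Proof.
apply: leq_trans (leq_mul (leqnn _) _) j_small.
apply/subset_leq_card/subsetP => v; rewrite in_cut_set => /and3P[vU vG vX].
rewrite in_setI vX andbT in_setD vG andbT.
by have := subsetP (cut_far_sub _ _ _ _ _ _) _ vU; rewrite in_setD => /andP[].
Qed.

Lemma cut_set_far : W \subset U.
Proof. by apply/subsetP => v; rewrite in_cut_set => /and3P[]. Qed.

Lemma cut_side : b' :&: U != set0 -> b' \subset U.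
Proof.
case/set0Pn => u; rewrite in_setI => /andP[ub uU].
have [s c _ _] := heavy_facts sDC b'_neq0.
apply/subsetP => v vb; suff : v \in U :&: b' by rewrite in_setI => /andP[].
apply: (closed_connect_within _ _ (c u v ub vb)); last by rewrite in_setI uU.
move=> x y; rewrite 2!in_setI => /andP[xU xb] yb xy; rewrite yb andbT.
apply: contraT => yU; case: (move_nW cl b'_neq0 xb).
by apply: (cut_set_nb E_sym E_X j_gt0 xU _ yU xy); apply: subsetP (move_sub cl b'_neq0) _ yb.
Qed.

Lemma cut_move_far : b' :&: U != set0 -> clusters (A :|: (grow A b j.-1 :|: W)) B ls b'.
Proof.
move=> /cut_side /subsetP sU; apply: move_extend => //.
- by rewrite setUA; apply: cut_near_connected => //; exact: cl_A cl.
- rewrite subUset grow_sub /=; apply: subset_trans cut_set_far _.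
  exact: subset_trans (cut_far_sub _ _ _ _ _ _) (subsetDl _ _).
- exact: subsetUr.
- exact: cut_set_small.
- apply: disjointI => v /setUP[vG|vW] vb; last exact: move_nW cl b'_neq0 v vb vW.
  by have := subsetP (cut_far_sub _ _ _ _ _ _) _ (sU v vb); rewrite in_setD vG.
move=> v vAG /nbP[u ub uv]; move: vAG; rewrite setUA => /setUP[vAG|//].
case: (move_nW cl b'_neq0 ub); apply: (cut_set_grow E_sym E_X j_gt0 (sU u ub) vAG uv).
Qed.

Lemma cut_move_near : b' :&: U = set0 -> clusters A (B :|: U) ls b'.
Proof.
move=> bU; have nU v : v \in b' -> v \in U -> False.
  by move=> vb vU; move/setP/(_ v): bU; rewrite in_set0 in_setI vb vU.
have sUb : U \subset b by apply: subset_trans (cut_far_sub _ _ _ _ _ _) (subsetDl _ _).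
apply/clusters_swap; apply: (move_extend (clusters_swap cl)) => //.
- exact: (cut_far_connected E_sym (cl_B cl)).
- exact: cut_set_far.
- exact: cut_set_small.
- by apply: disjointI => v vU vb; exact: nU v vb vU.
move=> v /setUP[vB|vU] /nbP[u ub uv]; have ub' := subsetP (move_sub cl b'_neq0) _ ub.
  case: (nU u ub); apply: (cut_far_nb E_sym nreach ub').
  by apply/nbP; exists v; rewrite // E_sym.
apply: (cut_set_nb E_sym E_X j_gt0 vU ub') => //; last by rewrite E_sym.
by apply/negP; exact: nU.
Qed.

Lemma cut_progress : touch A b -> touch B b -> b' \proper b.
Proof.
move=> tA tB; rewrite properEneq (move_sub cl b'_neq0) andbT; apply/eqP => e.
have [u ub un] : exists2 u, u \in b & u \in nb B.
  by case/touchP: tB => v [u [vB ub vu]]; exists u => //; apply/nbP; exists v.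
have uU := cut_far_nb E_sym nreach ub un.
have bU : b' :&: U != set0 by apply/set0Pn; exists u; rewrite in_setI e ub.
have sU := cut_side bU; rewrite e in sU.
case/touchP: tA => v [w [vA wb vw]].
case: (move_nW cl b'_neq0 (v := w)); first by rewrite e.
apply: (cut_set_grow E_sym E_X j_gt0 (subsetP sU _ wb) (w := v)); first by rewrite in_setU vA.
by rewrite E_sym.
Qed.

End CutMove.
End Clusters.

(** * Balanced separators *)

Lemma iteri_fix (T : Type) (f : nat -> T -> T) x n : (forall k, f k x = x) -> iteri n f x = x.
Proof. by move=> fx; elim: n => //= n ->. Qed.

Section SeparatorAlgorithm.
Variables (N : nat) (E : rel 'I_N) (X : {set 'I_N}).
Local Notation V := 'I_N.
Hypothesis E_sym : symmetric E.
Hypothesis E_X : forall u v, E u v -> (u \in X) || (v \in X).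
Implicit Types (A B C D F L P Q S U W Z b : {set V}) (u v w : V) (ls : seq {set V}).

Local Notation connected := (connected E).
Local Notation touch := (touch E).
Local Notation nb := (nb E).
Local Notation comp := (comp E).
Local Notation heavy := (heavy E X).
Local Notation grow := (grow E X).
Local Notation reached := (reached E X).

Definition first D : {set V} := [set v in D | [forall u in D, v <= u]].

Lemma firstP D v0 : v0 \in D -> exists2 v, v \in D & first D = [set v].
Proof.
move=> v0D; case: (arg_minnP (P := fun v => v \in D) (fun v => v : nat) v0D) => v vD vmin.
exists v => //; apply/setP => u; rewrite !inE; apply/andP/eqP => [[uD /forall_inP um]|->].
  by apply: val_inj; apply/eqP; rewrite eqn_leq um // vmin.
by split=> //; apply/forall_inP.
Qed.

Definition erase_path A B b r : {set V} :=
  iteri N (fun i P => let Q := [set v in P | v != i :> nat] in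
                      if reached A B Q r then Q else P) b.

Lemma erase_pathP A B b r : reached A B b r ->
  [/\ reached A B (erase_path A B b r) r, erase_path A B b r \subset b
    & forall v, v \in erase_path A B b r -> ~~ reached A B (erase_path A B b r :\ v) r].
Proof.
move=> rb; rewrite /erase_path.
suff H k : let P := iteri k (fun i P => let Q := [set v in P | v != i :> nat] in
    if reached A B Q r then Q else P) b in
  [/\ reached A B P r, P \subset b & forall v, v \in P -> v < k -> ~~ reached A B (P :\ v) r].
  by have [H1 H2 H3] := H N; split=> // v vP; apply: H3.
elim: k => [|k [H1 H2 H3]] /=; first by split.
set P := iteri k _ _ in H1 H2 H3 *; set Q := [set v in P | v != k :> nat].
have sQP : Q \subset P by apply/subsetP => v; rewrite inE => /andP[].
case: ifP => [rQ|rQ]; split=> //; first exact: subset_trans sQP H2.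
  move=> v vQ; rewrite ltnS leq_eqVlt => /predU1P[vk|vk].
    by move: vQ; rewrite inE vk eqxx andbF.
  have vP := subsetP sQP _ vQ; apply: contra (H3 v vP vk).
  exact/reachedS/setSD.
move=> v vP; rewrite ltnS leq_eqVlt => /predU1P[vk|]; last exact: H3.
rewrite (_ : P :\ v = Q) ?rQ //; apply/setP => u; rewrite !inE andbC -vk.
by rewrite -(inj_eq val_inj).
Qed.

Definition good_layers C (r : nat) A b : {set V} :=
  [set j : V | [&& 0 < j, j <= r & r * #|(grow A b j :\: grow A b j.-1) :&: X| <= #|C :&: X| ]].
Definition layers_before C r A b : {set V} :=
  [set v | [exists j in first (good_layers C r A b), v \in grow A b j.-1]].
Definition layers_upto C r A b : {set V} :=
  [set v | [exists j in first (good_layers C r A b), v \in grow A b j]].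
Definition beyond B D : {set V} := [set u | [exists c, (c \in nb B) && (u \in comp D c)]].

Record sstate := SState {
  sA : {set V}; sB : {set V}; sL : {set V}; sb : {set V}; sS : {set V}; sdone : bool }.

Definition merge_first A L b := if touch A b then A else A :|: L.
Definition keep_leaves A L b := if touch A b then L else set0.

Section Step.
Variables (C : {set V}) (r : nat) (A B L b S : {set V}).
Definition cut_before := b :\: layers_before C r A b.
Definition far_side := beyond B cut_before.
Definition removed :=
  if touch A b && touch B b then
    if reached A B b r then erase_path A B b r else far_side :&: layers_upto C r A b :&: X
  else first b.
Definition next_b := heavy C (b :\: removed).
Definition next_A :=
  if ~~ touch A b then removed else
  if [&& touch B b, ~~ reached A B b r & next_b :&: far_side != set0]
  then A :|: (layers_before C r A b :|: removed) else A.
Definition next_B :=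
  if ~~ touch A b then B else if ~~ touch B b then removed else
  if ~~ reached A B b r && (next_b :&: far_side == set0) then B :|: far_side else B.
Definition next_L := if [&& touch A b, touch B b & reached A B b r] then removed :|: L else L.
Definition next_S := if next_b == set0 then ((C :&: nb b) :\: b) :|: removed else S.
End Step.

Definition step C r (s : sstate) : sstate :=
  let: A := merge_first (sA s) (sL s) (sb s) in
  let: L' := keep_leaves (sA s) (sL s) (sb s) in
  let: B := merge_first (sB s) L' (sb s) in
  let: L := keep_leaves (sB s) L' (sb s) in
  let: b := sb s in
  if sdone s then s else
  SState (next_A C r A B b) (next_B C r A B b) (next_L C r A B L b) (next_b C r A B b)
         (next_S C r A B b (sS s)) (next_b C r A B b == set0).

Definition separates C S : Prop :=
  S \subset C /\ forall v, v \in C :\: S -> 2 * #|comp (C :\: S) v :&: X| <= #|C :&: X|.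

Section StepCorrect.
Variables (q r K : nat) (C : {set V}).
Hypothesis K3q : K3_bound E q.
Hypothesis r_gt0 : 0 < r.
Hypothesis r_ltN : r < N.
Hypothesis K_layer : forall z, r * z <= #|C :&: X| -> z <= K.
Hypothesis K_leaves : q * r.*2.+1 <= K.
Hypothesis K_leaf : r.*2.+1 <= K.
Local Notation clusters := (clusters E X r K C).

Definition step_inv (s : sstate) : Prop :=
  if sdone s then separates C (sS s) /\ #|sS s| <= 4 * K
  else exists2 ls, clusters (sA s) (sB s) ls (sb s) & sL s = \bigcup_(l <- ls) l.

Lemma clusters_separates A B ls b W : clusters A B ls b -> W \subset b ->
  heavy C (b :\: W) = set0 -> separates C (((C :&: nb b) :\: b) :|: W).
Proof.
move=> cl sW h0; have sbC := cl_sub cl; set S := _ :|: W.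
split.
  rewrite subUset (subset_trans sW sbC) andbT.
  by apply/subsetP => v; rewrite in_setD in_setI => /and3P[].
move=> v vD; set D := C :\: S in vD *.
have clos x y : x \in b -> y \in D -> E x y -> y \in b.
  move=> xb; rewrite in_setD in_setU in_setD in_setI => /andP[+ yC] xy.
  have -> : y \in nb b by apply/nbP; exists x.
  by rewrite yC !andbT negb_or negbK => /andP[].
have nW y : y \in D -> y \notin W by rewrite in_setD in_setU => /andP[/norP[]].
have [vb|vb] := boolP (v \in b).
  have cb : comp D v \subset b :\: W.
    apply/subsetP => u uc; have uD := subsetP (comp_sub E D v) _ uc.
    rewrite in_setD nW //=; move: uc; rewrite in_comp => /and3P[_ _ vu].
    exact: closed_connect_within clos vb vu.
  have : v \notin heavy C (b :\: W) by rewrite h0 in_set0.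
  rewrite in_heavy in_setD nW // vb /= -leqNgt; apply: leq_trans.
  rewrite leq_mul2l /=; apply/subset_leq_card/setSI.
  by apply: comp_max cb _; [exact: comp_connected | exact: comp_id].
have dis u : u \in comp D v -> u \in b -> False.
  rewrite in_comp (within_sym E_sym) => /and3P[_ _ uv] ub.
  by case/negP: vb; apply: closed_connect_within clos ub uv.
have : #|comp D v :&: X| + #|b :&: X| <= #|C :&: X|.
  have le : #|comp D v :&: X :|: b :&: X| <= #|C :&: X|.
    rewrite -setIUl; apply/subset_leq_card/setSI; rewrite subUset sbC andbT.
    exact: subset_trans (comp_sub _ _ _) (subsetDl _ _).
  apply: leq_trans le; rewrite cardsU (_ : _ :&: (b :&: X) = set0) ?cards0 ?subn0 //.
  apply/setP => u; rewrite 3!in_setI in_set0; apply/negP => /andP[/andP[uc _] /andP[ub _]].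
  exact: dis uc ub.
have := cl_big cl.
by move: #|b :&: X| #|C :&: X| #|comp D v :&: X| => *; lia.
Qed.

Lemma first_layer A b : b \subset C -> exists j : V,
  [/\ 0 < j, j <= r, r * #|(grow A b j :\: grow A b j.-1) :&: X| <= #|C :&: X|,
      layers_before C r A b = grow A b j.-1 & layers_upto C r A b = grow A b j].
Proof.
move=> sbC; have [k [k0 kr kX]] := ex_small_layer E X A r_gt0 sbC.
have kN : k < N by apply: leq_ltn_trans kr r_ltN.
have [|j] := @firstP (good_layers C r A b) (Ordinal kN); first by rewrite inE k0 kr.
rewrite inE => /and3P[j0 jr jX] e; exists j; split=> //; apply/setP => v;
  rewrite inE e; apply/existsP/idP => [[i /andP[/set1P-> //]]|vj];
  by exists j; rewrite set11.
Qed.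

Lemma step_correct s : sdone s = false -> step_inv s -> step_inv (step C r s) /\
  (sdone (step C r s) \/ sb (step C r s) \proper sb s).
Proof.
case: s => A0 B0 L0 b S [] // _ [ls0 /= cl0 eL0]; rewrite /step /=.
set A := merge_first _ _ _; set L' := keep_leaves _ _ _.
set B := merge_first _ _ _; set L := keep_leaves _ _ _.
have [ls [cl eL tAls tBls]] : exists ls, [/\ clusters A B ls b, L = \bigcup_(l <- ls) l,
    ~~ touch A b -> ls = [::] & ~~ touch B b -> ls = [::]].
  have [ls1 [cl1 eL1 tA1]] : exists ls, [/\ clusters A B0 ls b, L' = \bigcup_(l <- ls) l
      & ~~ touch A b -> ls = [::]].
    rewrite /A /L' /merge_first /keep_leaves; have [t|nt] := boolP (touch A0 b).
      by exists ls0; rewrite t.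
    exists [::]; rewrite big_nil; split=> //.
    by rewrite eL0; exact: (clusters_merge E_sym K3q K_leaves cl0 nt).
  rewrite /B /L /merge_first /keep_leaves; have [t|nt] := boolP (touch B0 b).
    by exists ls1; rewrite t.
  exists [::]; rewrite big_nil; split=> //.
  rewrite eL1; apply: clusters_swap.
  exact: (clusters_merge E_sym K3q K_leaves (clusters_swap cl1) nt).
have [x xb] : exists x, x \in b.
  apply/set0Pn; apply: contraTneq (cl_big cl) => ->.
  by rewrite set0I cards0 -leqNgt.
have [y yb ey] := firstP xb.
have sbC := cl_sub cl.
rewrite /next_A /next_B /next_L /next_S /next_b.
have [j [j0 jr jX eF eF']] := first_layer A sbC.
have eU : far_side C r A B b = cut_far E X A B b j by rewrite /far_side /cut_before eF.
have eW : far_side C r A B b :&: layers_upto C r A b :&: X = cut_set E X A B b j by rewrite eU eF'.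
have rch : ~~ reached A B b r -> ~~ reached A B b j.
  by apply: contra => /touchP[u [v [uG vB uv]]]; apply/touchP; exists u, v; split=> //;
     apply: subsetP (grow_mono E X A b jr) _ uG.
set W := removed C r A B b.
have [sWb kW] : W \subset b /\ #|W| <= K.
  rewrite /W /removed; case: ifP => [_|_]; last first.
    by rewrite ey sub1set yb cards1; split=> //; apply: leq_trans K_leaf.
  case: ifP => [rc|_].
    have [e1 e2 e3] := erase_pathP rc; split=> //.
    by have [_ k _ _] := reached_min E_sym E_X e1 e3; apply: leq_trans K_leaf.
  rewrite eW; split; last exact/K_layer/cut_set_small.
  apply: subset_trans (cut_set_far _ _ _ _ _ _) _.
  exact: subset_trans (cut_far_sub _ _ _ _ _ _) (subsetDl _ _).
have [b0|b'_neq0] := eqVneq (heavy C (b :\: W)) set0.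
  rewrite /step_inv /=; split; last by left.
  split; first exact: clusters_separates cl sWb b0.
  apply: leq_trans (leq_card_setU _ _) _.
  by apply: leq_trans (leq_add (clusters_boundary E_sym K3q r_gt0 K_leaves K_leaf cl) kW) _; lia.
have move_proper : forall z, z \in W -> heavy C (b :\: W) \proper b.
  move=> z zW; apply/properP; split; first exact: move_sub cl b'_neq0.
  by exists z; [exact: subsetP sWb _ zW | apply/negP => /(move_nW E_sym cl b'_neq0)/(_ zW)].
rewrite /step_inv /=.
have [tA|ntA] := boolP (touch A b); last first.
  have eWy : W = [set y] by rewrite /W /removed (negbTE ntA) ey.
  split; last by right; apply: (move_proper y); rewrite eWy set11.
  exists [::]; last by rewrite eL tAls.
  rewrite -/W eWy in b'_neq0 *.
  exact: (move_restart E_sym K_leaf cl b'_neq0 (tAls ntA) ntA yb erefl).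
have [tB|ntB] := boolP (touch B b); last first.
  have eWy : W = [set y] by rewrite /W /removed tA (negbTE ntB) ey.
  split; last by right; apply: (move_proper y); rewrite eWy set11.
  exists [::]; last by rewrite eL tBls.
  rewrite -/W eWy in b'_neq0 *; apply: clusters_swap.
  exact: (move_restart E_sym K_leaf (clusters_swap cl) b'_neq0 (tBls ntB) ntB yb erefl).
have [rc|nrc] := boolP (reached A B b r).
  have eWp : W = erase_path A B b r by rewrite /W /removed tA tB rc.
  have [e1 e2 e3] := erase_pathP rc; rewrite -eWp in e1 e2 e3.
  have [cW kW' tAW tBW] := reached_min E_sym E_X e1 e3.
  split; last first.
    by right; move/touchP: tAW => [u [v [_ vW _]]]; exact: move_proper vW.
  exists (W :: ls); last by rewrite big_cons eL.
  exact: (move_leaf E_sym cl b'_neq0).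
have eWc : W = cut_set E X A B b j by rewrite /W /removed tA tB (negbTE nrc) eW.
have nrc' := rch nrc; rewrite -/W eWc eU eF in b'_neq0 *.
split; last by right; exact: (cut_progress E_sym E_X cl j0 nrc' b'_neq0).
exists ls; last exact: eL.
have [far|far] := eqVneq (heavy C (b :\: cut_set E X A B b j) :&: cut_far E X A B b j) set0.
  exact: (cut_move_near E_sym E_X K_layer cl j0 nrc' jX b'_neq0).
exact: (cut_move_far E_sym E_X K_layer cl j0 jX b'_neq0).
Qed.

Definition start C : sstate := SState set0 set0 set0 C C false.
Definition run_steps C r k : sstate := iter k (step C r) (start C).

Lemma run_steps_done : connected C -> 0 < #|C :&: X| ->
  sdone (run_steps C r N) /\ separates C (sS (run_steps C r N)) /\ #|sS (run_steps C r N)| <= 4 * K.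
Proof.
move=> cC nC.
have inv k : step_inv (run_steps C r k) /\
    (sdone (run_steps C r k) \/ #|sb (run_steps C r k)| + k <= #|C|).
  elim: k => [|k [IH1 IH2]].
    split; last by right; rewrite addn0.
    exists [::]; rewrite /= ?big_nil //; split; rewrite ?set0I ?cards0 //.
    - by rewrite mul2n -addnn -[ltnLHS]addn0 ltn_add2l.
    - exact: connected0.
    - exact: connected0.
    - by apply: disjointI => v; rewrite in_set0.
    - by apply: disjointI => v; rewrite in_set0.
    - by apply: disjointI => v; rewrite in_set0.
    - by move=> v -> .
  rewrite /run_steps iterS -/(run_steps C r k).
  have [d|nd] := boolP (sdone (run_steps C r k)).
    by rewrite /step d; split=> //; left.
  have [H1 H2] := step_correct (negbTE nd) IH1; split=> //.
  case: H2 => [->|/proper_card lt]; [by left | right].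
  by case: IH2 nd => [->//|le _]; lia.
have [H1 H2] := inv N; have d : sdone (run_steps C r N).
  case: H2 => // le; apply: contraT => nd.
  move: H1; rewrite /step_inv (negbTE nd) => -[ls cl _]; have := cl_big cl.
  have : #|sb (run_steps C r N) :&: X| <= #|sb (run_steps C r N)|.
    exact/subset_leq_card/subsetIl.
  have : #|C| <= N by rewrite -[leqRHS]card_ord max_card.
  by move: le; move: #|sb _| #|C| #|_ :&: X| #|C :&: X| => *; lia.
by move: H1; rewrite /step_inv d.
Qed.

End StepCorrect.

Definition separator C : {set V} :=
  iteri N (fun r S =>
    let: s := run_steps C r N in
    if [&& 0 < r, 0 < #|C :&: X|, sdone s & #|sS s| < #|S| ] then sS s else S)
  (if 0 < #|C :&: X| then C :&: X else C).

Record separator_spec C S : Prop := SeparatorSpec {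
  sep_sub : S \subset C;
  sep_neq0 : S != set0;
  sep_half : forall v, v \in C :\: S -> 2 * #|comp (C :\: S) v :&: X| <= #|C :&: X|;
  sep_card : 0 < #|C :&: X| -> #|S| <= #|C :&: X|;
  sep_single : #|C :&: X| = 0 -> S = C /\ #|S| = 1 }.

Lemma separates_neq0 C S : connected C -> 0 < #|C :&: X| -> separates C S -> S != set0.
Proof.
move=> cC nC [_ half]; apply: contraTneq nC => S0; rewrite S0 setD0 in half.
rewrite -leqNgt leqn0 -[_ == 0]negbK -lt0n; apply/negP => nC.
have /set0Pn[v] : C :&: X != set0 by rewrite -card_gt0.
rewrite in_setI => /andP[vC _]; have := half v vC.
have -> : comp C v = C.
  by apply/eqP; rewrite eqEsubset comp_sub (comp_max cC (subxx C) vC).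
by move: nC; move: #|_| => k; lia.
Qed.

Lemma separator_specP q C : K3_bound E q -> connected C -> C != set0 ->
  separator_spec C (separator C) /\
  (0 < #|C :&: X| -> forall r K, 0 < r < N -> (forall z, r * z <= #|C :&: X| -> z <= K) ->
     q * r.*2.+1 <= K -> r.*2.+1 <= K -> #|separator C| <= 4 * K).
Proof.
move=> K3q cC C0; rewrite /separator; have [nC|] := posnP #|C :&: X|; last first.
  move=> nC; suff H k : k <= N -> let S := iteri k (fun r S => let: s := run_steps C r N in
      if [&& 0 < r, true, sdone s & #|sS s| < #|S| ] then sS s else S) (C :&: X) in
    [/\ separates C S, #|S| <= #|C :&: X| & forall r K, 0 < r < k ->
      (forall z, r * z <= #|C :&: X| -> z <= K) -> q * r.*2.+1 <= K -> r.*2.+1 <= K -> #|S| <= 4 * K].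
    have [sp le H3] := H N (leqnn N); split; last by move=> _; exact: H3.
    case: (sp) => sub half; split=> //; first exact: separates_neq0 nC sp.
    by move=> e; rewrite e in nC.
  elim: k => [|k IHk] kN /=.
    split=> //; last by move=> r K; rewrite ltn0 andbF.
    split; first exact: subsetIl.
    move=> v vD; rewrite (_ : comp _ v :&: X = set0) ?cards0 ?muln0 //.
    apply/setP => u; rewrite in_set0 in_setI; apply/negP => /andP[uc uX].
    by have := subsetP (comp_sub E _ v) _ uc; rewrite in_setD in_setI uX andbT; case: (u \in C).
  have [sp le H3] := IHk (ltnW kN); set S := iteri k _ _ in sp le H3 *.
  have good r K := @run_steps_done q r K C K3q.
  case: ifP => [/and3P[k0 dn lt]|nlt]; last first.
    split=> // r K /andP[r0]; rewrite ltnS leq_eqVlt => /predU1P[rk|rk] K1 K2 K3; last first.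
      by apply: (H3 r K _ K1 K2 K3); rewrite r0.
    have r_lt : r < N by rewrite rk.
    have [dn [_ kS]] := good r K r0 r_lt K1 K2 K3 cC nC; rewrite rk in r0 dn kS.
    apply: leq_trans kS; rewrite leqNgt; apply: contraFN nlt => lt.
    by rewrite r0 dn lt.
  pose K0 := #|C :&: X| + q * k.*2.+1 + k.*2.+1.
  have [|||_ [sp' _]] := good k K0 k0 kN _ _ _ cC nC; try by rewrite /K0; lia.
    move=> z kz; apply: leq_trans (_ : #|C :&: X| <= _); last by rewrite /K0 -addnA leq_addr.
    by apply: leq_trans kz; rewrite leq_pmull.
  split=> //; first exact: leq_trans (ltnW lt) le.
  move=> r K /andP[r0]; rewrite ltnS leq_eqVlt => /predU1P[rk|rk] K1 K2 K3; last first.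
    by apply: leq_trans (ltnW lt) (H3 r K _ K1 K2 K3); rewrite r0.
  by rewrite -rk; have [|_ [_ ->]] := good r K r0 _ K1 K2 K3 cC nC; rewrite ?rk.
split=> //; rewrite (_ : iteri _ _ _ = C); last first.
  by apply: iteri_fix => k; rewrite andbF.
have [v vC] := set0Pn _ C0.
have nX u : u \in C -> u \notin X.
  move=> uC; apply: contraTN isT => uX; suff : u \in C :&: X by rewrite (cards0_eq nC) in_set0.
  by rewrite in_setI uC.
have C1 : C = [set v].
  apply/setP => u; rewrite in_set1; apply/idP/eqP => [uC|->//].
  have /connectP[[|w p] /=] := cC v u vC uC; first by move=> _ ->.
  by case/andP=> /and3P[_ wC vw] _; have := E_X vw; rewrite (negbTE (nX _ vC)) (negbTE (nX _ wC)).
split=> //; first by move=> u; rewrite setDv in_set0.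
  by rewrite nC.
by move=> _; split=> //; rewrite C1 cards1.
Qed.

Lemma separator_bound g C : K3_bound E (2 * g + 2) -> #|X| < N -> connected C -> C != set0 ->
  0 < #|C :&: X| -> #|separator C| ^ 2 <= 1600 * ((g + 1) * #|C :&: X|).
Proof.
move=> K3q XN cC C0 nC; have [spec H] := separator_specP K3q cC C0.
have le := sep_card spec nC; set k := #|C :&: X| in nC le H *; set sz := #|separator C| in le H *.
have [kg|gk] := ltnP k (g + 1); first by nia.
pose P r := (g + 1) * r ^ 2 <= k.
have P1 : exists r, P r by exists 1; rewrite /P muln1.
have Pub r : P r -> r <= k by rewrite /P => Pr; nia.
have [r Pr rmax] := ex_maxnP P1 Pub.
have r0 : 0 < r by apply: rmax; rewrite /P muln1.
have nP : k < (g + 1) * r.+1 ^ 2.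
  by rewrite ltnNge; apply/negP => /rmax; rewrite ltnn.
have kN : k < N by apply: leq_ltn_trans XN; apply/subset_leq_card/subsetIr.
have rN : 0 < r < N by rewrite r0 (leq_ltn_trans (Pub r Pr)).
have := H nC r (10 * ((g + 1) * r)) rN; move: nP Pr; rewrite /P; move: (sz) r0 => z r0 nP Pr Hz.
have : z <= 4 * (10 * ((g + 1) * r)) by apply: Hz => [y| |]; nia.
nia.
Qed.

End SeparatorAlgorithm.

(** * Dissection into a tree decomposition *)

Lemma sqrn_add_half (y z a b : nat) : y ^ 2 <= 1600 * a -> z ^ 2 <= 25 * 1024 * b -> 2 * b <= a ->
  (y + z) ^ 2 <= 25 * 1024 * a.
Proof.
move=> ya zb ba; have yz : 6 * (y * z) <= z ^ 2 + 9 * y ^ 2.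
  clear; rewrite -!mulnn.
  by have := Num.Theory.sqr_ge0 (z%:Z - 3 * y%:Z)%R; nia.
rewrite sqrnD; move: (y * z) (y ^ 2) (z ^ 2) ya zb yz. move=> *; lia.
Qed.

Lemma card_initial (N n : nat) : n <= N -> #|[set v : 'I_N | v < n]| <= n.
Proof.
move=> n_leN; apply: leq_trans (_ : #|[set widen_ord n_leN x | x : 'I_n]| <= _).
  apply/subset_leq_card/subsetP => v; rewrite inE => vn.
  by apply/imsetP; exists (Ordinal vn) => //; apply: val_inj.
by apply: leq_trans (leq_imset_card _ _) _; rewrite card_ord.
Qed.

Section Dissection.
Variables (N : nat) (E : rel 'I_N) (n : nat).
Local Notation V := 'I_N.
Local Notation X := [set v : V | v < n].
Hypothesis E_sym : symmetric E.
Hypothesis n_leN : n <= N.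
Hypothesis N_gt0 : 0 < N.

(* Stage [t] removes [cutter t] from the component [piece t] of what remains. *)
Variables (remaining piece cutter : nat -> {set V}) (g : nat).
Hypothesis remaining0 : remaining 0 = setT.
Hypothesis remainingS : forall t, remaining t.+1 = remaining t :\: cutter t.
Hypothesis pieceP : forall t, [/\ piece t \subset remaining t, connected E (piece t),
  (forall a b, a \in piece t -> b \in remaining t -> E a b -> b \in piece t)
  & remaining t != set0 -> piece t != set0].
Hypothesis cutter_spec : forall t, piece t != set0 -> separator_spec E X (piece t) (cutter t).
Hypothesis cutter0 : forall t, piece t = set0 -> cutter t = set0.
Hypothesis cutter_bound : forall t, 0 < #|piece t :&: X| ->
  #|cutter t| ^ 2 <= 1600 * ((g + 1) * #|piece t :&: X|).

Lemma cutter_sub t : cutter t \subset piece t.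
Proof. by have [p0|/cutter_spec[]//] := eqVneq (piece t) set0; rewrite cutter0 // sub0set. Qed.

Lemma remaining_mono s t : s <= t -> remaining t \subset remaining s.
Proof.
move=> /subnK <-; elim: (t - s) => [//|k IHk].
by rewrite addSn remainingS; apply: subset_trans (subsetDl _ _) IHk.
Qed.

Lemma cutter_removed s t v : s < t -> v \in remaining t -> v \notin cutter s.
Proof. by move=> /remaining_mono/subsetP sub /sub; rewrite remainingS in_setD => /andP[]. Qed.

Lemma remaining_card t : t <= N -> #|remaining t| <= N - t.
Proof.
elim: t => [_|t IHt tN]; first by rewrite remaining0 cardsT card_ord subn0.
have := IHt (ltnW tN); rewrite remainingS.
have [->|R0] := eqVneq (remaining t) set0; first by rewrite set0D cards0.
have [sp _ _ p0] := pieceP t; have [u uS] := set0Pn _ (sep_neq0 (cutter_spec (p0 R0))).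
suff : #|remaining t :\: cutter t| < #|remaining t| by move: #|remaining t :\: cutter t| #|remaining t| => a b; lia.
apply: proper_card; apply/properP; split; first exact: subsetDl.
exists u; last by rewrite in_setD uS.
exact: subsetP sp _ (subsetP (cutter_sub t) _ uS).
Qed.

Lemma cutter_cover v : exists t : V, v \in cutter t.
Proof.
have H t : t <= N -> v \in remaining t \/ exists2 s : nat, s < t & v \in cutter s.
  elim: t => [_|t IHt tN]; first by left; rewrite remaining0 inE.
  case: (IHt (ltnW tN)) => [vR|[s st vs]]; last by right; exists s; rewrite // leqW.
  have [vS|vS] := boolP (v \in cutter t); first by right; exists t.
  by left; rewrite remainingS in_setD vS.
have [vN|[s sN vs]] := H N (leqnn N); last by exists (Ordinal sN).
by have := remaining_card (leqnn N); rewrite subnn leqn0 cards_eq0 => /eqP e; rewrite e in_set0 in vN.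
Qed.

Definition anc (s t : V) : bool := (s == t) || (s < t) && (cutter t :&: piece s != set0).

Lemma piece_sub s t u : s <= t -> u \in piece s -> u \in piece t -> piece t \subset piece s.
Proof.
move=> st us ut; have [_ _ cl _] := pieceP s; have [sub c _ _] := pieceP t.
apply/subsetP => v vt; apply: (closed_connect_within _ us (c u v ut vt)) => a b aS bt.
exact: cl aS (subsetP (remaining_mono st) _ (subsetP sub _ bt)).
Qed.

Lemma anc_piece (s t : V) : s < t -> anc s t -> exists2 u, u \in piece t & piece t \subset piece s.
Proof.
move=> st; rewrite /anc; have -> : (s == t) = false by apply: contraTF st => /eqP->; rewrite ltnn.
rewrite st => /set0Pn[u]; rewrite in_setI => /andP[uS us].
by exists u; [exact: subsetP (cutter_sub t) _ uS | exact: piece_sub (ltnW st) us (subsetP (cutter_sub t) _ uS)].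
Qed.

Lemma anc_trans (s s' t : V) : s < s' -> s' <= t -> anc s t -> anc s' t -> anc s s'.
Proof.
move=> ss'; rewrite leq_eqVlt => /predU1P[/val_inj->//|s't].
move=> /(anc_piece (ltn_trans ss' s't))[u ut /subsetP sts] /(anc_piece s't)[_ _ /subsetP sts'].
have sub := piece_sub (ltnW ss') (sts u ut) (sts' u ut).
rewrite /anc ss' /= orbC; apply/orP; left.
have p0 : piece s' != set0 by apply/set0Pn; exists u; apply: sts'.
have [w wS] := set0Pn _ (sep_neq0 (cutter_spec p0)).
by apply/set0Pn; exists w; rewrite in_setI wS (subsetP sub) ?(subsetP (cutter_sub _)).
Qed.

Definition parent (s t : V) : bool :=
  (s < t) && (anc s t && [forall s' : V, (s < s') && (s' < t) ==> ~~ anc s' t]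
              || (s == 0 :> nat) && [forall s' : V, (s' < t) ==> ~~ anc s' t]).

Definition tree_adj : rel V := [rel s t | parent s t || parent t s].

Lemma tree_adj_sym : symmetric tree_adj.
Proof. by move=> s t; rewrite /tree_adj /= orbC. Qed.

Lemma tree_adj_irr : irreflexive tree_adj.
Proof. by move=> s; rewrite /tree_adj /= /parent ltnn. Qed.

Definition tree := SGraph tree_adj_sym tree_adj_irr.

Lemma parent_anc (s0 t : V) : s0 < t -> anc s0 t -> exists s : V, [/\ parent s t, anc s t & s0 <= s].
Proof.
move=> st a; have Ps : (s0 < t) && anc s0 t by rewrite st.
case: (arg_maxnP (P := fun s : V => (s < t) && anc s t) (fun s => s : nat) Ps) => s /andP[st' sa] smax.
exists s; split=> //; last by apply: smax.
rewrite /parent st' sa; apply/orP; left; apply/forallP => s'; apply/implyP => /andP[ss' s't].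
by apply: contraTN ss' => a'; rewrite -leqNgt; apply: smax; rewrite s't.
Qed.

Lemma parent_ex (t : V) : 0 < t -> exists s : V, parent s t.
Proof.
move=> t0; have [/existsP[s /andP[st sa]]|] := boolP [exists s : V, (s < t) && anc s t].
  by have [s' []] := parent_anc st sa; exists s'.
move=> /existsPn H; exists (Ordinal N_gt0); rewrite /parent t0 /=; apply/orP; right.
by apply/forallP => s; apply/implyP => st; have := H s; rewrite st.
Qed.

Lemma parent_uniq (s s' t : V) : parent s t -> parent s' t -> s = s'.
Proof.
have W (a b : V) : a < b -> parent a t -> parent b t -> False.
  move=> ab /andP[at_ Ha] /andP[bt Hb].
  have nb : ~~ anc b t.
    by case/orP: Ha => /andP[_ /forallP/(_ b)]; rewrite ?ab bt.
  case/orP: Hb => /andP[]; first by rewrite (negbTE nb).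
  by move=> /eqP b0; rewrite b0 in ab.
move=> ps ps'; case: (ltngtP s s') => [lt|lt|/val_inj//].
  by case: (W _ _ lt ps ps').
by case: (W _ _ lt ps' ps).
Qed.

Lemma tree_is_tree : is_tree tree.
Proof.
have cs := sym_connect_sym tree_adj_sym; split.
- by rewrite card_ord.
- have H k (t : V) : t <= k -> connect tree_adj t (Ordinal N_gt0).
    elim: k t => [|k IHk] t tk.
      by apply: eq_connect0; apply: val_inj; apply/eqP; rewrite -leqn0.
    have [t0|/parent_ex[s ps]] := posnP t; first by apply: eq_connect0; apply: val_inj.
    apply: connect_trans (connect1 (_ : tree_adj t s)) (IHk s _).
      by rewrite /tree_adj /= ps orbT.
    by case/andP: ps => st _; rewrite -ltnS; apply: leq_trans st tk.
  by move=> s t; apply: connect_trans (H _ s (leqnn s)) _; rewrite cs; apply: H.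
move=> p /andP[cp up]; rewrite leqNgt; apply/negP => sz.
case: p sz cp up => // x0 p0; set p := x0 :: p0 => sz cp up.
case: (arg_maxnP (P := fun s : V => s \in p) (fun s => s : nat) (mem_head x0 p0)) => t tp tmax.
have [i p' ep] := rot_to tp.
have cr : cycle tree_adj (t :: p') by rewrite -ep rot_cycle.
have ur : uniq (t :: p') by rewrite -ep rot_uniq.
have sr : 2 < size (t :: p') by rewrite -ep size_rot.
have lt s : s \in p' -> tree_adj s t -> parent s t.
  move=> sp; rewrite /tree_adj /= => /orP[//|/andP[ts _]].
  have : s \in p by rewrite -(mem_rot i) ep inE sp orbT.
  by move/tmax => /=; rewrite leqNgt ts.
case: p' cr ur sr {ep} lt => [|a [|b p']] //= /and3P[ta _ pb] /and3P[_ nab _] _ lt.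
have pa : parent a t by apply: lt; rewrite ?mem_head // tree_adj_sym.
have pl : parent (last b p') t.
  apply: lt; first by rewrite inE mem_last orbT.
  by move: pb; rewrite rcons_path => /andP[].
have e := parent_uniq pa pl.
by move: nab; rewrite e mem_last.
Qed.

Variable G : sgraph 'I_n.
Local Notation wx x := (widen_ord n_leN x).
Hypothesis G_E : forall x x' : 'I_n, G x x' =
  (x != x') && [exists w : V, [&& n <= w, E w (wx x) & E w (wx x')]].

Definition own (s : V) : {set 'I_n} :=
  [set x : 'I_n | [exists u in cutter s, (u == x :> nat) || (n <= u) && E u (wx x)]].
Definition bag (t : V) : {set 'I_n} := [set x : 'I_n | [exists s : V, anc s t && (x \in own s)]].

Lemma ownP (s : V) x : reflect (exists2 u, u \in cutter s & u = wx x \/ n <= u /\ E u (wx x)) (x \in own s).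
Proof.
rewrite inE; apply: (iffP existsP) => [[u /andP[uS H]]|[u uS H]]; exists u => //.
  by case/orP: H => [/eqP e|/andP[]]; [left; apply: val_inj | right].
by rewrite uS; case: H => [->|[-> ->]]; rewrite ?eqxx ?orbT.
Qed.

Lemma bagP (t : V) x : reflect (exists2 s, anc s t & x \in own s) (x \in bag t).
Proof.
rewrite inE; apply: (iffP existsP) => [[s /andP[]]|[s a o]]; first by exists s.
by exists s; rewrite a.
Qed.

Lemma anc_refl (t : V) : anc t t.
Proof. by rewrite /anc eqxx. Qed.

Lemma own_bag (t : V) x : x \in own t -> x \in bag t.
Proof. by move=> o; apply/bagP; exists t; rewrite ?anc_refl. Qed.

Local Notation joined_at x := [rel a b | [&& tree a b, x \in bag a & x \in bag b]].

Lemma connect_up x (s t : V) : x \in own s -> anc s t -> connect (joined_at x) t s.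
Proof.
move=> xs; move: {2}(t : nat) (leqnn t) => k; elim: k t => [|k IHk] t tk a.
  have [/eqP->|/andP[st _]] := orP a; first exact: connect0.
  by move: (leq_trans st tk).
have [/eqP->|/andP[st _]] := orP a; first exact: connect0.
have [p [pt pa sp]] := parent_anc st a.
have pltt : p < t by case/andP: pt.
have asp : anc s p.
  move: sp; rewrite leq_eqVlt => /predU1P[/val_inj->|sp]; first exact: anc_refl.
  exact: anc_trans sp (ltnW pltt) a pa.
apply: connect_trans (IHk p _ asp); last by rewrite -ltnS; apply: leq_trans pltt tk.
apply/connect1; rewrite /= /tree_adj /= pt orbT /=.
by apply/andP; split; apply/bagP; exists s.
Qed.

Lemma joined_at_sym x : connect_sym (joined_at x).
Proof.
by apply: sym_connect_sym => u v; rewrite /= tree_adj_sym [(x \in _) && _]andbC.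
Qed.

Lemma connect_own x (j : V) (t : V) : wx x \in cutter j -> x \in bag t -> connect (joined_at x) t j.
Proof.
move=> xj /bagP[s a xs]; have xoj : x \in own j by apply/ownP; exists (wx x) => //; left.
apply: connect_trans (connect_up xs a) _.
have cs := joined_at_sym x.
have in_piece i v : v \in cutter i -> v \in piece i by apply/subsetP/cutter_sub.
have in_rem i v : v \in cutter i -> v \in remaining i.
  by move=> vi; have [sub _ _ _] := pieceP i; apply: subsetP sub _ (in_piece _ _ vi).
have [u us H] := ownP _ _ xs.
have [sj|js|/val_inj->] := ltngtP s j; last exact: connect0.
- rewrite cs; apply: connect_up xs _; rewrite /anc sj; apply/orP; right.
  apply/set0Pn; exists (wx x); rewrite in_setI xj.
  have xr : wx x \in remaining s by apply: subsetP (remaining_mono (ltnW sj)) _ (in_rem _ _ xj).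
  case: H => [<-|[_ ux]]; first exact: in_piece.
  by have [_ _ cl _] := pieceP s; apply: cl (in_piece _ _ us) xr ux.
- apply: connect_up xoj _; rewrite /anc js; apply/orP; right.
  apply/set0Pn; exists u; rewrite in_setI us.
  have ur : u \in remaining j by apply: subsetP (remaining_mono (ltnW js)) _ (in_rem _ _ us).
  case: H => [->|[_ ux]]; first exact: in_piece.
  by have [_ _ cl _] := pieceP j; apply: cl (in_piece _ _ xj) ur _; rewrite E_sym.
Qed.

Lemma dissection_td : tree_decomposition G tree bag.
Proof.
split.
- exact: tree_is_tree.
- move=> x; have [t xt] := cutter_cover (wx x); exists t; apply: own_bag.
  by apply/ownP; exists (wx x) => //; left.
- move=> x x'; rewrite G_E => /andP[_ /existsP[w /and3P[nw wx_ wx']]].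
  have [t wt] := cutter_cover w; exists t.
  by split; apply/own_bag/ownP; exists w => //; right.
move=> x s t xs xt; have [j xj] := cutter_cover (wx x).
apply: connect_trans (connect_own xj xs) _.
by rewrite joined_at_sym; apply: connect_own.
Qed.

(* Every vertex of a cutter accounts for a clique of the bag. *)
Lemma alpha_bag (t : V) : alpha G (bag t) <= \sum_(s : V | anc s t) #|cutter s|.
Proof.
apply/bigmax_leqP => A /andP[/subsetP sA /forall_inP stA].
pose f (x : 'I_n) : V := odflt (wx x)
  [pick u | [exists s : V, anc s t && (u \in cutter s)] && ((u == wx x) || (n <= u) && E u (wx x))].
have fP x : x \in A -> [exists s : V, anc s t && (f x \in cutter s)] /\ (f x = wx x \/ n <= f x /\ E (f x) (wx x)).
  move=> /sA/bagP[s a /ownP[u us H]]; rewrite /f; case: pickP => [w /andP[-> /orP[/eqP|/andP[]]]|/(_ u)].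
  - by split=> //; left.
  - by split=> //; right.
  have -> : [exists s : V, anc s t && (u \in cutter s)] by apply/existsP; exists s; rewrite a.
  by case: H => [->|[-> ->]]; rewrite ?eqxx ?orbT.
have f_inj : {in A &, injective f}.
  move=> x x' xA x'A e; have [_ H] := fP x xA; have [_ H'] := fP x' x'A; rewrite -e in H'.
  have ninx (y y' : 'I_n) : f x = wx y -> n <= f x -> False by move=> -> /=; rewrite leqNgt ltn_ord.
  case: H H' => [ex|[nx Ex]] [ex'|[nx' Ex']].
  - by apply: val_inj; have := congr1 val ex; rewrite ex' => -[].
  - by case: (ninx x x ex nx').
  - by case: (ninx x' x ex' nx).
  apply/eqP; apply: contraT => xx'; have := stA x xA => /forall_inP/(_ x' x'A); rewrite G_E xx' /=.
  by case/existsP; exists (f x); rewrite nx Ex.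
rewrite -(card_in_imset f_inj).
apply: leq_trans (_ : #|\bigcup_(s : V | anc s t) cutter s| <= _).
  apply/subset_leq_card/subsetP => _ /imsetP[x xA ->].
  by have [/existsP[s /andP[a fs]] _] := fP x xA; apply/bigcupP; exists s.
elim/big_rec2: _ => [|s k D _ IH]; first by rewrite cards0.
exact: leq_trans (leq_card_setU _ _) (leq_add (leqnn _) IH).
Qed.

Lemma cut_chain_bound (s t : V) : anc s t ->
  exists2 z, \sum_(s' : V | (s <= s') && anc s' t) #|cutter s'| <= z + 1
    & z ^ 2 <= 25 * 1024 * ((g + 1) * #|piece s :&: X|).
Proof.
move: {2}(N - s) (leqnn (N - s)) => k; elim: k s => [|k IHk] s sk a.
  by have := ltn_ord s; lia.
rewrite (bigD1 s) /= ?leqnn //; set rest := \sum_(_ | _) _.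
have [p0|p0] := eqVneq (piece s) set0.
  exists 0; last by rewrite exp0n.
  suff -> : rest = 0 by rewrite cutter0 // cards0.
  apply: big1 => s' /andP[/andP[ss' a'] ns]; have lt : s < s' by rewrite ltn_neqAle ss' andbT eq_sym.
  have := anc_piece lt; case: (leqP s' t) => s't; last first.
    by move: a'; rewrite /anc ltnNge (ltnW s't) /= orbF => /eqP e; rewrite e ltnn in s't.
  case/(_ (anc_trans lt s't a a')) => u us' /subsetP/(_ u us').
  by rewrite p0 in_set0.
have spec := cutter_spec p0; have [_ c _ _] := pieceP s.
have [/existsP[s1 /andP[s1s a1]]|] := boolP [exists s' : V, (s < s') && anc s' t]; last first.
  move=> /existsPn H; have -> : rest = 0.
    apply: big1 => s' /andP[/andP[ss' a'] ns]; have := H s'.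
    by rewrite a' andbT ltn_neqAle ss' eq_sym ns.
  have [nC0|nC] := posnP #|piece s :&: X|.
    have [_ ->] := sep_single spec nC0; exists 0 => //.
  exists #|cutter s|; first by rewrite addn0 leq_addr.
  by apply: leq_trans (cutter_bound nC) _; rewrite leq_mul2r orbT.
have P1 : (s < s1) && anc s1 t by rewrite s1s.
case: (arg_minnP (P := fun s' : V => (s < s') && anc s' t) (fun s => s : nat) P1) => s2 /andP[ss2 a2] min2.
have s2t : s2 <= t.
  by have [/eqP->|/andP[/ltnW]] := orP a2.
have as2 := anc_trans ss2 s2t a a2.
have [u u2 sub] := anc_piece ss2 as2.
have [sub2 c2 _ _] := pieceP s2.
have subD : piece s2 \subset piece s :\: cutter s.
  apply/subsetP => v v2; rewrite in_setD (subsetP sub) // andbT.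
  exact: cutter_removed ss2 (subsetP sub2 _ v2).
have half : 2 * #|piece s2 :&: X| <= #|piece s :&: X|.
  apply: leq_trans (sep_half spec (subsetP subD _ u2)).
  rewrite leq_mul2l /=; apply/subset_leq_card/setSI.
  exact: comp_max c2 subD u2.
have [z zr zz] : exists2 z, rest <= z + 1 & z ^ 2 <= 25 * 1024 * ((g + 1) * #|piece s2 :&: X|).
  have [|z zr zz] := IHk s2 _ a2.
    by rewrite -ltnS; apply: leq_trans sk; rewrite ltn_sub2l // (ltn_trans ss2).
  exists z => //; apply: leq_trans zr; rewrite /rest big_mkcond [leqRHS]big_mkcond /=.
  apply: leq_sum => s' _; case: ifP => // /andP[/andP[ss' a'] ns].
  by rewrite a' andbT min2 ?a' ?andbT // ltn_neqAle ss' andbT eq_sym.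
have nC : 0 < #|piece s :&: X|.
  rewrite lt0n; apply/eqP => /(sep_single spec)[e _].
  by have := subsetP subD _ u2; rewrite e setDv in_set0.
have zS := cutter_bound nC.
exists (#|cutter s| + z); first by rewrite -addnA leq_add2l.
apply: sqrn_add_half zS zz _; by rewrite mulnCA leq_mul2l half orbT.
Qed.

Lemma alpha_bag_bound (t : V) :
  exists2 z, alpha G (bag t) <= z + 1 & z ^ 2 <= 25 * 1024 * ((g + 1) * n).
Proof.
have Xn : #|X| <= n by exact: card_initial.
have Pt : anc t t := anc_refl t.
case: (arg_minnP (P := fun s : V => anc s t) (fun s => s : nat) Pt) => s a smin.
have [z zs zz] := cut_chain_bound a.
exists z.
  apply: leq_trans (alpha_bag t) _; apply: leq_trans zs.
  rewrite big_mkcond [leqRHS]big_mkcond /=; apply: leq_sum => s' _.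
  by case: ifP => // a'; rewrite smin.
apply: leq_trans zz _; rewrite leq_mul2l /= leq_mul2l; apply/orP; right.
by apply: leq_trans Xn; apply/subset_leq_card/subsetIr.
Qed.

End Dissection.

Section DissectionAlgorithm.
Variables (N : nat) (E : rel 'I_N) (n : nat).
Local Notation V := 'I_N.
Local Notation X := [set v : V | v < n].
Hypothesis E_sym : symmetric E.
Hypothesis E_X : forall u v, E u v -> (u \in X) || (v \in X).

Definition leading_comp (R : {set V}) : {set V} :=
  [set u | [exists v in first R, u \in comp E R v]].

Fixpoint remaining (t : nat) : {set V} :=
  if t is k.+1 then remaining k :\: separator E X (leading_comp (remaining k)) else setT.

Definition piece t := leading_comp (remaining t).
Definition cutter t := separator E X (piece t).

Lemma leading_compP R : R != set0 -> exists2 v, v \in R & leading_comp R = comp E R v.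
Proof.
case/set0Pn => v0 /firstP[v vR ev]; exists v => //; apply/setP => u.
rewrite inE ev; apply/existsP/idP => [[w /andP[/set1P->]]//|uc].
by exists v; rewrite set11.
Qed.

Lemma leading_comp0 : leading_comp set0 = set0.
Proof.
apply/setP => u; rewrite in_set0; apply/negP; rewrite in_set => /existsP[v /andP[]].
by rewrite in_set in_set0.
Qed.

Lemma separator0 : separator E X set0 = set0.
Proof.
by rewrite /separator set0I cards0; apply: iteri_fix => k; rewrite andbF.
Qed.

Lemma pieceP t : [/\ piece t \subset remaining t, connected E (piece t),
  (forall a b, a \in piece t -> b \in remaining t -> E a b -> b \in piece t)
  & remaining t != set0 -> piece t != set0].
Proof.
rewrite /piece; have [->|R0] := eqVneq (remaining t) set0.
  by rewrite leading_comp0 eqxx; split=> // a b; rewrite in_set0.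
have [v vR ->] := leading_compP R0; split; [exact: comp_sub | exact: comp_connected | |].
  by move=> a b ac bR ab; apply: comp_closed ac bR ab.
by move=> _; apply/set0Pn; exists v; apply: comp_id.
Qed.

Variable g : nat.
Hypothesis K3q : K3_bound E (2 * g + 2).

Lemma cutterE t : cutter t = separator E X (piece t).
Proof. by []. Qed.

Lemma cutter_spec t : piece t != set0 -> separator_spec E X (piece t) (cutter t).
Proof. by move=> p0; have [_ c _ _] := pieceP t; case: (separator_specP E_sym E_X K3q c p0). Qed.

Lemma cutter0 t : piece t = set0 -> cutter t = set0.
Proof. by move=> p0; rewrite cutterE p0 separator0. Qed.

Lemma cutter_bound t : #|X| < N -> 0 < #|piece t :&: X| ->
  #|cutter t| ^ 2 <= 1600 * ((g + 1) * #|piece t :&: X|).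
Proof.
move=> XN nC; have [_ c _ _] := pieceP t; rewrite cutterE.
apply: (separator_bound E_sym E_X K3q XN c _ nC).
by apply: contraTneq nC => ->; rewrite set0I cards0.
Qed.

End DissectionAlgorithm.

(** * Loops on the random access machine *)

(* Expressions and loops over raw memory, with named index variables.  [RPar i] is
   the i-th of four fixed parameters; parameter 0 bounds every sum. *)
Inductive rexpr :=
| RCst (k : nat) | RPar (i : nat) | RVar (x : nat) | RMem (e : rexpr)
| RAdd (a b : rexpr) | RSub (a b : rexpr) | RIf (c a b : rexpr)
| RSum (x : nat) (e : rexpr) | RScale (i : nat) (e : rexpr).

Inductive rstmt :=
| RPut (a b : rexpr) | RSeq (s1 s2 : rstmt) | RFor (i x : nat) (s : rstmt).

Fixpoint reval (p M env : nat -> nat) (e : rexpr) : nat :=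
  match e with
  | RCst k => k
  | RPar i => p i
  | RVar x => env x
  | RMem a => M (reval p M env a)
  | RAdd a b => reval p M env a + reval p M env b
  | RSub a b => reval p M env a - reval p M env b
  | RIf c a b => if reval p M env c != 0 then reval p M env a else reval p M env b
  | RSum x a => \sum_(i < p 0) reval p M (upd env x i) a
  | RScale i a => reval p M env a * p i
  end.

Fixpoint rrun (p env M : nat -> nat) (s : rstmt) : nat -> nat :=
  match s with
  | RPut a b => upd M (reval p M env a) (reval p M env b)
  | RSeq s1 s2 => rrun p env (rrun p env M s1) s2
  | RFor i x s => iteri (p i) (fun k M => rrun p (upd env x k) M s) M
  end.

(* Counts register [k] down to 0; register [w] holds the constant 1. *)
Definition countdown (k w : nat) (body : cmd) : cmd := While k (Seq body (Defs.Sub k k w)).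

Fixpoint ecompile (lk : nat -> nat) (d : nat) (e : rexpr) : cmd :=
  match e with
  | RCst k => Const d k
  | RPar i => Add d i.+1 0
  | RVar x => Add d (lk x) 0
  | RMem a => Seq (ecompile lk d a) (Read d d)
  | RAdd a b => Seq (ecompile lk d a) (Seq (ecompile lk d.+1 b) (Add d d d.+1))
  | RSub a b => Seq (ecompile lk d a) (Seq (ecompile lk d.+1 b) (Defs.Sub d d d.+1))
  | RIf c a b => Seq (ecompile lk d c) (If d (ecompile lk d a) (ecompile lk d b))
  | RSum x a =>
      Seq (Const d 0) (Seq (Const d.+1 0) (Seq (Add d.+2 1 0) (Seq (Const d.+3 1)
        (countdown d.+2 d.+3 (Seq (ecompile (upd lk x d.+1) d.+4 a)
           (Seq (Add d d d.+4) (Add d.+1 d.+1 d.+3)))))))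
  | RScale i a =>
      Seq (ecompile lk d.+1 a) (Seq (Const d 0) (Seq (Add d.+2 i.+1 0) (Seq (Const d.+3 1)
        (countdown d.+2 d.+3 (Add d d d.+1)))))
  end.

Fixpoint scompile (lk : nat -> nat) (d : nat) (s : rstmt) : cmd :=
  match s with
  | RPut a b => Seq (ecompile lk d a) (Seq (ecompile lk d.+1 b) (Write d d.+1))
  | RSeq s1 s2 => Seq (scompile lk d s1) (scompile lk d s2)
  | RFor i x s =>
      Seq (Const d 0) (Seq (Add d.+1 i.+1 0) (Seq (Const d.+2 1)
        (countdown d.+1 d.+2 (Seq (scompile (upd lk x d) d.+3 s) (Add d d d.+2)))))
  end.

Fixpoint ecost (p : nat -> nat) (e : rexpr) : nat :=
  match e with
  | RCst _ | RPar _ | RVar _ => 1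
  | RMem a => ecost p a + 1
  | RAdd a b | RSub a b => ecost p a + (ecost p b + 1)
  | RIf c a b => ecost p c + (ecost p a + ecost p b).+1
  | RSum _ a => 4 + (p 0 * (ecost p a + 4) + 1)
  | RScale i a => ecost p a + (3 + (p i * 3 + 1))
  end.

Fixpoint scost (p : nat -> nat) (s : rstmt) : nat :=
  match s with
  | RPut a b => ecost p a + (ecost p b + 1)
  | RSeq s1 s2 => scost p s1 + scost p s2
  | RFor i _ s => 3 + (p i * (scost p s + 3) + 1)
  end.

Lemma updE f a b : upd f a b a = b.
Proof. by rewrite /upd eqxx. Qed.

Lemma upd_neq f a b x : x != a -> upd f a b x = f x.
Proof. by rewrite /upd => /negbTE->. Qed.

Definition exec_le (c : cmd) (s : state) (T : nat) (Q : state -> Prop) : Prop :=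
  exists t s', [/\ exec c s t s', t <= T & Q s'].

Lemma exec_le_seq c1 c2 s T1 T2 (Q1 Q : state -> Prop) :
  exec_le c1 s T1 Q1 -> (forall s1, Q1 s1 -> exec_le c2 s1 T2 Q) ->
  exec_le (Seq c1 c2) s (T1 + T2) Q.
Proof.
case=> t1 [s1 [e1 le1 q1]] /(_ s1 q1)[t2 [s2 [e2 le2 q2]]].
by exists (t1 + t2), s2; split=> //; [exact: ExSeq e1 e2 | exact: leq_add].
Qed.

Lemma exec_le_weak c s T T' (Q Q' : state -> Prop) : exec_le c s T Q -> T <= T' ->
  (forall s', Q s' -> Q' s') -> exec_le c s T' Q'.
Proof. by case=> t [s' [e le q]] le' H; exists t, s'; split; [|exact: leq_trans le'|exact: H]. Qed.

Lemma exec_le_const s x k (Q : state -> Prop) : Q (set_reg s x k) -> exec_le (Const x k) s 1 Q.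
Proof. by move=> q; exists 1, (set_reg s x k); split=> //; constructor. Qed.

Lemma exec_le_add s x y z (Q : state -> Prop) :
  Q (set_reg s x (reg s y + reg s z)) -> exec_le (Add x y z) s 1 Q.
Proof. by move=> q; eexists _, _; split; [constructor | | exact: q]. Qed.

Lemma exec_le_sub s x y z (Q : state -> Prop) :
  Q (set_reg s x (reg s y - reg s z)) -> exec_le (Defs.Sub x y z) s 1 Q.
Proof. by move=> q; eexists _, _; split; [constructor | | exact: q]. Qed.

(* [I j] is the invariant when [j] iterations are left. *)
Lemma exec_le_countdown k w body T (I : nat -> state -> Prop) :
  k != w ->
  (forall j s, I j s -> reg s k = j /\ reg s w = 1) ->
  (forall j s, I j.+1 s -> exec_le body s T (fun s' =>
     [/\ reg s' k = j.+1, reg s' w = 1 & I j (set_reg s' k j)])) ->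
  forall j s, I j s -> exec_le (countdown k w body) s (j * (T + 2) + 1) (I 0).
Proof.
move=> kw Ir Ib; elim=> [|j IHj] s Is.
  by exists 1, s; split=> //; apply: ExWhileF; have [->] := Ir _ _ Is.
have [t [s' [e le [rk rw Is']]]] := Ib j s Is.
have [t' [s'' [e' le' Is'']]] := IHj _ Is'.
exists (t + 1 + t').+1, s''; split=> //; last by lia.
apply: ExWhileT e'; first by have [->] := Ir _ _ Is.
apply: ExSeq e _; have -> : set_reg s' k j = set_reg s' k (reg s' k - reg s' w).
  by rewrite rk rw subn1.
exact: ExSub.
Qed.

Section Compile.
Variable p : nat -> nat.
Local Notation mem := Defs.mem.
Implicit Types (lk env : nat -> nat) (s : state) (d : nat).

Definition ready lk d env s : Prop :=
  [/\ reg s 0 = 0, forall i, i < 4 -> reg s i.+1 = p i, forall x, lk x < d,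
      forall x, reg s (lk x) = env x & 4 < d].

Definition same_below d s s' : Prop := forall x, x < d -> reg s' x = reg s x.

Lemma ready_same lk d env s s' : ready lk d env s -> same_below d s s' -> ready lk d env s'.
Proof.
case=> r0 rp lkd rl d4 H; split=> //; first by rewrite H //; lia.
  by move=> i i4; rewrite H; [exact: rp | lia].
by move=> x; rewrite H.
Qed.

Lemma ready_leq lk d d' env s : d <= d' -> ready lk d env s -> ready lk d' env s.
Proof. by move=> dd' [r0 rp lkd rl d4]; split=> //; [move=> x; apply: leq_trans dd' | exact: leq_trans dd']. Qed.

Lemma ready_upd lk d env s x r d' k : ready lk d env s -> d <= r < d' -> reg s r = k ->
  ready (upd lk x r) d' (upd env x k) s.
Proof.
move=> [r0 rp lkd rl d4] /andP[dr rd] rk; split=> //; last by lia.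
  by move=> y; rewrite /upd; case: eqP => // _; apply: leq_trans (lkd y) _; lia.
by move=> y; rewrite /upd; case: eqP.
Qed.

Fixpoint ewf (e : rexpr) : bool :=
  match e with
  | RCst _ | RVar _ => true
  | RPar i => i < 4
  | RMem a | RSum _ a => ewf a
  | RScale i a => (i < 2) && ewf a
  | RAdd a b | RSub a b => ewf a && ewf b
  | RIf c a b => [&& ewf c, ewf a & ewf b]
  end.

Fixpoint swf (s : rstmt) : bool :=
  match s with
  | RPut a b => ewf a && ewf b
  | RSeq s1 s2 => swf s1 && swf s2
  | RFor i _ s => ((i == 0) || (i == 2)) && swf s
  end.

Definition computes d v s s' : Prop := [/\ mem s' = mem s, same_below d s s' & reg s' d = v].

Ltac registers := rewrite /= /upd; repeat (case: eqP => [?|?]; try (exfalso; lia)); try lia.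

Lemma ecompile_ok e lk d env s : ewf e -> ready lk d env s ->
  exec_le (ecompile lk d e) s (ecost p e) (computes d (reval p (mem s) env e) s).
Proof.
have setS d0 v s0 : computes d0 v s0 (set_reg s0 d0 v).
  by split=> //=; [move=> x xd; rewrite /= upd_neq // neq_ltn xd | rewrite updE].
have trans d0 v s0 s1 s2 : mem s1 = mem s0 -> same_below d0 s0 s1 -> computes d0 v s1 s2 -> computes d0 v s0 s2.
  by move=> m1 H1 [m2 H2 v2]; split=> //; [rewrite m2 | move=> x xd; rewrite H2 // H1].
elim: e lk d env s => [k|i|x|a IHa|a IHa b IHb|a IHa b IHb|c IHc a IHa b IHb|x a IHa|i a IHa] lk d env s /= W rdy.
- exact: exec_le_const.
- apply: exec_le_add; have [r0 rp _ _ _] := rdy; rewrite r0 addn0 rp //; exact: setS.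
- apply: exec_le_add; have [r0 _ _ rl _] := rdy; rewrite r0 addn0 rl; exact: setS.
- apply: exec_le_seq (IHa _ _ _ _ W rdy) _ => s1 [m1 H1 v1].
  exists 1, (set_reg s1 d (mem s1 (reg s1 d))); split=> //; first exact: ExRead.
  by rewrite v1 m1; apply: trans H1 (setS _ _ _).
- case/andP: W => Wa Wb; apply: exec_le_seq (IHa _ _ _ _ Wa rdy) _ => s1 [m1 H1 v1].
  have rdy1 := ready_leq (leqnSn d) (ready_same rdy H1).
  apply: exec_le_seq (IHb _ _ _ _ Wb rdy1) _ => s2 [m2 H2 v2].
  apply: exec_le_add; rewrite v2 H2 // v1 m1.
  by apply: trans (setS _ _ _); [rewrite m2 | move=> x xd; rewrite H2 ?H1 //; lia].
- case/andP: W => Wa Wb; apply: exec_le_seq (IHa _ _ _ _ Wa rdy) _ => s1 [m1 H1 v1].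
  have rdy1 := ready_leq (leqnSn d) (ready_same rdy H1).
  apply: exec_le_seq (IHb _ _ _ _ Wb rdy1) _ => s2 [m2 H2 v2].
  apply: exec_le_sub; rewrite v2 H2 // v1 m1.
  by apply: trans (setS _ _ _); [rewrite m2 | move=> x xd; rewrite H2 ?H1 //; lia].
- case/and3P: W => Wc Wa Wb; apply: exec_le_seq (IHc _ _ _ _ Wc rdy) _ => s1 [m1 H1 v1].
  have rdy1 := ready_same rdy H1; have [c0|c1] := boolP (reval p (mem s) env c != 0).
    have [t [s2 [e2 le2 q2]]] := IHa _ _ _ _ Wa rdy1; exists t.+1, s2; split; last 2 first.
    - by rewrite ltnS; apply: leq_trans le2 (leq_addr _ _).
    - by rewrite m1 in q2; apply: trans q2.
    by apply: ExIfT e2; rewrite v1.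
  have [t [s2 [e2 le2 q2]]] := IHb _ _ _ _ Wb rdy1; exists t.+1, s2; split; last 2 first.
  - by rewrite ltnS; apply: leq_trans le2 (leq_addl _ _).
  - by rewrite m1 in q2; apply: trans q2.
  by apply: ExIfF e2; rewrite v1 -[_ == 0]negbK.
- have [r0 rp lkd rl d4] := rdy.
  rewrite -[4]/(1 + (1 + (1 + 1))) -!addnA.
  apply: (@exec_le_seq _ _ _ _ _ (eq (set_reg s d 0))); first exact: exec_le_const.
  move=> _ <-; apply: (@exec_le_seq _ _ _ _ _ (eq (set_reg (set_reg s d 0) d.+1 0))).
    exact: exec_le_const.
  move=> _ <-; set s2 := set_reg _ d.+1 0.
  apply: (@exec_le_seq _ _ _ _ _ (eq (set_reg s2 d.+2 (p 0)))).
    apply: exec_le_add; congr set_reg; rewrite -(rp 0) //; registers.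
  move=> _ <-; apply: (@exec_le_seq _ _ _ _ _ (eq (set_reg (set_reg s2 d.+2 (p 0)) d.+3 1))).
    exact: exec_le_const.
  move=> _ <-; set s4 := set_reg _ d.+3 1.
  pose I j s' := [/\ j <= p 0, mem s' = mem s, same_below d s s' & [/\
    reg s' d = \sum_(i < p 0 - j) reval p (mem s) (upd env x i) a,
    reg s' d.+1 = p 0 - j, reg s' d.+2 = j & reg s' d.+3 = 1]].
  apply: (@exec_le_weak _ _ (p 0 * (ecost p a + 2 + 2) + 1) _ (I 0)); last 2 first.
  + by rewrite -addnA.
  + by move=> s' [_ m' H' [vd _ _ _]]; split=> //; rewrite vd subn0.
  apply: (@exec_le_countdown d.+2 d.+3 _ (ecost p a + 2) I).
  + by rewrite neq_ltn ltnSn.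
  + by move=> j s' [_ _ _ []].
  + move=> j s' [jN m' H' [vd v1 v2 v3]].
    have rdy' : ready (upd lk x d.+1) d.+4 (upd env x (p 0 - j.+1)) s'.
      by apply: ready_upd (ready_same rdy H') _ v1; lia.
    apply: exec_le_seq (IHa _ _ _ _ W rdy') _ => s5 [m5 H5 v5]; rewrite -[2]/(1 + 1).
    apply: (@exec_le_seq _ _ _ _ _ (eq (set_reg s5 d (reg s5 d + reg s5 d.+4)))).
      exact: exec_le_add.
    move=> _ <-; apply: exec_le_add.
    have h0 : reg s5 d = reg s' d by apply: H5; lia.
    have h1 : reg s5 d.+1 = reg s' d.+1 by apply: H5; lia.
    have h2 : reg s5 d.+2 = reg s' d.+2 by apply: H5; lia.
    have h3 : reg s5 d.+3 = reg s' d.+3 by apply: H5; lia.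
    split; [by registers | by registers |].
    split; [exact: ltnW | by rewrite /= m5 | by move=> y yd; registers; rewrite H5 ?H' //; lia |].
    split; [|by registers|by registers|by registers].
    registers; rewrite v5 h0 vd m' (_ : p 0 - j = (p 0 - j.+1).+1); last by lia.
    by rewrite big_ord_recr.
  split=> //; first by move=> y yd; registers.
  by split; registers; rewrite subnn ?big_ord0.
- case/andP: W => i2 W; have [r0 rp lkd rl d4] := rdy.
  have rdy1 := ready_leq (leqnSn d) rdy.
  apply: exec_le_seq (IHa _ _ _ _ W rdy1) _ => s1 [m1 H1 v1]; rewrite -[3]/(1 + (1 + 1)) -!addnA.
  apply: (@exec_le_seq _ _ _ _ _ (eq (set_reg s1 d 0))); first exact: exec_le_const.
  move=> _ <-; apply: (@exec_le_seq _ _ _ _ _ (eq (set_reg (set_reg s1 d 0) d.+2 (p i)))).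
    apply: exec_le_add; congr set_reg; rewrite -(rp i); last by lia.
    by registers; rewrite ?H1 ?r0 ?addn0 //; lia.
  move=> _ <-; apply: (@exec_le_seq _ _ _ _ _ (eq (set_reg (set_reg (set_reg s1 d 0) d.+2 (p i)) d.+3 1))).
    exact: exec_le_const.
  move=> _ <-; set s4 := set_reg _ d.+3 1; set v := reval _ _ _ _ in v1 *.
  pose I j s' := [/\ j <= p i, mem s' = mem s, same_below d s s' & [/\
    reg s' d = v * (p i - j), reg s' d.+1 = v, reg s' d.+2 = j & reg s' d.+3 = 1]].
  apply: (@exec_le_weak _ _ (p i * (1 + 2) + 1) _ (I 0)) => //; last first.
    by move=> s' [_ m' H' [vd _ _ _]]; split=> //; rewrite vd subn0.
  apply: (@exec_le_countdown d.+2 d.+3 _ 1 I).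
  + by rewrite neq_ltn ltnSn.
  + by move=> j s' [_ _ _ []].
  + move=> j s' [jN m' H' [vd w1 w2 w3]].
    apply: exec_le_add; split; [by registers | by registers |].
    split; [exact: ltnW | by rewrite /= m' | by move=> y yd; registers; rewrite H' |].
    split; [|by registers|by registers|by registers].
    registers; rewrite vd w1 (_ : p i - j = (p i - j.+1).+1); last by lia.
    by rewrite mulnS addnC.
  split=> //; first by move=> y yd; registers; rewrite H1 //; lia.
  by split; registers; rewrite subnn muln0.
Qed.

Lemma scompile_ok c lk d env s : swf c -> ready lk d env s ->
  exec_le (scompile lk d c) s (scost p c) (fun s' =>
    mem s' = rrun p env (mem s) c /\ same_below d s s').
Proof.
elim: c lk d env s => [a b|c1 IH1 c2 IH2|i x c IH] lk d env s /= W rdy.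
- case/andP: W => Wa Wb; apply: exec_le_seq (ecompile_ok Wa rdy) _ => s1 [m1 H1 v1].
  have rdy1 := ready_leq (leqnSn d) (ready_same rdy H1).
  apply: exec_le_seq (ecompile_ok Wb rdy1) _ => s2 [m2 H2 v2].
  eexists _, _; split; [exact: ExWrite | by [] | split=> /=].
    by rewrite v2 m2 m1 H2 // v1.
  by move=> y yd; rewrite /= H2 ?H1 //; lia.
- case/andP: W => W1 W2; apply: exec_le_seq (IH1 _ _ _ _ W1 rdy) _ => s1 [m1 H1].
  apply: exec_le_weak (IH2 _ _ _ _ W2 (ready_same rdy H1)) (leqnn _) _ => s2 [m2 H2].
  by split; [rewrite m2 m1 | move=> y yd; rewrite H2 ?H1].
case/andP: W => i2 W; have [r0 rp lkd rl d4] := rdy.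
rewrite -[3]/(1 + (1 + 1)) -!addnA.
apply: (@exec_le_seq _ _ _ _ _ (eq (set_reg s d 0))); first exact: exec_le_const.
move=> _ <-; apply: (@exec_le_seq _ _ _ _ _ (eq (set_reg (set_reg s d 0) d.+1 (p i)))).
  apply: exec_le_add; congr set_reg; rewrite -(rp i); last by lia.
  by registers.
move=> _ <-; apply: (@exec_le_seq _ _ _ _ _ (eq (set_reg (set_reg (set_reg s d 0) d.+1 (p i)) d.+2 1))).
  exact: exec_le_const.
move=> _ <-; set s3 := set_reg _ d.+2 1.
pose f k M := rrun p (upd env x k) M c.
pose I j s' := [/\ j <= p i, mem s' = iteri (p i - j) f (mem s), same_below d s s' & [/\
  reg s' d = p i - j, reg s' d.+1 = j & reg s' d.+2 = 1]].
apply: (@exec_le_weak _ _ (p i * (scost p c + 1 + 2) + 1) _ (I 0)); last 2 first.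
- by rewrite -addnA.
- by move=> s' [_ m' H' _]; split=> //; rewrite m' subn0.
apply: (@exec_le_countdown d.+1 d.+2 _ (scost p c + 1) I).
- by rewrite neq_ltn ltnSn.
- by move=> j s' [_ _ _ []].
- move=> j s' [jN m' H' [vd v1 v2]].
  have rdy' : ready (upd lk x d) d.+3 (upd env x (p i - j.+1)) s'.
    by apply: ready_upd (ready_same rdy H') _ vd; lia.
  apply: exec_le_seq (IH _ _ _ _ W rdy') _ => s5 [m5 H5].
  have h0 : reg s5 d = reg s' d by apply: H5; lia.
  have h1 : reg s5 d.+1 = reg s' d.+1 by apply: H5; lia.
  have h2 : reg s5 d.+2 = reg s' d.+2 by apply: H5; lia.
  apply: exec_le_add; split; [by registers | by registers |].
  split; [exact: ltnW | | by move=> y yd; registers; rewrite H5 ?H' //; lia |].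
    by rewrite /= m5 m' (_ : p i - j = (p i - j.+1).+1) //; lia.
  by split; registers.
split=> //=; [by rewrite subnn | by move=> y yd; registers |].
by split; registers; rewrite subnn.
Qed.

End Compile.

Fixpoint mdepth (s : rstmt) : nat :=
  match s with
  | RPut _ _ => 0
  | RSeq s1 s2 => maxn (mdepth s1) (mdepth s2)
  | RFor i _ s => (i == 2) + mdepth s
  end.

Lemma poly_leq (c c' d d' k k' x y : nat) : c <= c' -> d <= d' -> k <= k' ->
  c * x.+1 ^ d * y.+1 ^ k <= c' * x.+1 ^ d' * y.+1 ^ k'.
Proof. by move=> cc dd kk; rewrite !leq_mul // leq_pexp2l. Qed.

Lemma ecost_poly e : ewf e ->
  exists c d, forall p : nat -> nat, p 1 <= p 0 -> ecost p e <= c * (p 0).+1 ^ d.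
Proof.
have up c d c' d' x y : y <= c * x.+1 ^ d -> c <= c' -> d <= d' -> y <= c' * x.+1 ^ d'.
  by move=> le cc dd; apply: leq_trans le _; rewrite leq_mul // leq_pexp2l.
have one c d x : c <= c * x.+1 ^ d by rewrite leq_pmulr // expn_gt0.
have bin a b W1 W2 k : W1 && W2 ->
    (W1 -> exists c d, forall p : nat -> nat, p 1 <= p 0 -> ecost p a <= c * (p 0).+1 ^ d) ->
    (W2 -> exists c d, forall p : nat -> nat, p 1 <= p 0 -> ecost p b <= c * (p 0).+1 ^ d) ->
    exists c d, forall p : nat -> nat, p 1 <= p 0 -> ecost p a + ecost p b + k <= c * (p 0).+1 ^ d.
  case/andP=> w1 w2 /(_ w1)[c1 [d1 H1]] /(_ w2)[c2 [d2 H2]].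
  exists (c1 + c2 + k), (d1 + d2) => p pp; rewrite !mulnDl !leq_add //.
  - by apply: up (H1 p pp) _ _; rewrite ?leq_addr.
  - by apply: up (H2 p pp) _ _; rewrite ?leq_addl.
elim: e => [k|i|x|a IHa|a IHa b IHb|a IHa b IHb|c IHc a IHa b IHb|x a IHa|i a IHa] /= W;
  try by exists 1, 0 => p pp; rewrite muln1.
- have [c [d H]] := IHa W; exists (c + 1), d => p pp.
  by rewrite mulnDl leq_add ?one ?H.
- have [c [d H]] := bin a b _ _ 1 W IHa IHb; exists c, d => p pp; rewrite addnA; exact: H.
- have [c [d H]] := bin a b _ _ 1 W IHa IHb; exists c, d => p pp; rewrite addnA; exact: H.
- case/and3P: W => /IHc[c0 [d0 H0]] Wa Wb.
  have [|c1 [d1 H1]] := bin a b (ewf a) (ewf b) 1 _ IHa IHb; first by rewrite Wa.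
  exists (c0 + c1), (d0 + d1) => p pp; rewrite mulnDl leq_add //.
  + by apply: up (H0 p pp) _ _; rewrite ?leq_addr.
  + by rewrite -addn1; apply: up (H1 p pp) _ _; rewrite ?leq_addl.
- have [c [d H]] := IHa W; exists (c + 9), d.+1 => p pp.
  have := H p pp; have := one 1 d (p 0); rewrite expnS; move: (_ ^ d) (ecost p a) => y z.
  move: (p 0) => k; nia.
- case/andP: W => i2 /IHa[c [d H]]; exists (c + 7), d.+1 => p pp.
  have := H p pp; have := one 1 d (p 0); rewrite expnS; move: (_ ^ d) (ecost p a) => y z.
  have : p i <= p 0 by case: i i2 => [|[|i]].
  move: (p 0) (p i) => k l; nia.
Qed.

Lemma scost_poly s : swf s -> exists c d, forall p : nat -> nat, p 1 <= p 0 ->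
  scost p s <= c * (p 0).+1 ^ d * (p 2).+1 ^ mdepth s.
Proof.
have one c d x : c <= c * x.+1 ^ d by rewrite leq_pmulr // expn_gt0.
elim: s => [a b|s1 IH1 s2 IH2|i x s IH] /= W.
- case/andP: W => /ecost_poly[c1 [d1 H1]] /ecost_poly[c2 [d2 H2]].
  exists (c1 + c2 + 1), (d1 + d2) => p pp; rewrite expn0 muln1 addnA !mulnDl !leq_add ?one //.
  + by apply: leq_trans (H1 p pp) _; rewrite leq_mul // leq_pexp2l ?leq_addr.
  + by apply: leq_trans (H2 p pp) _; rewrite leq_mul // leq_pexp2l ?leq_addl.
- case/andP: W => /IH1[c1 [d1 H1]] /IH2[c2 [d2 H2]].
  exists (c1 + c2), (d1 + d2) => p pp; rewrite !mulnDl leq_add //.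
  + by apply: leq_trans (H1 p pp) _; apply: poly_leq; rewrite ?leq_addr ?leq_maxl.
  + by apply: leq_trans (H2 p pp) _; apply: poly_leq; rewrite ?leq_addl ?leq_maxr.
case/andP: W => i02 /IH[c [d H]]; exists (c + 7), d.+1 => p pp.
have h0 := H p pp; have h1 := one 1 d (p 0); have h2 := one 1 (mdepth s) (p 2).
move: h0 h1 h2; rewrite !mul1n expnS; move: (scost p s) ((p 0).+1 ^ d) => z y.
case/orP: i02 => /eqP ->; rewrite ?eqxx /= ?add0n ?add1n ?expnS; move: ((p 2).+1 ^ _) => w;
  move: (p 0) (p 2) => k l h0 h1 h2.
- have yw : 1 <= y * w by nia.
  have h0' : z <= c * (y * w) by rewrite mulnA.
  rewrite -!mulnA; move: (y * w) yw h0' => v; nia.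
- have yw : 1 <= y * w by nia.
  have h0' : z <= c * (y * w) by rewrite mulnA.
  have -> : (c + 7) * (k.+1 * y) * (l.+1 * w) = (c + 7) * ((k.+1 * l.+1) * (y * w)) by nia.
  move: (y * w) yw h0' => v yw h0'; have : l.+1 <= k.+1 * l.+1 by nia.
  move: (k.+1 * l.+1) => u lu; nia.
Qed.

(** * Parameters of the input *)

Definition table_dim (n : nat) : nat := n * n + n + 2.

Definition params (n m i : nat) : nat :=
  match i with
  | 0 => table_dim n
  | 1 => n
  | 2 => m
  | _ => n * m + 4 * (table_dim n * table_dim n)
  end.

(* Leaves [params n m i] in register [i.+1]; a product is a repeated addition. *)
Definition prelude (body : cmd) : cmd :=
  Seq (Const 5 0) (Seq (Read 2 5) (Seq (Const 6 1) (Seq (Read 3 6) (Seq (Add 7 2 0)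
  (Seq (countdown 7 6 (Seq (Add 8 8 2) (Add 9 9 3)))
  (Seq (Add 1 8 2) (Seq (Add 1 1 6) (Seq (Add 1 1 6) (Seq (Add 7 1 0)
  (Seq (countdown 7 6 (Add 10 10 1))
  (Seq (Add 4 10 10) (Seq (Add 4 4 4) (Seq (Add 4 4 9) body))))))))))))).

Lemma exec_le_read s x y (Q : state -> Prop) :
  Q (set_reg s x (Defs.mem s (reg s y))) -> exec_le (Read x y) s 1 Q.
Proof. by move=> q; eexists _, _; split; [exact: ExRead | | exact: q]. Qed.

Lemma prelude_ok body input n m T (Q : state -> Prop) :
  nth 0 input 0 = n -> nth 0 input 1 = m ->
  (forall s, ready (params n m) (fun=> 0) 11 (fun=> 0) s -> Defs.mem s = nth 0 input ->
     exec_le body s T Q) ->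
  exec_le (prelude body) (init_state input) (n * 4 + table_dim n * 3 + 14 + T) Q.
Proof.
move=> en em H; rewrite /prelude.
have -> : n * 4 + table_dim n * 3 + 14 + T =
  1 + (1 + (1 + (1 + (1 + ((n * (2 + 2) + 1) + (1 + (1 + (1 + (1 + ((table_dim n * (1 + 2) + 1) +
  (1 + (1 + (1 + T))))))))))))) by lia.
pose I1 j s := [/\ Defs.mem s = nth 0 input, j <= n,
  [/\ reg s 0 = 0, reg s 2 = n, reg s 3 = m & reg s 10 = 0] &
  [/\ reg s 7 = j, reg s 6 = 1, reg s 8 = (n - j) * n & reg s 9 = (n - j) * m]].
pose I2 j s := [/\ Defs.mem s = nth 0 input, j <= table_dim n,
  [/\ reg s 0 = 0, reg s 1 = table_dim n, reg s 2 = n & reg s 3 = m] &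
  [/\ reg s 7 = j, reg s 6 = 1, reg s 9 = n * m & reg s 10 = (table_dim n - j) * table_dim n]].
do 5!(apply: (@exec_le_seq _ _ _ _ _ (eq _)) => [|_ <-];
      [by first [apply: exec_le_const | apply: exec_le_read | apply: exec_le_add]|]).
apply: (@exec_le_seq _ _ _ _ _ (I1 0)).
  apply: (@exec_le_countdown 7 6 _ 2 I1) => //.
  - by move=> j s [_ _ _ []].
  - move=> j s [ms jn [r0 r2 r3 r10] [r7 r6 r8 r9]]; rewrite -[2]/(1 + 1).
    apply: (@exec_le_seq _ _ _ _ _ (eq _)) => [|_ <-]; first by apply: exec_le_add.
    apply: exec_le_add; rewrite /I1 /= /upd /= r0 r2 r3 r6 r7 r8 r9 r10.
    have -> : n - j = (n - j.+1).+1 by lia.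
    by split=> //; split=> //; rewrite ?[in RHS]mulSn ?[_ + n]addnC ?[_ + m]addnC //; lia.
  by rewrite /I1 /= /upd /= en em subnn !mul0n addn0.
move=> s1 [ms1 _ [r0 r2 r3 r10] [r7 r6 r8 r9]]; rewrite subn0 in r8 r9.
do 4!(apply: (@exec_le_seq _ _ _ _ _ (eq _)) => [|_ <-]; first by apply: exec_le_add).
apply: (@exec_le_seq _ _ _ _ _ (I2 0)).
  apply: (@exec_le_countdown 7 6 _ 1 I2) => //.
  - by move=> j s [_ _ _ []].
  - move=> j s [ms jn [q0 q1 q2 q3] [q7 q6 q9 q10]].
    apply: exec_le_add; rewrite /I2 /= /upd /= q0 q1 q2 q3 q6 q7 q9 q10.
    have -> : table_dim n - j = (table_dim n - j.+1).+1 by lia.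
    by split=> //; split=> //; [lia | rewrite ?mulSn 1?addnC].
  rewrite /I2 /= /upd /= r0 r2 r3 r6 r8 r9 r10 subnn mul0n addn0 /table_dim.
  by split=> //; split=> //; lia.
move=> s2 [ms2 _ [q0 q1 q2 q3] [q7 q6 q9 q10]]; rewrite subn0 in q10.
do 3!(apply: (@exec_le_seq _ _ _ _ _ (eq _)) => [|_ <-]; first by apply: exec_le_add).
apply: H => //=; split=> //=; rewrite /upd /= ?q0 //.
by case=> [|[|[|[|i]]]] //= _; rewrite ?q1 ?q2 ?q3 ?q9 ?q10 //=; lia.
Qed.

Lemma raw_program s : swf s -> mdepth s <= 1 -> exists P c d, forall input n m,
  nth 0 input 0 = n -> nth 0 input 1 = m ->
  exec_le P (init_state input) (c * n.+1 ^ d * m.+1)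
    (fun s' => Defs.mem s' = rrun (params n m) (fun=> 0) (nth 0 input) s).
Proof.
move=> W md; have [c [d H]] := scost_poly W.
exists (prelude (scompile (fun=> 0) 11 s)), (24 + c * 3 ^ d), (2 * d + 2) => input n m en em.
have le0 : params n m 1 <= params n m 0 by rewrite /params /table_dim; nia.
apply: exec_le_weak (prelude_ok en em (T := scost (params n m) s) _) _ (fun s' q => q).
  move=> s0 rdy ms; apply: exec_le_weak (scompile_ok W rdy) (leqnn _) _ => s' [-> _].
  by rewrite ms.
have n1 : n.+1 ^ 2 <= n.+1 ^ (2 * d + 2) by rewrite leq_pexp2l // leq_addl.
have sc : scost (params n m) s <= c * 3 ^ d * n.+1 ^ (2 * d + 2) * m.+1.
  apply: leq_trans (H _ le0) _; apply: leq_mul; last first.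
    by case: (mdepth s) md => [|[|k]] // _; rewrite /params ?expn0 ?expn1.
  rewrite -mulnA leq_mul2l; apply/orP; right.
  apply: leq_trans (_ : (3 * n.+1 ^ 2) ^ d <= _).
    by case: (d) => // d'; rewrite leq_exp2r // /params /table_dim; nia.
  by rewrite expnMn -expnM leq_mul2l leq_pexp2l ?leq_addr ?orbT.
rewrite [X in _ <= X * m.+1]mulnDl mulnDl leq_add //.
apply: leq_trans (_ : 24 * n.+1 ^ 2 <= _); first by rewrite /table_dim; nia.
apply: leq_trans (_ : 24 * n.+1 ^ (2 * d + 2) <= _); first by rewrite leq_mul2l n1 orbT.
by rewrite leq_pmulr.
Qed.

(** * A language of tables *)

(* Square tables indexed below [p 0], stored above address [p 3]; the raw memory below
   [p 3] holds the input and later the output.  Out-of-range accesses read 0. *)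
Inductive texpr :=
| TCst (k : nat) | TPar (i : nat) | TVar (x : nat)
| TRd (a : nat) (i j : texpr) | TRaw (e : texpr)
| TAdd (a b : texpr) | TSub (a b : texpr) | TIf (c a b : texpr)
| TSum (x : nat) (e : texpr) | TScale (i : nat) (e : texpr).

Inductive tstmt :=
| TLet (a x y : nat) (e : texpr) | TOut (a b : texpr)
| TSeq (s1 s2 : tstmt) | TFor (i x : nat) (s : tstmt).

Record tstate := TState { raw : nat -> nat; tab : nat -> nat -> nat -> nat }.

Fixpoint teval (p : nat -> nat) (st : tstate) (env : nat -> nat) (e : texpr) : nat :=
  match e with
  | TCst k => k
  | TPar i => p i
  | TVar x => env x
  | TRd a i j => let: u := teval p st env i in let: v := teval p st env j in
      if (u < p 0) && (v < p 0) then tab st a u v else 0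
  | TRaw a => let: u := teval p st env a in if u < p 3 then raw st u else 0
  | TAdd a b => teval p st env a + teval p st env b
  | TSub a b => teval p st env a - teval p st env b
  | TIf c a b => if teval p st env c != 0 then teval p st env a else teval p st env b
  | TSum x a => \sum_(i < p 0) teval p st (upd env x i) a
  | TScale i a => teval p st env a * p i
  end.

Definition set_tab (st : tstate) (a : nat) (f : nat -> nat -> nat) : tstate :=
  TState (raw st) (fun b => if b == a then f else tab st b).

Fixpoint trun (p env : nat -> nat) (st : tstate) (s : tstmt) : tstate :=
  match s with
  | TLet a x y e => set_tab st a (fun i j => teval p st (upd (upd env x i) y j) e)
  | TOut a b => let: u := teval p st env a in
      if u < p 3 then TState (upd (raw st) u (teval p st env b)) (tab st) else st
  | TSeq s1 s2 => trun p env (trun p env st s1) s2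
  | TFor i x s => iteri (p i) (fun k st => trun p (upd env x k) st s) st
  end.

Definition cell (a : nat) (i j : rexpr) : rexpr :=
  RAdd (RPar 3) (RAdd (RScale 0 (RAdd (RScale 0 (RCst a)) i)) j).

Definition guarded (a b e : rexpr) : rexpr := RIf (RSub b a) e (RCst 0).

Fixpoint elower (e : texpr) : rexpr :=
  match e with
  | TCst k => RCst k
  | TPar i => RPar i
  | TVar x => RVar x
  | TRd a i j => guarded (elower i) (RPar 0) (guarded (elower j) (RPar 0)
                   (RMem (cell a.+1 (elower i) (elower j))))
  | TRaw a => guarded (elower a) (RPar 3) (RMem (elower a))
  | TAdd a b => RAdd (elower a) (elower b)
  | TSub a b => RSub (elower a) (elower b)
  | TIf c a b => RIf (elower c) (elower a) (elower b)
  | TSum x a => RSum x (elower a)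
  | TScale i a => RScale i (elower a)
  end.

Definition fill (x y : nat) (a b : rexpr) : rstmt := RFor 0 x (RFor 0 y (RPut a b)).

(* Table slot 0 buffers the new contents, so that a table may be updated simultaneously;
   an out-of-range output is diverted to that buffer. *)
Fixpoint slower (s : tstmt) : rstmt :=
  match s with
  | TLet a x y e =>
      RSeq (fill x y (cell 0 (RVar x) (RVar y)) (elower e))
           (fill x y (cell a.+1 (RVar x) (RVar y)) (RMem (cell 0 (RVar x) (RVar y))))
  | TOut a b => RPut (RIf (RSub (RPar 3) (elower a)) (elower a) (RPar 3)) (elower b)
  | TSeq s1 s2 => RSeq (slower s1) (slower s2)
  | TFor i x s => RFor i x (slower s)
  end.

Fixpoint twf_expr (e : texpr) : bool :=
  match e with
  | TCst _ | TVar _ => true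
  | TPar i => i < 4
  | TRd _ a b => twf_expr a && twf_expr b
  | TRaw a | TSum _ a => twf_expr a
  | TScale i a => (i < 2) && twf_expr a
  | TAdd a b | TSub a b => twf_expr a && twf_expr b
  | TIf c a b => [&& twf_expr c, twf_expr a & twf_expr b]
  end.

Fixpoint twf (s : tstmt) : bool :=
  match s with
  | TLet _ x y e => (x != y) && twf_expr e
  | TOut a b => twf_expr a && twf_expr b
  | TSeq s1 s2 => twf s1 && twf s2
  | TFor i _ s => ((i == 0) || (i == 2)) && twf s
  end.

Fixpoint tdepth (s : tstmt) : nat :=
  match s with
  | TLet _ _ _ _ | TOut _ _ => 0
  | TSeq s1 s2 => maxn (tdepth s1) (tdepth s2)
  | TFor i _ s => (i == 2) + tdepth s
  end.

Lemma elower_wf e : twf_expr e -> ewf (elower e).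
Proof.
elim: e => //= [a i IHi j IHj|a IHa|a IHa b IHb|a IHa b IHb|c IHc a IHa b IHb|i a IHa].
- by case/andP=> /IHi-> /IHj->.
- by move=> /IHa->.
- by case/andP=> /IHa-> /IHb->.
- by case/andP=> /IHa-> /IHb->.
- by case/and3P=> /IHc-> /IHa-> /IHb->.
- by case/andP=> -> /IHa->.
Qed.

Lemma slower_wf s : twf s -> swf (slower s).
Proof.
elim: s => //= [a x y e|a b|s1 IH1 s2 IH2|i x s IH].
- by case/andP=> _ /elower_wf->.
- by case/andP=> /elower_wf-> /elower_wf->.
- by case/andP=> /IH1-> /IH2->.
- by case/andP=> -> /IH->.
Qed.

Lemma slower_depth s : mdepth (slower s) = tdepth s.
Proof. by elim: s => //= [s1 -> s2 ->|i x s ->]. Qed.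

Section Lower.
Variable p : nat -> nat.
Local Notation N := (p 0).

Definition cell_addr a i j : nat := p 3 + ((a * N + i) * N + j).

Definition rep (M : nat -> nat) (st : tstate) : Prop :=
  (forall q, q < p 3 -> M q = raw st q) /\
  (forall a i j, i < N -> j < N -> M (cell_addr a.+1 i j) = tab st a i j).

Lemma cell_addr_inj a i j a' i' j' : i < N -> j < N -> i' < N -> j' < N ->
  cell_addr a i j = cell_addr a' i' j' -> [/\ a = a', i = i' & j = j'].
Proof.
move=> iN jN i'N j'N /addnI E.
have N0 : 0 < N by apply: leq_ltn_trans iN.
have := congr1 (fun k => k %/ N) E; rewrite !divnMDl // !divn_small // !addn0 => E1.
have := congr1 (fun k => k %/ N) E1; rewrite !divnMDl // !divn_small // !addn0 => E2.
by move: E1 E; rewrite E2 => /addnI -> /addnI ->.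
Qed.

Lemma reval_cell M env a i j :
  reval p M env (cell a i j) = cell_addr a (reval p M env i) (reval p M env j).
Proof. by []. Qed.

Lemma reval_mem M env e : reval p M env (RMem e) = M (reval p M env e).
Proof. by []. Qed.

Lemma reval_guarded M env a b e : reval p M env (guarded a b e) =
  if reval p M env a < reval p M env b then reval p M env e else 0.
Proof. by rewrite /= subn_eq0 -ltnNge. Qed.

Lemma elower_ok M st env e : rep M st -> reval p M env (elower e) = teval p st env e.
Proof.
move=> [rraw rtab]; elim: e env => [k|i|x|a i IHi j IHj|a IHa|a IHa b IHb|a IHa b IHb|c IHc a IHa b IHb|x a IHa|i a IHa] env //.
- rewrite [elower _]/= 2!reval_guarded reval_mem reval_cell IHi IHj /=.
  case: ltnP => //= iN; case: ltnP => //= jN; exact: rtab.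
- rewrite [elower _]/= reval_guarded reval_mem IHa /=; case: ltnP => //= aB; exact: rraw.
- by rewrite /= IHa IHb.
- by rewrite /= IHa IHb.
- by rewrite /= IHc IHa IHb.
- by rewrite /=; apply: eq_bigr => i _; rewrite IHa.
- by rewrite /= IHa.
Qed.

Lemma fill_loop (n : nat) (al be : nat -> nat) (F : nat -> (nat -> nat) -> nat) (M : nat -> nat) :
  (forall j j', j < n -> j' < n -> al j = al j' -> j = j') ->
  (forall j M', j < n -> (forall q, (forall l, l < n -> q != al l) -> M' q = M q) -> F j M' = be j) ->
  let M' := iteri n (fun j M => upd M (al j) (F j M)) M in
  (forall j, j < n -> M' (al j) = be j) /\
  (forall q, (forall l, l < n -> q != al l) -> M' q = M q).
Proof.
move=> inj HF; suff H k : k <= n -> let M' := iteri k (fun j M => upd M (al j) (F j M)) M in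
    (forall j, j < k -> M' (al j) = be j) /\ (forall q, (forall l, l < n -> q != al l) -> M' q = M q).
  exact: H.
elim: k => [|k IHk] kn //=; have [H1 H2] := IHk (ltnW kn); split=> [j|q Hq].
  rewrite ltnS leq_eqVlt => /predU1P[->|jk]; first by rewrite updE HF.
  rewrite upd_neq ?H1 //; apply/eqP => /(inj _ _ (ltn_trans jk kn) kn) e.
  by rewrite e ltnn in jk.
by rewrite upd_neq ?H2 // Hq.
Qed.

Lemma fill_ok M env x y a b (al be : nat -> nat -> nat) : x != y ->
  (forall i j i' j', i < N -> j < N -> i' < N -> j' < N -> al i j = al i' j' -> i = i' /\ j = j') ->
  (forall M' i j, i < N -> j < N -> reval p M' (upd (upd env x i) y j) a = al i j) ->
  (forall M' i j, i < N -> j < N ->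
     (forall q, (forall i' j', i' < N -> j' < N -> q != al i' j') -> M' q = M q) ->
     reval p M' (upd (upd env x i) y j) b = be i j) ->
  let M' := rrun p env M (fill x y a b) in
  (forall i j, i < N -> j < N -> M' (al i j) = be i j) /\
  (forall q, (forall i j, i < N -> j < N -> q != al i j) -> M' q = M q).
Proof.
move=> xy inj Ha Hb; suff H k : k <= N ->
    let M' := iteri k (fun i M => rrun p (upd env x i) M (RFor 0 y (RPut a b))) M in
    (forall i j, i < k -> j < N -> M' (al i j) = be i j) /\
    (forall q, (forall i j, i < N -> j < N -> q != al i j) -> M' q = M q) by exact: H.
elim: k => [|k IHk] kn //; have [H1 H2] := IHk (ltnW kn).
rewrite iteriS; set M1 := iteri k _ _ in H1 H2 *.
have e : rrun p (upd env x k) M1 (RFor 0 y (RPut a b)) =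
    iteri N (fun j M => upd M (reval p M (upd (upd env x k) y j) a) (reval p M (upd (upd env x k) y j) b)) M1 by [].
have e' : forall n, n <= N -> iteri n (fun j M => upd M (reval p M (upd (upd env x k) y j) a) (reval p M (upd (upd env x k) y j) b)) M1
   = iteri n (fun j M => upd M (al k j) (reval p M (upd (upd env x k) y j) b)) M1.
  by elim=> //= n IHn nN; rewrite IHn ?Ha //; apply: ltnW.
rewrite e e' //.
have [] := @fill_loop N (al k) (be k) (fun j M => reval p M (upd (upd env x k) y j) b) M1.
- by move=> j j' jN j'N /(inj _ _ _ _ kn jN kn j'N)[].
- move=> j M' jN HM'; apply: Hb => // q Hq; rewrite HM' ?H2 // => l lN; exact: Hq.
move=> G1 G2; split=> [i j|q Hq]; last by rewrite G2 ?H2 // => l lN; exact: Hq.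
rewrite ltnS leq_eqVlt => /predU1P[->|ik] jN; first exact: G1.
rewrite G2 ?H1 // => l lN; apply/eqP => /(inj _ _ _ _ (ltn_trans ik kn) jN kn lN)[e1 _].
by rewrite e1 ltnn in ik.
Qed.

Lemma slower_ok s M env st : twf s -> rep M st -> rep (rrun p env M (slower s)) (trun p env st s).
Proof.
elim: s M env st => [a x y e|a b|s1 IH1 s2 IH2|i x s IH] M env st W R.
- case/andP: W => xy We.
  have ev i j : upd (upd env x i) y j x = i.
    by rewrite upd_neq // updE.
  have cellE M' c i j : reval p M' (upd (upd env x i) y j) (cell c (RVar x) (RVar y)) = cell_addr c i j.
    by rewrite reval_cell /= ev updE.
  have inj c i j i' j' : i < N -> j < N -> i' < N -> j' < N ->
      cell_addr c i j = cell_addr c i' j' -> i = i' /\ j = j'.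
    by move=> iN jN i'N j'N /(cell_addr_inj iN jN i'N j'N)[].
  have neq c c' i j i' j' : c != c' -> i < N -> j < N -> i' < N -> j' < N ->
      cell_addr c i j != cell_addr c' i' j'.
    move=> cc' iN jN i'N j'N; apply: contra cc' => /eqP.
    by case/(cell_addr_inj iN jN i'N j'N) => ->.
  have base c i j q : q < p 3 -> q != cell_addr c i j.
    by move=> q3; rewrite neq_ltn (leq_trans q3) ?leq_addr.
  have [] := @fill_ok M env x y (cell 0 (RVar x) (RVar y)) (elower e) (cell_addr 0)
      (fun i j => teval p st (upd (upd env x i) y j) e) xy (inj 0).
  + by move=> M' i j _ _; exact: cellE.
  + move=> M' i j iN jN HM'; apply: elower_ok; case: R => R1 R2; split.
      by move=> q q3; rewrite HM' ?R1 // => i' j' _ _; exact: base.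
    by move=> c i' j' i'N j'N; rewrite HM' ?R2 // => k l kN lN; exact: neq.
  set M1 := rrun p env M (fill x y (cell 0 (RVar x) (RVar y)) (elower e)) => A1 A2.
  have [] := @fill_ok M1 env x y (cell a.+1 (RVar x) (RVar y)) (RMem (cell 0 (RVar x) (RVar y))) (cell_addr a.+1)
      (fun i j => teval p st (upd (upd env x i) y j) e) xy (inj a.+1).
  + by move=> M' i j _ _; exact: cellE.
  + move=> M' i j iN jN HM'.
    rewrite -[LHS]/(M' (reval p M' (upd (upd env x i) y j) (cell 0 (RVar x) (RVar y)))) cellE HM'; first exact: A1.
    by move=> k l kN lN; exact: neq.
  set M2 := rrun p env M1 (fill x y (cell a.+1 (RVar x) (RVar y)) (RMem (cell 0 (RVar x) (RVar y)))).
  move=> B1 B2; rewrite -[rrun _ _ _ (slower _)]/M2.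
  case: R => R1 R2; split.
    by move=> q q3; rewrite B2 ?A2 ?R1 // => i j _ _; exact: base.
  move=> c i j iN jN; rewrite [tab _ _]/=; have [->|ca] := eqVneq c a; first exact: B1.
  by rewrite B2 ?A2 ?R2 // => k l kN lN; apply: neq.
- case: (R) => R1 R2; rewrite /= !(elower_ok _ _ R) subn_eq0 -ltnNge.
  case: ltnP => a3.
    split=> [q q3|c i j iN jN] /=; first by rewrite /upd; case: eqP => // _; exact: R1.
    by rewrite upd_neq ?R2 // gtn_eqF // (leq_trans a3) ?leq_addr.
  split=> [q q3|c i j iN jN]; first by rewrite upd_neq ?R1 // ltn_eqF.
  have N0 : 0 < N by apply: leq_ltn_trans iN.
  have p3 : p 3 = cell_addr 0 0 0 by rewrite /cell_addr !mul0n !addn0.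
  rewrite upd_neq ?R2 // p3; apply/eqP => /(cell_addr_inj iN jN N0 N0)[//].
- by case/andP: W => W1 W2; apply: IH2 => //; apply: IH1.
case/andP: W => _ W /=; elim: (p i) => [//|k IHk].
by rewrite !iteriS; apply: IH.
Qed.

End Lower.

Lemma table_program s : twf s -> tdepth s <= 1 -> exists P c d, forall input n m,
  nth 0 input 0 = n -> nth 0 input 1 = m -> size input <= params n m 3 ->
  exists t s', [/\ exec P (init_state input) t s', t <= c * n.+1 ^ d * m.+1
    & forall q, q < params n m 3 ->
      Defs.mem s' q = raw (trun (params n m) (fun=> 0) (TState (nth 0 input) (fun _ _ _ => 0)) s) q].
Proof.
move=> W td; have [|P [c [d H]]] := raw_program (slower_wf W); first by rewrite slower_depth.
exists P, c, d => input n m en em sz; have [t [s' [e le ms]]] := H input n m en em.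
exists t, s'; split=> // q qb; rewrite ms.
have R0 : rep (params n m) (nth 0 input) (TState (nth 0 input) (fun _ _ _ => 0)).
  by split=> // a i j _ _; rewrite nth_default // (leq_trans sz) ?leq_addr.
by have [-> //] := slower_ok (fun=> 0) W R0.
Qed.

(** * A language of families of sets *)

Inductive ix := IC (k : nat) | IV (x : nat) | IP (i : ix).

(* [SImg s a k] is the union of the rows of the family [a] whose index lies in [s],
   shifted down by one if [k] holds. *)
Inductive sx :=
| SRow (a : nat) (i : ix) | SX | SSing (i : ix) | SU (s s' : sx) | SI (s s' : sx)
| SD (s s' : sx) | SIf (b : bx) (s s' : sx) | SImg (s : sx) (a : nat) (k : bool)
| SFirst (s : sx) | SSep (x : nat) (b : bx) | SInp (i : ix)
with bx :=
| BNe (s : sx) | BNot (b : bx) | BAnd (b b' : bx) | BLt (i j : ix) | BIn (i : ix) (s : sx)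
| BCard (i : ix) (s s' : sx).

Inductive sstmt :=
| SLet (a x : nat) (s : sx) | SSeq (s1 s2 : sstmt) | SFor (i x : nat) (s : sstmt).

Scheme sx_bx_ind := Induction for sx Sort Prop with bx_sx_ind := Induction for bx Sort Prop.
Combined Scheme sx_mutind from sx_bx_ind, bx_sx_ind.

Fixpoint iden (env : nat -> nat) (i : ix) : nat :=
  match i with IC k => k | IV x => env x | IP i => (iden env i).-1 end.

Section Semantics.
Variables (N n : nat) (inp : nat -> bool).
Local Notation V := 'I_N.
Implicit Types (F : nat -> nat -> {set V}) (env : nat -> nat).

Fixpoint sden F env (s : sx) : {set V} :=
  match s with
  | SRow a i => F a (iden env i)
  | SX => [set v : V | v < n]
  | SSing i => [set v : V | v == iden env i :> nat]
  | SU s s' => sden F env s :|: sden F env s'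
  | SI s s' => sden F env s :&: sden F env s'
  | SD s s' => sden F env s :\: sden F env s'
  | SIf b s s' => if bden F env b then sden F env s else sden F env s'
  | SImg s a k => [set v : V | [exists u in sden F env s, v \in F a (if k then u.-1 else u)]]
  | SFirst s => first (sden F env s)
  | SSep x b => [set v : V | bden F (upd env x v) b]
  | SInp i => [set v : V | (v < n) && inp (2 + n * n + iden env i * n + v)]
  end
with bden F env (b : bx) : bool :=
  match b with
  | BNe s => sden F env s != set0
  | BNot b => ~~ bden F env b
  | BAnd b b' => bden F env b && bden F env b'
  | BLt i j => iden env i < iden env j
  | BIn i s => [exists v in sden F env s, v == iden env i :> nat]
  | BCard i s s' => minn (iden env i) N * #|sden F env s| <= #|sden F env s'|
  end.

Definition set_fam F a (f : nat -> {set V}) : nat -> nat -> {set V} :=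
  fun b => if b == a then f else F b.

Fixpoint srun (bound : nat -> nat) env F (s : sstmt) : nat -> nat -> {set V} :=
  match s with
  | SLet a x s => set_fam F a (fun i => if i < N then sden F (upd env x i) s else set0)
  | SSeq s1 s2 => srun bound env (srun bound env F s1) s2
  | SFor i x s => iteri (bound i) (fun k F => srun bound (upd env x k) F s) F
  end.

Fixpoint writes (s : sstmt) : seq nat :=
  match s with
  | SLet a _ _ => [:: a]
  | SSeq s1 s2 => writes s1 ++ writes s2
  | SFor _ _ s => writes s
  end.

Lemma srun_frame bound env F s b : b \notin writes s -> srun bound env F s b = F b.
Proof.
elim: s env F => [a x s|s1 IH1 s2 IH2|i x s IH] env F /=.
- by rewrite inE /set_fam => /negbTE ->.
- by rewrite mem_cat negb_or => /andP[/IH1 e1 /IH2 ->].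
by move=> /IH e; elim: (bound i) => //= k IHk; rewrite e.
Qed.

End Semantics.

(* The variables of the set language become even, and those ranging over the elements of
   a set become odd. *)
Definition tnot e := TIf e (TCst 0) (TCst 1).
Definition tand a b := TIf a b (TCst 0).
Definition teq a b := tnot (TAdd (TSub a b) (TSub b a)).
Definition tvar y := TVar y.*2.+1.
Definition tcard y e := TSum y.*2.+1 (TIf e (TCst 1) (TCst 0)).
Definition tex y e := TSum y.*2.+1 e.

Fixpoint ilow (i : ix) : texpr :=
  match i with IC k => TCst k | IV x => TVar x.*2 | IP i => TSub (ilow i) (TCst 1) end.

Fixpoint slow (y : nat) (s : sx) : texpr :=
  match s with
  | SRow a i => TRd a (ilow i) (tvar y)
  | SX => TSub (TPar 1) (tvar y)
  | SSing i => teq (tvar y) (ilow i)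
  | SU s s' => TAdd (slow y s) (slow y s')
  | SI s s' => tand (slow y s) (slow y s')
  | SD s s' => tand (slow y s) (tnot (slow y s'))
  | SIf b s s' => TIf (blow y b) (slow y s) (slow y s')
  | SImg s a k => tex y.+1 (tand (slow y.+1 s)
      (TRd a (if k then TSub (tvar y.+1) (TCst 1) else tvar y.+1) (tvar y)))
  | SFirst s => tand (slow y s)
      (tnot (tex y.+1 (tand (slow y.+1 s) (TSub (tvar y) (tvar y.+1)))))
  | SSep x b => TSum x.*2 (tand (teq (TVar x.*2) (tvar y)) (blow y.+1 b))
  | SInp i => tand (TSub (TPar 1) (tvar y))
      (TRaw (TAdd (TAdd (TAdd (TCst 2) (TScale 1 (TPar 1))) (TScale 1 (ilow i))) (tvar y)))
  end
with blow (y : nat) (b : bx) : texpr :=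
  match b with
  | BNe s => tex y (slow y s)
  | BNot b => tnot (blow y b)
  | BAnd b b' => tand (blow y b) (blow y b')
  | BLt i j => TSub (ilow j) (ilow i)
  | BIn i s => tex y (tand (slow y s) (teq (tvar y) (ilow i)))
  | BCard i s s' => tnot (TSub
      (tex y (tand (TSub (ilow i) (tvar y)) (tcard y.+1 (slow y.+1 s)))) (tcard y (slow y s')))
  end.

Fixpoint lower (s : sstmt) : tstmt :=
  match s with
  | SLet a x s => TLet a x.*2 1 (slow 0 s)
  | SSeq s1 s2 => TSeq (lower s1) (lower s2)
  | SFor i x s => TFor i x.*2 (lower s)
  end.

Section LowerSets.
Variable p : nat -> nat.
Local Notation N := (p 0).
Local Notation V := 'I_N.
Variable R : nat -> nat.
Definition input_bit (q : nat) : bool := (q < p 3) && (R q != 0).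
Definition fam (st : tstate) (a i : nat) : {set V} :=
  [set v : V | (i < N) && (tab st a i v != 0)].
Local Notation sden := (sden (p 1) input_bit).
Local Notation bden := (bden (p 1) input_bit).
Local Notation truth st env e := (teval p st env e != 0).

Definition agree (env env' : nat -> nat) : Prop := forall x, env' x.*2 = env x.

Lemma agree_odd env env' y v : agree env env' -> agree env (upd env' y.*2.+1 v).
Proof. by move=> H x; rewrite upd_neq ?H //; lia. Qed.

Lemma agree_even env env' x v : agree env env' -> agree (upd env x v) (upd env' x.*2 v).
Proof.
move=> H z; rewrite /upd; have -> : (z.*2 == x.*2) = (z == x) by lia.
by case: eqP.
Qed.

Lemma truth_not st env e : truth st env (tnot e) = ~~ truth st env e.
Proof. by rewrite /=; case: (teval p st env _). Qed.
Lemma truth_and st env a b : truth st env (tand a b) = truth st env a && truth st env b.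
Proof. by rewrite /=; case: (teval p st env _). Qed.
Lemma truth_eq st env a b : truth st env (teq a b) = (teval p st env a == teval p st env b).
Proof. by rewrite truth_not /=; lia. Qed.
Lemma truth_sub st env a b : truth st env (TSub a b) = (teval p st env b < teval p st env a).
Proof. by rewrite /=; lia. Qed.
Lemma truth_sum st env x e :
  truth st env (TSum x e) = [exists v : V, truth st (upd env x v) e].
Proof. by rewrite /= sum_nat_eq0 negb_forall. Qed.
Lemma eval_card st env y e :
  teval p st env (tcard y e) = #|[set v : V | truth st (upd env y.*2.+1 v) e]|.
Proof.
rewrite /= -sum1dep_card [RHS]big_mkcond; apply: eq_bigr => v _ /=.
by case: eqP.
Qed.
Lemma truth_rd st (env : nat -> nat) a i y (v : V) : env y = v ->
  truth st env (TRd a i (TVar y)) = (v \in fam st a (teval p st env i)).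
Proof. by move=> e; rewrite inE /= e ltn_ord andbT; case: ifP. Qed.

Lemma ilow_ok st env env' i : agree env env' -> teval p st env' (ilow i) = iden env i.
Proof. by move=> H; elim: i => //= i ->; rewrite subn1. Qed.

Lemma setP_card (A B : {set V}) : A = B -> #|A| = #|B|.
Proof. by move=> ->. Qed.

Lemma lower_exprs st : raw st = R ->
  (forall s env env' y (v : V), agree env env' -> env' y.*2.+1 = v ->
     truth st env' (slow y s) = (v \in sden (fam st) env s)) /\
  (forall b env env' y, agree env env' -> truth st env' (blow y b) = bden (fam st) env b).
Proof.
move=> eR; have up y env v : upd env y.*2.+1 v y.*2.+1 = v by rewrite updE.
apply: sx_mutind.
- by move=> a i env env' y v H e; rewrite [slow _ _]/= (truth_rd _ _ _ e) (ilow_ok _ _ H).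
- by move=> env env' y v H e; rewrite truth_sub /= inE e.
- by move=> i env env' y v H e; rewrite truth_eq (ilow_ok _ _ H) /= inE e.
- move=> s IHs s' IHs' env env' y v H e; rewrite in_setU -(IHs _ _ _ _ H e) -(IHs' _ _ _ _ H e) /=.
  by lia.
- by move=> s IHs s' IHs' env env' y v H e; rewrite truth_and in_setI (IHs _ _ _ _ H e) (IHs' _ _ _ _ H e).
- move=> s IHs s' IHs' env env' y v H e.
  by rewrite truth_and truth_not in_setD (IHs _ _ _ _ H e) (IHs' _ _ _ _ H e) andbC.
- move=> b IHb s IHs s' IHs' env env' y v H e.
  rewrite -[sden _ _ _]/(if bden (fam st) env b then sden (fam st) env s else sden (fam st) env s').
  rewrite -(IHb _ _ y H) /=; case: ifP => _; [exact: IHs|exact: IHs'].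
- move=> s IHs a k env env' y v H e; rewrite truth_sum inE; apply: eq_existsb => u.
  have H' := agree_odd y.+1 u H.
  rewrite truth_and (IHs _ _ _ _ H' (up _ _ _)); congr (_ && _).
  rewrite (@truth_rd _ _ _ _ _ v) ?upd_neq //; last by lia.
  by case: k => /=; rewrite up ?subn1.
- move=> s IHs env env' y v H e; rewrite truth_and truth_not truth_sum inE (IHs _ _ _ _ H e); congr (_ && _).
  rewrite negb_exists; apply: eq_forallb => u.
  have H' := agree_odd y.+1 u H.
  rewrite truth_and truth_sub (IHs _ _ _ _ H' (up _ _ _)) /= up upd_neq ?e; last by lia.
  by rewrite negb_and implybE -leqNgt.
- move=> x b IHb env env' y v H e; rewrite truth_sum inE.
  apply/existsP/idP => [[u]|h].
    rewrite truth_and truth_eq /= updE upd_neq ?e; last by lia.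
    by case/andP=> /eqP <-; rewrite (IHb _ _ _ (agree_even x u H)).
  exists v; rewrite truth_and truth_eq /= updE upd_neq ?e ?eqxx; last by lia.
  by rewrite (IHb _ _ _ (agree_even x v H)).
- move=> i env env' y v H e; rewrite truth_and truth_sub inE /= e (ilow_ok _ _ H) eR.
  by rewrite /input_bit; case: ifP.
- move=> s IHs env env' y H; rewrite truth_sum /=.
  apply/existsP/set0Pn => -[u h]; exists u; move: h; by rewrite (IHs _ _ _ _ (agree_odd y u H) (up _ _ _)).
- by move=> b IHb env env' y H; rewrite truth_not (IHb _ _ _ H).
- by move=> b IHb b' IHb' env env' y H; rewrite truth_and (IHb _ _ _ H) (IHb' _ _ _ H).
- by move=> i j env env' y H; rewrite truth_sub !(ilow_ok _ _ H).
- move=> i s IHs env env' y H; rewrite truth_sum; apply: eq_existsb => u.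
  have H' := agree_odd y u H.
  by rewrite truth_and truth_eq (IHs _ _ _ _ H' (up _ _ _)) (ilow_ok _ _ H') /= up.
move=> i s IHs s' IHs' env env' y H; rewrite truth_not truth_sub eval_card -leqNgt.
have -> : [set v : V | truth st (upd env' y.*2.+1 v) (slow y s')] = sden (fam st) env s'.
  by apply/setP => v; rewrite inE (IHs' _ _ _ _ (agree_odd y v H) (up _ _ _)).
congr (_ <= _); rewrite [LHS]/=.
transitivity (\sum_(v < N | v < iden env i) #|sden (fam st) env s|).
  rewrite [RHS]big_mkcond /=; apply: eq_bigr => v _; have H' := agree_odd y v H.
  rewrite (ilow_ok _ _ H') updE subn_eq0 -ltnNge; case: ifP => // _.
  rewrite -[LHS]/(teval p st (upd env' y.*2.+1 v) (tcard y.+1 (slow y.+1 s))) eval_card; apply: setP_card.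
  by apply/setP => u; rewrite inE (IHs _ _ _ _ (agree_odd y.+1 u H') (up _ _ _)).
rewrite -[RHS]/(minn (iden env i) N * #|sden (fam st) env s|).
have [kN|Nk] := leqP (iden env i) N.
  by rewrite (big_ord_narrow kN) sum_nat_const card_ord.
rewrite (eq_bigl xpredT) ?sum_nat_const ?card_ord // => v.
exact: ltn_trans (ltn_ord v) Nk.
Qed.

Lemma lower_raw s env st : raw (trun p env st (lower s)) = raw st.
Proof.
elim: s env st => //= [s1 IH1 s2 IH2|i x s IH] env st; first by rewrite IH2 IH1.
by elim: (p i) => //= k IHk; rewrite IH.
Qed.

Lemma lower_ok s env env' st : raw st = R -> agree env env' ->
  fam (trun p env' st (lower s)) = srun (p 1) input_bit p env (fam st) s.
Proof.
elim: s env env' st => [a x s|s1 IH1 s2 IH2|i x s IH] env env' st eR H /=.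
- apply/funext => b; rewrite /set_fam /fam /=; case: eqP => // _; apply/funext => i; apply/setP => v; rewrite inE.
  case: ltnP => iN; last by rewrite inE.
  have [Hs _] := lower_exprs eR; apply: Hs; last exact: updE.
  exact: (agree_odd 0 v (agree_even x i H)).
- by rewrite (IH2 env) ?lower_raw // (IH1 env).
elim: (p i) => //= k IHk; rewrite (IH (upd env x k)) ?IHk //; last exact: agree_even.
by elim: {IHk} k => //= k IHk; rewrite lower_raw.
Qed.

End LowerSets.

(** * The separator as a program *)

Lemma iteri_ind (T : Type) (P : nat -> T -> Prop) (f : nat -> T -> T) n x :
  P 0 x -> (forall k y, k < n -> P k y -> P k.+1 (f k y)) -> P n (iteri n f x).
Proof.
move=> P0 PS; suff H k : k <= n -> P k (iteri k f x) by exact: H.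
by elim: k => //= k IHk kn; apply: PS => //; apply/IHk/ltnW.
Qed.

Local Notation "s1 ;; s2" := (SSeq s1 s2) (at level 60, right associativity).
Local Notation row a := (SRow a (IC 0)).
Local Notation nbx s := (SImg s 0 false).

Definition comp_prog (K d : nat) : sstmt :=
  SLet K 0 (SD (row d) (row d)) ;;
  SFor 0 1 (SLet K 0 (SU (SI (row d) (SSing (IV 0))) (SI (row d) (nbx (SRow K (IV 0)))))).

Definition layerx (a d : nat) (s : sx) : sx := SI (SI (row d) SX) (nbx (SU (row a) s)).

Definition grow_prog (G a d : nat) : sstmt :=
  let prev := SRow G (IP (IV 0)) in
  SFor 0 1 (SLet G 0 (SIf (BLt (IC 0) (IV 0))
    (SU (SU prev (layerx a d prev)) (SI (SD (row d) SX) (nbx (layerx a d prev))))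
    (SI (SD (row d) SX) (nbx (row a))))).

Definition touchx (s s' : sx) : bx := BNe (SI (nbx s) s').

Definition erase_prog (P Q G a b d r : nat) : sstmt :=
  SLet P 0 (row d) ;;
  SFor 0 2 (SLet Q 0 (SD (row P) (SSing (IV 2))) ;;
            grow_prog G a Q ;;
            SLet P 0 (SIf (touchx (SRow G (IV r)) (row b)) (row Q) (row P))).

Section Programs.
Variables (N n : nat) (inp : nat -> bool) (bound : nat -> nat) (E : rel 'I_N).
Hypothesis bound0 : bound 0 = N.
Hypothesis N_gt0 : 0 < N.
Local Notation V := 'I_N.
Local Notation X := [set v : V | v < n].
Local Notation fam := (nat -> nat -> {set V}).
Implicit Types (F : fam) (env : nat -> nat) (D W : {set V}).
Local Notation sden := (@sden N n inp).
Local Notation bden := (@bden N n inp).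
Local Notation srun := (srun n inp bound).
Local Notation comp := (comp E).
Local Notation nb := (nb E).

Definition edges_ok F : Prop := forall u v : V, (v \in F 0 u) = E u v.

Lemma in_first D v : (v \in first D) = (v \in D) && [forall u in D, v <= u].
Proof. by rewrite in_set. Qed.

Lemma nbx_ok F env s : edges_ok F -> sden F env (nbx s) = nb (sden F env s).
Proof.
move=> EF; apply/setP => v; rewrite in_set [RHS]in_set; apply: eq_existsb => u.
by rewrite EF.
Qed.

Lemma touch_nbl D W : touch E D W = (nb D :&: W != set0).
Proof.
apply/touchP/set0Pn => [[u [v [uD vW uv]]]|[v]].
  by exists v; rewrite in_setI vW andbT; apply/nbP; exists u.
by rewrite in_setI => /andP[/nbP[u uD uv] vW]; exists u, v.
Qed.

Lemma touchx_ok F env s s' : edges_ok F -> bden F env (touchx s s') = touch E (sden F env s) (sden F env s').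
Proof. by move=> EF; rewrite touch_nbl -(nbx_ok _ _ EF). Qed.

Lemma run_edges env F s : 0 \notin writes s -> edges_ok F -> edges_ok (srun env F s).
Proof. by move=> w EF u v; rewrite srun_frame. Qed.

Lemma let_edges env F a x s : a != 0 -> edges_ok F -> edges_ok (srun env F (SLet a x s)).
Proof. by move=> a0; apply: run_edges; rewrite inE eq_sym. Qed.

Lemma srun_for (P : nat -> fam -> Prop) env F i x s : P 0 F ->
  (forall k F', k < bound i -> P k F' -> P k.+1 (srun (upd env x k) F' s)) ->
  P (bound i) (srun env F (SFor i x s)).
Proof. exact: iteri_ind. Qed.

Lemma srun_for0 (P : nat -> fam -> Prop) env F x s : P 0 F ->
  (forall k F', k < N -> P k F' -> P k.+1 (srun (upd env x k) F' s)) ->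
  P N (srun env F (SFor 0 x s)).
Proof.
move=> P0 PS; suff : P (bound 0) (srun env F (SFor 0 x s)) by rewrite [X in P X _]bound0.
by apply: srun_for P0 _ => k F' kN; apply: PS; rewrite -bound0.
Qed.

Lemma srun_let env F a x s i : i < N -> srun env F (SLet a x s) a i = sden F (upd env x i) s.
Proof. by move=> iN; rewrite /= /set_fam eqxx iN. Qed.

Lemma srun_let_neq env F a x s b : b != a -> srun env F (SLet a x s) b = F b.
Proof. by move=> ba; rewrite /= /set_fam (negbTE ba). Qed.

Lemma comp_fix D v : iter N (fun W => D :&: [set v] :|: D :&: nb W) set0 = comp D v.
Proof.
set g := fun W => _; have mono : {homo g : A B / A \subset B}.
  by move=> A B sAB; apply/setUS/setIS/nbS.
have fixg : g (iter N g set0) = iter N g set0.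
  by have := fixsetK mono; rewrite /fixset card_ord.
apply/eqP; rewrite eqEsubset; apply/andP; split.
  suff H k : iter k g set0 \subset comp D v by exact: H.
  elim: k => [|k IHk]; first exact: sub0set.
  rewrite iterS /g; apply/subsetP => u; rewrite in_setU !in_setI in_set1 => /orP[/andP[uD /eqP<-]|/andP[uD]].
    exact: comp_id.
  by case/nbP => w /(subsetP IHk) wc wu; apply: comp_closed wc uD wu.
apply/subsetP => u; rewrite in_comp => /and3P[vD _]; apply: closed_connect_within.
  move=> a b aF bD ab; rewrite -fixg /g in_setU !in_setI bD; apply/orP; right.
  by apply/nbP; exists a.
by rewrite -fixg /g in_setU in_setI vD in_set1 eqxx.
Qed.

Lemma comp_progP F K d env (v : V) : K != 0 -> d != K -> edges_ok F ->
  srun env F (comp_prog K d) K v = comp (F d 0) v.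
Proof.
move=> K0 dK EF; rewrite -comp_fix; set g := fun W => _.
pose P k F' := [/\ F' K v = iter k g set0, F' d = F d & edges_ok F'].
suff [] : P N (srun env F (comp_prog K d)) by [].
change (P N (srun env (srun env F (SLet K 0 (SD (row d) (row d)))) (SFor 0 1
  (SLet K 0 (SU (SI (row d) (SSing (IV 0))) (SI (row d) (nbx (SRow K (IV 0))))))))).
apply: (srun_for0 (P := P)) => [|k F' kN [e1 e2 e3]].
  by split; [rewrite srun_let // [LHS]/= setDv | rewrite srun_let_neq | exact: let_edges].
split; [| by rewrite srun_let_neq | exact: let_edges].
rewrite srun_let // iterS -e1 /g -(nbx_ok (upd (upd env 1 k) 0 v) (SRow K (IV 0)) e3).
rewrite -e2; congr (_ :|: _); rewrite [iden _ (IV 0)]/= updE; apply/setP => u; rewrite !in_setI in_set in_set1; exact: erefl.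
Qed.

Lemma layerx_ok F env a d s : edges_ok F ->
  sden F env (layerx a d s) = grow_layer E X (F a 0) (F d 0) (sden F env s).
Proof.
move=> EF; rewrite /layerx -[LHS]/(F d 0 :&: X :&: sden F env (nbx (SU (row a) s))) nbx_ok //.
by apply/setP => v; rewrite in_grow_layer !in_setI andbA.
Qed.

Lemma grow_progP F G a d env i : G != 0 -> a != G -> d != G -> edges_ok F -> i < N ->
  srun env F (grow_prog G a d) G i = grow E X (F a 0) (F d 0) i.
Proof.
move=> G0 aG dG EF.
pose P k F' := [/\ forall i, i < k -> i < N -> F' G i = grow E X (F a 0) (F d 0) i,
  F' a = F a, F' d = F d & edges_ok F'].
suff [H _ _ _] : P N (srun env F (grow_prog G a d)) by move=> iN; apply: H.
apply: (srun_for0 (P := P)) => [|k F' kN [e1 e2 e3 e4]]; first by [].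
split; [| by rewrite srun_let_neq | by rewrite srun_let_neq | exact: let_edges].
move=> {}i ik iN; rewrite srun_let //; set env' := upd _ 0 i.
case: i ik iN @env' => [|i] ik iN env'.
  rewrite growE0; transitivity ((F' d 0 :\: X) :&: sden F' env' (nbx (row a))); first by [].
  rewrite nbx_ok // e3 [sden _ _ _]/= e2; apply/setP => v.
  by rewrite in_grow_start in_setI in_setD andbA [X in X && _]andbC.
set prev := SRow G (IP (IV 0)).
rewrite growES -e1 // 1?ltnW // grow_stepE -e3 -e2.
transitivity (sden F' env' prev :|: sden F' env' (layerx a d prev)
  :|: (F' d 0 :\: X) :&: sden F' env' (nbx (layerx a d prev))); first by [].
rewrite nbx_ok // layerx_ok //; congr (_ :|: _); apply/setP => v.
by rewrite in_setI in_setD [RHS]in_set andbA [X in X && _]andbC.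
Qed.

Lemma erase_progP F env r : env 11 = r -> r < N -> edges_ok F ->
  srun env F (erase_prog 19 20 15 11 13 7 11) 19 0 = erase_path E X (F 11 0) (F 13 0) (F 7 0) r.
Proof.
move=> er rN EF; rewrite /erase_path; set f := fun i P => _.
pose P k F' := [/\ F' 19 0 = iteri k f (F 7 0), F' 11 = F 11, F' 13 = F 13 & edges_ok F'].
suff [] : P N (srun env F (erase_prog 19 20 15 11 13 7 11)) by [].
change (P N (srun env (srun env F (SLet 19 0 (row 7))) (SFor 0 2
  (SLet 20 0 (SD (row 19) (SSing (IV 2))) ;; grow_prog 15 11 20 ;;
   SLet 19 0 (SIf (touchx (SRow 15 (IV 11)) (row 13)) (row 20) (row 19)))))).
apply: (srun_for0 (P := P)) => [|k F' kN [e1 e2 e3 e4]].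
  by split; [rewrite srun_let | rewrite srun_let_neq | rewrite srun_let_neq | exact: let_edges].
set env' := upd env 2 k; set s1 := SLet 20 0 _; set F1 := srun env' F' s1.
have E1 : edges_ok F1 by exact: let_edges.
set F2 := srun env' F1 (grow_prog 15 11 20).
have E2 : edges_ok F2 by apply: run_edges.
have fr : forall b, b \notin [:: 15; 19; 20] ->
    srun env' F' (s1 ;; grow_prog 15 11 20 ;; SLet 19 0 (SIf (touchx (SRow 15 (IV 11)) (row 13)) (row 20) (row 19))) b = F' b.
  by move=> b; rewrite !inE !negb_or => /and3P[b1 b2 b3]; rewrite srun_frame // !inE !negb_or b1 b2 b3.
split; [| by rewrite fr | by rewrite fr | by apply: run_edges].
change (srun env' F2 (SLet 19 0 (SIf (touchx (SRow 15 (IV 11)) (row 13)) (row 20) (row 19))) 19 0 = iteri k.+1 f (F 7 0)).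
rewrite srun_let // iteriS -e1 /f.
have F20 : F1 20 0 = [set v in F' 19 0 | v != k :> nat].
  by rewrite /F1 /s1 srun_let //; apply/setP => v; rewrite in_setD 2!in_set andbC.
have F2_20 : F2 20 0 = [set v in F' 19 0 | v != k :> nat] by rewrite /F2 srun_frame.
have F2_15 : F2 15 r = grow E X (F 11 0) [set v in F' 19 0 | v != k :> nat] r.
  have F11 : F1 11 = F 11 by rewrite -e2; exact: srun_let_neq.
  rewrite -F20 -F11; exact: (@grow_progP F1 15 11 20 env' r isT isT isT E1 rN).
have F2_19 : F2 19 = F' 19 by rewrite /F2 srun_frame // /F1 srun_let_neq.
have F2_13 : F2 13 = F 13 by rewrite /F2 srun_frame // /F1 srun_let_neq.
set env2 := upd env' 0 0.
transitivity (if bden F2 env2 (touchx (SRow 15 (IV 11)) (row 13)) then F2 20 0 else F2 19 0); first by [].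
rewrite touchx_ok // F2_20 F2_19 /reached -F2_15 -F2_13.
by have -> : sden F2 env2 (SRow 15 (IV 11)) = F2 15 r by rewrite /env2 /env' /= !upd_neq // er.
Qed.

End Programs.

Local Notation "a ::= s" := (SLet a 0 s) (at level 55).
Local Notation emptyx := (SD SX SX).
Local Notation fullx := (SSep 3 (BNot (BLt (IV 3) (IV 3)))).
Local Notation touches a b := (touchx (row a) (row b)).

(* Variable 0 is the row index of an assignment, 10 the stage and 11 the radius [r].
   Family 0 holds the edges, 1 the components, 2 what remains, 3 the piece [C], 4 to 9
   the fields of [sstate], 10 the best separator so far; 27 and 28 list the pieces and
   the cutters, 31 the tree and 33 the bags.  Row 0 stands for a single set, and a flag
   is raised by a nonempty set. *)
Definition step_prog : sstmt :=
  (11 ::= SIf (touches 4 7) (row 4) (SU (row 4) (row 6))) ;;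
  (12 ::= SIf (touches 4 7) (row 6) emptyx) ;;
  (13 ::= SIf (touches 5 7) (row 5) (SU (row 5) (row 12))) ;;
  (14 ::= SIf (touches 5 7) (row 12) emptyx) ;;
  grow_prog 15 11 7 ;;
  (16 ::= SSep 3 (BAnd (BLt (IC 0) (IV 3)) (BAnd (BNot (BLt (IV 11) (IV 3)))
     (BCard (IV 11) (SI (SD (SRow 15 (IV 3)) (SRow 15 (IP (IV 3)))) SX) (SI (row 3) SX))))) ;;
  (38 ::= SImg (SFirst (row 16)) 15 true) ;;
  (39 ::= SImg (SFirst (row 16)) 15 false) ;;
  (26 ::= SIf (touchx (SRow 15 (IV 11)) (row 13)) fullx emptyx) ;;
  (17 ::= SD (row 7) (row 38)) ;;
  comp_prog 1 17 ;;
  (18 ::= SImg (nbx (row 13)) 1 false) ;;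
  erase_prog 19 20 15 11 13 7 11 ;;
  (21 ::= SIf (BAnd (touches 11 7) (touches 13 7))
           (SIf (BNe (row 26)) (row 19) (SI (SI (row 18) (row 39)) SX)) (SFirst (row 7))) ;;
  (22 ::= SD (row 7) (row 21)) ;;
  comp_prog 1 22 ;;
  (23 ::= SSep 3 (BAnd (BIn (IV 3) (row 22))
     (BNot (BCard (IC 2) (SI (SRow 1 (IV 3)) SX) (SI (row 3) SX))))) ;;
  (24 ::= SIf (BNot (touches 11 7)) (row 21)
     (SIf (BAnd (touches 13 7) (BAnd (BNot (BNe (row 26))) (BNe (SI (row 23) (row 18)))))
        (SU (row 11) (SU (row 38) (row 21))) (row 11))) ;;
  (25 ::= SIf (BNot (touches 11 7)) (row 13) (SIf (BNot (touches 13 7)) (row 21)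
     (SIf (BAnd (BNot (BNe (row 26))) (BNot (BNe (SI (row 23) (row 18))))) (SU (row 13) (row 18)) (row 13)))) ;;
  (40 ::= SIf (BAnd (touches 11 7) (BAnd (touches 13 7) (BNe (row 26)))) (SU (row 21) (row 14)) (row 14)) ;;
  (41 ::= SIf (BNe (row 23)) (row 8) (SU (SD (SI (row 3) (nbx (row 7))) (row 7)) (row 21))) ;;
  (4 ::= SIf (BNe (row 9)) (row 4) (row 24)) ;;
  (5 ::= SIf (BNe (row 9)) (row 5) (row 25)) ;;
  (6 ::= SIf (BNe (row 9)) (row 6) (row 40)) ;;
  (7 ::= SIf (BNe (row 9)) (row 7) (row 23)) ;;
  (8 ::= SIf (BNe (row 9)) (row 8) (row 41)) ;;
  (9 ::= SIf (BNe (row 9)) (row 9) (SIf (BNe (row 23)) emptyx fullx)).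

Section StepProgram.
Variables (N n : nat) (inp : nat -> bool) (bound : nat -> nat) (E : rel 'I_N).
Hypothesis bound0 : bound 0 = N.
Hypothesis N_gt1 : 1 < N.
Local Notation V := 'I_N.
Local Notation X := [set v : V | v < n].
Local Notation fam := (nat -> nat -> {set V}).
Implicit Types (F : fam) (env : nat -> nat) (D W : {set V}).
Local Notation sden := (@sden N n inp).
Local Notation bden := (@bden N n inp).
Local Notation srun := (srun n inp bound).
Local Notation comp := (comp E).
Local Notation nb := (nb E).
Local Notation edges_ok := (edges_ok E).

Definition const D : nat -> {set V} := fun i => if i < N then D else set0.

Lemma const0 D : const D 0 = D.
Proof. by rewrite /const (ltnW N_gt1). Qed.

Lemma run_let1 (P : fam -> Prop) env F a s D : (forall i, sden F (upd env 0 i) s = D) ->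
  P (set_fam F a (const D)) -> P (srun env F (a ::= s)).
Proof.
move=> e; have <- // : srun env F (a ::= s) = set_fam F a (const D).
apply/funext => b; rewrite /= /set_fam /const; case: ifP => // _.
by apply/funext => i; rewrite e.
Qed.

Lemma run_let (P : fam -> Prop) env F a s rest D : (forall i, sden F (upd env 0 i) s = D) ->
  P (srun env (set_fam F a (const D)) rest) -> P (srun env F ((a ::= s) ;; rest)).
Proof. exact: (@run_let1 (fun F' => P (srun env F' rest))). Qed.

Lemma run_comp (P : fam -> Prop) env F K d rest : K != 0 -> d != K -> edges_ok F ->
  (forall W : nat -> {set V}, (forall v : V, W v = comp (F d 0) v) -> P (srun env (set_fam F K W) rest)) ->
  P (srun env F (comp_prog K d ;; rest)).
Proof.
move=> K0 dK EF /(_ (srun env F (comp_prog K d) K)) H.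
have -> : srun env F (comp_prog K d ;; rest) = srun env (srun env F (comp_prog K d)) rest by [].
have -> : srun env F (comp_prog K d) = set_fam F K (srun env F (comp_prog K d) K).
  apply/funext => b; rewrite /set_fam; case: eqP => [->//|/eqP bK].
  by rewrite srun_frame // !inE negb_or bK.
by apply: H => v; rewrite (comp_progP n inp bound0 _ _ K0 dK EF).
Qed.

Lemma run_grow (P : fam -> Prop) env F G a d rest : G != 0 -> a != G -> d != G -> edges_ok F ->
  (forall W : nat -> {set V}, (forall i, i < N -> W i = grow E X (F a 0) (F d 0) i) ->
     P (srun env (set_fam F G W) rest)) ->
  P (srun env F (grow_prog G a d ;; rest)).
Proof.
move=> G0 aG dG EF /(_ (srun env F (grow_prog G a d) G)) H.
have -> : srun env F (grow_prog G a d ;; rest) = srun env (srun env F (grow_prog G a d)) rest by [].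
have -> : srun env F (grow_prog G a d) = set_fam F G (srun env F (grow_prog G a d) G).
  apply/funext => b; rewrite /set_fam; case: eqP => [->//|/eqP bG].
  by rewrite srun_frame // inE.
by apply: H => i iN; rewrite (grow_progP n inp bound0 _ G0 aG dG EF iN).
Qed.

Lemma run_erase (P : fam -> Prop) env F r rest : env 11 = r -> r < N -> edges_ok F ->
  (forall f g h : nat -> {set V}, f 0 = erase_path E X (F 11 0) (F 13 0) (F 7 0) r ->
     P (srun env (set_fam (set_fam (set_fam F 15 h) 20 g) 19 f) rest)) ->
  P (srun env F (erase_prog 19 20 15 11 13 7 11 ;; rest)).
Proof.
move=> er rN EF H; set s := erase_prog _ _ _ _ _ _ _.
have -> : srun env F (s ;; rest) = srun env (srun env F s) rest by [].
have -> : srun env F s =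
    set_fam (set_fam (set_fam F 15 (srun env F s 15)) 20 (srun env F s 20)) 19 (srun env F s 19).
  apply/funext => b; rewrite /set_fam; case: eqP => [->//|/eqP b1]; case: eqP => [->//|/eqP b2].
  case: eqP => [->//|/eqP b3].
  by rewrite srun_frame // !inE !negb_or b1 b2 b3.
by apply: H; exact: (erase_progP n inp bound0 (ltnW N_gt1) er rN EF).
Qed.

Definition sread F : sstate N := SState (F 4 0) (F 5 0) (F 6 0) (F 7 0) (F 8 0) (F 9 0 != set0).

Lemma den_empty F env : sden F env (SD SX SX) = set0.
Proof. exact: setDv. Qed.
Lemma den_if F env b s s' :
  sden F env (SIf b s s') = if bden F env b then sden F env s else sden F env s'.
Proof. by []. Qed.
Lemma den_row F env a : sden F env (row a) = F a 0.
Proof. by []. Qed.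
Lemma den_setU F env s s' : sden F env (SU s s') = sden F env s :|: sden F env s'.
Proof. by []. Qed.
Lemma den_setI F env s s' : sden F env (SI s s') = sden F env s :&: sden F env s'.
Proof. by []. Qed.
Lemma den_setD F env s s' : sden F env (SD s s') = sden F env s :\: sden F env s'.
Proof. by []. Qed.
Lemma den_X F env : sden F env SX = X.
Proof. by []. Qed.
Lemma den_first F env s : sden F env (SFirst s) = first (sden F env s).
Proof. by []. Qed.
Lemma den_and F env b b' : bden F env (BAnd b b') = bden F env b && bden F env b'.
Proof. by []. Qed.
Lemma den_not F env b : bden F env (BNot b) = ~~ bden F env b.
Proof. by []. Qed.
Lemma den_ne F env s : bden F env (BNe s) = (sden F env s != set0).
Proof. by []. Qed.
Lemma den_lt F env i j : bden F env (BLt i j) = (iden env i < iden env j).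
Proof. by []. Qed.
Lemma den_card F env i s s' :
  bden F env (BCard i s s') = (minn (iden env i) N * #|sden F env s| <= #|sden F env s'|).
Proof. by []. Qed.
Lemma den_srow F env a i : sden F env (SRow a i) = F a (iden env i).
Proof. by []. Qed.
Lemma in_sep F env x b (v : V) : (v \in sden F env (SSep x b)) = bden F (upd env x v) b.
Proof. by rewrite in_set. Qed.
Lemma in_img F env s a k (v : V) : (v \in sden F env (SImg s a k)) =
  [exists u in sden F env s, v \in F a (if k then u.-1 else u)].
Proof. by rewrite in_set. Qed.
Lemma den_in F env s i : bden F env (BIn i s) = [exists v in sden F env s, v == iden env i :> nat].
Proof. by []. Qed.
Lemma bden_in F env s i (v : V) : iden env i = v -> bden F env (BIn i s) = (v \in sden F env s).
Proof.
rewrite den_in => ->; apply/existsP/idP => [[u /andP[us /eqP/val_inj <-//]]|vs].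
by exists v; rewrite vs /=.
Qed.
Definition denE := (den_empty, den_if, den_row, den_setU, den_setI, den_setD, den_X, den_first,
  den_and, den_not, den_ne, den_lt, den_card, den_srow).

Lemma den_full F env : sden F env (SSep 3 (BNot (BLt (IV 3) (IV 3)))) = setT.
Proof. by apply/setP => v; rewrite in_sep denE in_set [bden _ _ _]/= ltnn. Qed.

Lemma setT_neq0 : [set: V] != set0.
Proof. by apply/set0Pn; exists (Ordinal (ltnW N_gt1)). Qed.

Lemma den_nbx F env s : edges_ok F -> sden F env (SImg s 0 false) = nb (sden F env s).
Proof. exact: nbx_ok. Qed.

Lemma den_touch F env s s' : edges_ok F ->
  bden F env (touchx s s') = touch E (sden F env s) (sden F env s').
Proof. exact: touchx_ok. Qed.

Lemma step_progP F env r : env 11 = r -> r < N -> edges_ok F ->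
  sread (srun env F step_prog) = step E X (F 3 0) r (sread F).
Proof.
move=> er rN EF; rewrite /step_prog.
pose A := merge_first E (F 4 0) (F 6 0) (F 7 0).
pose L' := keep_leaves E (F 4 0) (F 6 0) (F 7 0).
pose B := merge_first E (F 5 0) L' (F 7 0).
pose L := keep_leaves E (F 5 0) L' (F 7 0).
set res := step _ _ _ _ _.
pose P F' := sread F' = res.
apply: (run_let (P := P) (D := A)).
  by move=> i; rewrite denE den_touch // !denE.
apply: (run_let (P := P) (D := L')).
  move=> i; rewrite denE den_touch // !denE.
  by rewrite /set_fam /=.
apply: (run_let (P := P) (D := B)).
  move=> i; rewrite denE den_touch // !denE.
  by rewrite /set_fam /= const0.
apply: (run_let (P := P) (D := L)).
  move=> i; rewrite denE den_touch // !denE.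
  by rewrite /set_fam /= const0.
apply: (run_grow (P := P)) => // G eG.
rewrite /set_fam /= !const0 in eG.
have Gr : G r = grow E X A (F 7 0) r by exact: eG.
pose LB := layers_before E X (F 3 0) r A (F 7 0); pose LU := layers_upto E X (F 3 0) r A (F 7 0).
apply: (run_let (P := P) (D := good_layers E X (F 3 0) r A (F 7 0))).
  move=> i; apply/setP => j; rewrite in_sep [RHS]in_set !denE.
  rewrite /set_fam /upd /= er (minn_idPl (ltnW rN)) -leqNgt eG ?eG //.
  exact: leq_ltn_trans (leq_pred _) _.
apply: (run_let (P := P) (D := LB)).
  move=> i; apply/setP => v; rewrite in_img [RHS]in_set !denE.
  apply: eq_existsb => j; rewrite /set_fam /= const0 eG //.
  exact: leq_ltn_trans (leq_pred _) _.
apply: (run_let (P := P) (D := LU)).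
  move=> i; apply/setP => v; rewrite in_img [RHS]in_set !denE.
  by apply: eq_existsb => j; rewrite /set_fam /= const0 eG.
pose rch := reached E X A B (F 7 0) r.
apply: (run_let (P := P) (D := if rch then setT else set0)).
  move=> i; rewrite denE den_touch // !denE den_full.
  by rewrite /set_fam /upd /= er const0 Gr.
pose b := F 7 0; pose CB := cut_before E X (F 3 0) r A b.
apply: (run_let (P := P) (D := CB)).
  by move=> i; rewrite !denE /set_fam /= const0.
apply: (run_comp (P := P)) => // K eK; rewrite /set_fam /= const0 in eK.
pose FAR := far_side E X (F 3 0) r A B b.
apply: (run_let (P := P) (D := FAR)).
  move=> i; apply/setP => u; rewrite in_img [RHS]in_set den_nbx // !denE.
  by apply: eq_existsb => c; rewrite /set_fam /= const0 eK.
apply: (run_erase (P := P) er rN) => // f g h ef.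
rewrite /set_fam /= !const0 in ef.
pose RM := removed E X (F 3 0) r A B b.
apply: (run_let (P := P) (D := RM)).
  move=> i; rewrite denE den_and !den_touch // !denE.
  rewrite /set_fam /= !const0 ef /RM /removed -/rch -/FAR -/LU.
  by case: rch; rewrite ?setT_neq0 ?eqxx.
apply: (run_let (P := P) (D := b :\: RM)).
  by move=> i; rewrite !denE /set_fam /= const0.
apply: (run_comp (P := P)) => // K2 eK2; rewrite /set_fam /= const0 in eK2.
pose NB := next_b E X (F 3 0) r A B b.
apply: (run_let (P := P) (D := NB)).
  move=> i; apply/setP => v; rewrite in_sep [RHS]in_heavy den_and (@bden_in _ _ _ _ v) // !denE.
  by rewrite /set_fam /upd /= const0 eK2 (minn_idPl N_gt1) -ltnNge.
apply: (run_let (P := P) (D := next_A E X (F 3 0) r A B b)).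
  move=> i; rewrite !(den_if, den_and, den_not) !den_touch // !denE.
  rewrite /set_fam /= !const0 /next_A -/rch -/FAR -/LB -/RM -/NB -/b.
  by case: rch; rewrite ?setT_neq0 ?eqxx.
apply: (run_let (P := P) (D := next_B E X (F 3 0) r A B b)).
  move=> i; rewrite !(den_if, den_and, den_not) !den_touch // !denE.
  rewrite /set_fam /= !const0 /next_B -/rch -/FAR -/LB -/RM -/NB -/b.
  by case: rch; rewrite ?setT_neq0 ?eqxx ?negbK.
apply: (run_let (P := P) (D := next_L E X (F 3 0) r A B L b)).
  move=> i; rewrite !(den_if, den_and, den_not) !den_touch // !denE.
  rewrite /set_fam /= !const0 /next_L -/rch -/RM -/b.
  by case: rch; rewrite ?setT_neq0 ?eqxx.
apply: (run_let (P := P) (D := next_S E X (F 3 0) r A B b (F 8 0))).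
  move=> i; rewrite !denE den_nbx // !denE.
  by rewrite /set_fam /= !const0 /next_S -/NB -/RM -/b if_neg.
pose keep (W W' : {set V}) := if F 9 0 != set0 then W else W'.
apply: (run_let (P := P) (D := keep (F 4 0) (next_A E X (F 3 0) r A B b))).
  by move=> i; rewrite !denE /set_fam /= !const0.
apply: (run_let (P := P) (D := keep (F 5 0) (next_B E X (F 3 0) r A B b))).
  by move=> i; rewrite !denE /set_fam /= !const0.
apply: (run_let (P := P) (D := keep (F 6 0) (next_L E X (F 3 0) r A B L b))).
  by move=> i; rewrite !denE /set_fam /= !const0.
apply: (run_let (P := P) (D := keep (F 7 0) NB)).
  by move=> i; rewrite !denE /set_fam /= !const0.
apply: (run_let (P := P) (D := keep (F 8 0) (next_S E X (F 3 0) r A B b (F 8 0)))).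
  by move=> i; rewrite !denE /set_fam /= !const0.
apply: (run_let1 (P := P) (D := keep (F 9 0) (if NB == set0 then setT else set0))).
  move=> i; rewrite !denE den_full /set_fam /= !const0 /keep; case: ifP => // _.
  by case: (NB == set0).
rewrite /P /sread /set_fam /= !const0 /res /step /= -/A -/L' -/B -/L /keep.
case: ifP => [D|/negbT D]; first by [].
by congr SState; rewrite -/NB; case: ifP; rewrite ?setT_neq0 ?eqxx.
Qed.

End StepProgram.

Local Notation eqx i j := (BAnd (BNot (BLt i j)) (BNot (BLt j i))).
Local Notation orx b b' := (BNot (BAnd (BNot b) (BNot b'))).

Definition restart_prog : sstmt :=
  (4 ::= emptyx) ;; (5 ::= emptyx) ;; (6 ::= emptyx) ;; (7 ::= row 3) ;; (8 ::= row 3) ;; (9 ::= emptyx).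

Definition separator_prog : sstmt :=
  (10 ::= SIf (BNe (SI (row 3) SX)) (SI (row 3) SX) (row 3)) ;;
  SFor 0 11 (restart_prog ;; SFor 0 12 step_prog ;;
    (10 ::= SIf (BAnd (BLt (IC 0) (IV 11)) (BAnd (BNe (SI (row 3) SX))
       (BAnd (BNe (row 9)) (BNot (BCard (IC 1) (row 10) (row 8)))))) (row 8) (row 10))).

Definition dissect_prog : sstmt :=
  (2 ::= fullx) ;;
  SFor 0 10 (comp_prog 1 2 ;; (3 ::= SImg (SFirst (row 2)) 1 false) ;; separator_prog ;;
    (27 ::= SIf (eqx (IV 0) (IV 10)) (row 3) (SRow 27 (IV 0))) ;;
    (28 ::= SIf (eqx (IV 0) (IV 10)) (row 10) (SRow 28 (IV 0))) ;;
    (2 ::= SD (row 2) (row 10))).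

Definition bags_prog : sstmt :=
  (29 ::= SSep 3 (orx (eqx (IV 3) (IV 0))
     (BAnd (BLt (IV 3) (IV 0)) (BNe (SI (SRow 28 (IV 0)) (SRow 27 (IV 3))))))) ;;
  (30 ::= SSep 3 (BAnd (BLt (IV 3) (IV 0)) (orx
     (BAnd (BIn (IV 3) (SRow 29 (IV 0))) (BNot (BNe (SSep 4
        (BAnd (BAnd (BLt (IV 3) (IV 4)) (BLt (IV 4) (IV 0))) (BIn (IV 4) (SRow 29 (IV 0))))))))
     (BAnd (BNot (BLt (IC 0) (IV 3))) (BNot (BNe (SSep 4
        (BAnd (BLt (IV 4) (IV 0)) (BIn (IV 4) (SRow 29 (IV 0)))))))))))  ;;
  (31 ::= SSep 3 (orx (BIn (IV 3) (SRow 30 (IV 0))) (BIn (IV 0) (SRow 30 (IV 3))))) ;;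
  (32 ::= SU (SRow 28 (IV 0)) (nbx (SD (SRow 28 (IV 0)) SX))) ;;
  (33 ::= SImg (SRow 29 (IV 0)) 32 false).

Section DissectProgram.
Variables (N n : nat) (inp : nat -> bool) (bound : nat -> nat) (E : rel 'I_N).
Hypothesis bound0 : bound 0 = N.
Hypothesis N_gt1 : 1 < N.
Local Notation V := 'I_N.
Local Notation X := [set v : V | v < n].
Local Notation fam := (nat -> nat -> {set V}).
Implicit Types (F : fam) (env : nat -> nat) (D W : {set V}).
Local Notation sden := (@sden N n inp).
Local Notation bden := (@bden N n inp).
Local Notation srun := (srun n inp bound).
Local Notation comp := (comp E).
Local Notation nb := (nb E).
Local Notation edges_ok := (edges_ok E).
Local Notation const0 := (const0 N_gt1).

Lemma steps_progP F env r : env 11 = r -> r < N -> edges_ok F ->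
  sread (srun env F (SFor 0 12 step_prog)) = iter N (step E X (F 3 0) r) (sread F).
Proof.
move=> er rN EF.
pose P k F' := [/\ sread F' = iter k (step E X (F 3 0) r) (sread F), F' 3 = F 3 & edges_ok F'].
suff [] : P N (srun env F (SFor 0 12 step_prog)) by [].
apply: (srun_for0 bound0 (P := P)) => [|k F' kN [e1 e2 e3]]; first by [].
split; [| by rewrite srun_frame | by move=> u v; rewrite srun_frame].
have er' : upd env 12 k 11 = r by rewrite upd_neq.
by rewrite (step_progP n inp bound0 N_gt1 er' rN e3) e1 e2.
Qed.

Lemma restart_progP F env : sread (srun env F restart_prog) = start (F 3 0).
Proof.
set res := start _; pose P F' := sread F' = res.
do 3 (apply: (run_let (P := P) (D := set0)); first by move=> i; rewrite den_empty).
do 2 (apply: (run_let (P := P) (D := F 3 0)); first by []).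
apply: (@run_let1 _ _ _ bound P _ _ _ _ set0); first by move=> i; rewrite den_empty.
by rewrite /P /sread /set_fam /= !const0 eqxx.
Qed.

Lemma separator_progP F env : edges_ok F -> srun env F separator_prog 10 0 = separator E X (F 3 0).
Proof.
move=> EF; set C := F 3 0; rewrite /separator; set init := if _ then _ else _; set f := fun r S => _.
have card_ne D : (0 < #|D|) = (D != set0) by rewrite card_gt0.
apply: (run_let (P := fun F' => F' 10 0 = _) (D := init)).
  by move=> i; rewrite !denE /init card_ne.
set F0 := set_fam F 10 (const init).
pose P r F' := [/\ F' 10 0 = iteri r f init, F' 3 0 = C & edges_ok F'].
suff [] : P N (srun env F0 (SFor 0 11 (restart_prog ;; SFor 0 12 step_prog ;;
    (10 ::= SIf (BAnd (BLt (IC 0) (IV 11)) (BAnd (BNe (SI (row 3) SX))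
       (BAnd (BNe (row 9)) (BNot (BCard (IC 1) (row 10) (row 8)))))) (row 8) (row 10))))) by [].
apply: (srun_for0 bound0 (P := P)) => [|r F' rN [e1 e2 e3]].
  by split; rewrite ?/F0 /set_fam //= const0.
set env' := upd env 11 r; set s3 := SLet 10 0 _.
split; [| by rewrite srun_frame | by move=> u v; rewrite srun_frame].
set F1 := srun env' F' restart_prog.
have E1 : edges_ok F1 by move=> u v; rewrite /F1 srun_frame.
set F2 := srun env' F1 (SFor 0 12 step_prog).
have er' : env' 11 = r by exact: updE.
have F13 : F1 3 = F' 3 by exact: srun_frame.
have S1 : sread F1 = start C by rewrite /F1 restart_progP e2.
have S2 : sread F2 = run_steps E X C r N by rewrite /F2 (steps_progP er' rN E1) S1 F13 e2.
have e10 : F2 10 0 = iteri r f init by rewrite -e1; transitivity (F1 10 0); congr (_ 0); exact: srun_frame.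
have e23 : F2 3 0 = C by rewrite -e2 -F13; congr (_ 0); exact: srun_frame.
have -> : srun env' F' (restart_prog ;; SFor 0 12 step_prog ;; s3) 10 0 = srun env' F2 s3 10 0 by [].
rewrite srun_let ?(ltnW N_gt1) // !denE iteriS {1}/f -S2 e10 e23 /env' /upd /= card_ne.
by rewrite (minn_idPl (ltnW N_gt1)) mul1n -ltnNge.
Qed.

Lemma dissect_progP F env i : edges_ok F -> i < N ->
  srun env F dissect_prog 27 i = piece E n i /\ srun env F dissect_prog 28 i = cutter E n i.
Proof.
move=> EF iN; rewrite /dissect_prog.
pose Q F' := F' 27 i = piece E n i /\ F' 28 i = cutter E n i.
apply: (run_let (P := Q) (D := setT)); first by move=> j; rewrite den_full.
set F0 := set_fam F 2 _.
pose P t F' := [/\ F' 2 0 = remaining E n t, forall i, i < t -> i < N -> F' 27 i = piece E n i,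
  forall i, i < t -> i < N -> F' 28 i = cutter E n i & edges_ok F'].
set body := comp_prog 1 2 ;; _.
suff [_ h1 h2 _] : P N (srun env F0 (SFor 0 10 body)) by split; [apply: h1|apply: h2].
apply: (srun_for0 bound0 (P := P)) => [|t F' tN [e1 e2 e3 e4]].
  by split; rewrite // /F0 /set_fam /= const0.
pose R F'' := [/\ F'' 2 0 = remaining E n t.+1, forall i, i < t.+1 -> i < N -> F'' 27 i = piece E n i
  & forall i, i < t.+1 -> i < N -> F'' 28 i = cutter E n i].
suff [h1 h2 h3] : R (srun (upd env 10 t) F' body).
  by split=> // u v; rewrite srun_frame.
rewrite /body; apply: (run_comp bound0 (P := R)) => // K eK.
apply: (run_let (P := R) (D := piece E n t)).
  move=> j; apply/setP => v; rewrite in_img [RHS]in_set !denE /set_fam /= e1.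
  by apply: eq_existsb => u; rewrite eK e1.
set env' := upd env 10 t; set F1 := set_fam _ _ _.
have E1 : edges_ok F1 by exact: e4.
have -> s : srun env' F1 (separator_prog ;; s) = srun env' (srun env' F1 separator_prog) s by [].
have F13 : F1 3 0 = piece E n t by rewrite /F1 /set_fam /= const0.
have S2 : srun env' F1 separator_prog 10 0 = cutter E n t.
  by rewrite (separator_progP env' E1) F13 -cutterE.
set F2 := srun env' F1 separator_prog in S2 *.
have fr b : b \notin writes separator_prog -> F2 b = F1 b by exact: srun_frame.
have f3 : F2 3 0 = piece E n t by rewrite fr.
have f2 : F2 2 0 = remaining E n t by rewrite fr.
have f27 : F2 27 = F' 27 by rewrite fr.
have f28 : F2 28 = F' 28 by rewrite fr.
have eqtest j (T : Type) (x y : T) : (if ~~ (j < t) && ~~ (t < j) then x else y) = if j == t then x else y.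
  by rewrite -!leqNgt eqn_leq andbC.
have rows a c j (H : fam) : j < N ->
    srun env' H (SLet a 0 (SIf (eqx (IV 0) (IV 10)) (row c) (SRow a (IV 0)))) a j = if j == t then H c 0 else H a j.
  by move=> jN; rewrite srun_let // !denE /upd /= -[in RHS](eqtest j).
set s27 := SLet 27 0 _; set s28 := SLet 28 0 _; set s2 := SLet 2 0 _.
set F3 := srun env' F2 s27; set F4 := srun env' F3 s28.
change (R (srun env' F4 s2)).
have F4_ b : b != 27 -> b != 28 -> F4 b = F2 b.
  by move=> b1 b2; rewrite /F4 /s28 srun_let_neq // /F3 /s27 srun_let_neq.
split=> [|j jt jN|j jt jN].
- by rewrite /s2 srun_let ?(ltnW N_gt1) // !denE !F4_ // f2 S2.
- transitivity (F3 27 j).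
    by transitivity (F4 27 j); congr (_ j); exact: srun_let_neq.
  rewrite /F3 /s27 (rows _ _ _ _ jN) f3 f27.
  by case: eqP jt => [->//|/eqP jt]; rewrite ltnS leq_eqVlt (negbTE jt) => /e2->.
have F3_10 : F3 10 = F2 10 by exact: srun_let_neq.
have F3_28 : F3 28 = F2 28 by exact: srun_let_neq.
transitivity (F4 28 j); first by congr (_ j); exact: srun_let_neq.
rewrite /F4 /s28 (rows _ _ _ _ jN) F3_10 F3_28 S2 f28.
case: eqP jt => [-> _|/eqP jt]; cbv iota; first by [].
rewrite ltnS leq_eqVlt (negbTE jt) => jlt.
exact: e3 jlt jN.
Qed.

Lemma run_rows (P : fam -> Prop) env F a s rest :
  (forall W : nat -> {set V}, (forall v : V, W v = sden F (upd env 0 v) s) ->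
     P (srun env (set_fam F a W) rest)) -> P (srun env F ((a ::= s) ;; rest)).
Proof.
move=> H; apply: (H (fun i => if i < N then sden F (upd env 0 i) s else set0)) => v.
by rewrite ltn_ord.
Qed.

Lemma den_or F env b b' : bden F env (orx b b') = bden F env b || bden F env b'.
Proof. by rewrite den_not den_and !den_not negb_and !negbK. Qed.

Lemma den_eq F env i j : bden F env (eqx i j) = (iden env i == iden env j).
Proof. by rewrite den_and !den_not !den_lt -!leqNgt eqn_leq andbC. Qed.

Lemma den_none F env x b :
  bden F env (BNot (BNe (SSep x b))) = [forall v : V, ~~ bden F (upd env x v) b].
Proof.
rewrite den_not den_ne negbK; apply/eqP/forallP => [e v|H].
  by rewrite -in_sep e in_set0.
by apply/setP => v; rewrite in_sep in_set0 (negbTE (H v)).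
Qed.

Lemma bags_progP (n_leN : n <= N) (piece cutter : nat -> {set V}) F env (t : V) : edges_ok F ->
  (forall i, i < N -> F 27 i = piece i) -> (forall i, i < N -> F 28 i = cutter i) ->
  (forall s : V, (s \in srun env F bags_prog 31 t) = tree_adj piece cutter s t) /\
  (forall x : 'I_n, (widen_ord n_leN x \in srun env F bags_prog 33 t) = (x \in bag E n_leN piece cutter t)).
Proof.
move=> EF e27 e28; rewrite /bags_prog.
pose P F' := (forall s : V, (s \in F' 31 t) = tree_adj piece cutter s t) /\
  (forall x : 'I_n, (widen_ord n_leN x \in F' 33 t) = (x \in bag E n_leN piece cutter t)).
apply: (run_rows (P := P)) => ANC eANC.
have {}eANC (s u : V) : (s \in ANC u) = anc piece cutter s u.
  by rewrite eANC in_sep den_or den_eq !denE /upd /= e27 // e28.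
apply: (run_rows (P := P)) => PAR ePAR.
have {}ePAR (s u : V) : (s \in PAR u) = parent piece cutter s u.
  rewrite ePAR in_sep den_and den_or !den_and !den_none den_not (@bden_in _ _ _ _ _ _ _ s) //.
  rewrite /parent eqn0Ngt -eANC; congr (_ && (_ && _ || _ && _)).
    apply: eq_forallb => v; rewrite den_and den_and (@bden_in _ _ _ _ _ _ _ v) //.
    by rewrite -eANC negb_and implybE.
  apply: eq_forallb => v; rewrite den_and (@bden_in _ _ _ _ _ _ _ v) //.
  by rewrite -eANC negb_and implybE.
apply: (run_rows (P := P)) => TREE eTREE.
apply: (run_rows (P := P)) => OWN eOWN.
have {}eOWN (u : V) (x : 'I_n) : (widen_ord n_leN x \in OWN u) = (x \in own E n_leN cutter u).
  have -> : OWN u = cutter u :|: nb (cutter u :\: X).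
    by rewrite eOWN den_setU (den_nbx _ _ (E := E)) // !denE /upd /set_fam /= e28.
  rewrite in_setU; apply/orP/ownP => [[xu|/nbP[w]]|[w wu [<-|[nw wx]]]].
  - by exists (widen_ord n_leN x) => //; left.
  - by rewrite in_setD in_set -leqNgt => /andP[nw wu] wx; exists w => //; right.
  - by left.
  by right; apply/nbP; exists w => //; rewrite in_setD in_set -leqNgt nw.
pose F0 := set_fam (set_fam (set_fam (set_fam F 29 ANC) 30 PAR) 31 TREE) 32 OWN.
change (P (srun env F0 (33 ::= SImg (SRow 29 (IV 0)) 32 false))).
split=> [s|x].
  rewrite srun_let_neq // /F0 /set_fam /= eTREE in_sep den_or.
  by rewrite (@bden_in _ _ _ _ _ _ _ s) // (@bden_in _ _ _ _ _ _ _ t) // !denE /upd /set_fam /= !ePAR.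
rewrite srun_let // in_img [RHS]in_set !denE; apply: eq_existsb => s.
by rewrite /F0 /upd /set_fam /= eANC eOWN.
Qed.

End DissectProgram.

(** * Selecting lakes *)

(* A lake enters the auxiliary graph only if it joins a pair of nations not yet joined. *)
Definition select_step : sstmt :=
  (34 ::= SInp (IV 13)) ;;
  (37 ::= SSep 3 (BAnd (BIn (IV 3) (row 34)) (BNe (SD (SD (row 34) (SSing (IV 3))) (SRow 36 (IV 3)))))) ;;
  (42 ::= SFirst (SD (SD fullx SX) (row 35))) ;;
  (0 ::= SIf (BNe (row 37))
     (SU (SRow 0 (IV 0)) (SU (SIf (BIn (IV 0) (row 34)) (row 42) emptyx)
        (SIf (BIn (IV 0) (row 42)) (row 34) emptyx))) (SRow 0 (IV 0))) ;;
  (36 ::= SIf (BAnd (BNe (row 37)) (BIn (IV 0) (row 34)))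
     (SU (SRow 36 (IV 0)) (SD (row 34) (SSing (IV 0)))) (SRow 36 (IV 0))) ;;
  (35 ::= SIf (BNe (row 37)) (SU (row 35) (row 42)) (row 35)).

Section Selection.
Variables (N n : nat) (inp : nat -> bool) (bound : nat -> nat).
Hypothesis N_gt1 : 1 < N.
Hypothesis N_big : n * n + n < N.
Local Notation V := 'I_N.
Local Notation X := [set v : V | v < n].
Local Notation fam := (nat -> nat -> {set V}).
Implicit Types (F : fam) (env : nat -> nat) (l : seq nat).
Local Notation sden := (@sden N n inp).
Local Notation srun := (srun n inp bound).
Local Notation const0 := (const0 N_gt1).

Definition shore (y : nat) : {set V} := [set v : V | (v < n) && inp (2 + n * n + y * n + v)].
Definition joins l (u v : V) := [&& n <= v, v < n + size l & u \in shore (nth 0 l (v - n))].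
Definition selected l : rel V := [rel u v | joins l u v || joins l v u].
Definition covered l (u v : V) := (u != v) && has (fun y => (u \in shore y) && (v \in shore y)) l.

Lemma shore_lt y (v : V) : v \in shore y -> v < n.
Proof. by rewrite in_set => /andP[]. Qed.

Definition selection_inv k F l : Prop :=
  [/\ uniq l, all (fun y => y < k) l, forall v : V, (v \in F 35 0) = (n <= v < n + size l),
      edges_ok (selected l) F
    & [/\ forall u v : V, (v \in F 36 u) = covered l u v,
      forall y (u v : V), y < k -> u != v -> u \in shore y -> v \in shore y -> covered l u v
    & size l <= \sum_(u : V) #|[set v | covered l u v]|]].

Lemma size_selection k F l : selection_inv k F l -> size l <= n * n.
Proof.
case=> _ _ _ _ [_ _ le]; apply: leq_trans le _.
have sX y (u : V) : u \in shore y -> u \in X by rewrite [u \in X]in_set; apply: shore_lt.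
apply: leq_trans (_ : \sum_(u in X) #|X| <= _); last first.
  by have Xn : #|X| <= n; [apply: card_initial; lia | rewrite sum_nat_const leq_mul].
rewrite [leqRHS]big_mkcond; apply: leq_sum => u _; have [uX|uX] := boolP (u \in X).
  apply/subset_leq_card/subsetP => v; rewrite in_set => /andP[_ /hasP[y _ /andP[_]]]; exact: sX.
rewrite leqn0 cards_eq0; apply/eqP/setP => v; rewrite in_set0 in_set.
by apply/negP => /andP[_ /hasP[y _ /andP[/sX]]]; rewrite (negbTE uX).
Qed.

Lemma free_slot F l env : size l <= n * n -> (forall v : V, (v \in F 35 0) = (n <= v < n + size l)) ->
  exists2 w : V, w = n + size l :> nat & sden F env (SFirst (SD (SD fullx SX) (row 35))) = [set w].
Proof.
move=> sz e35; have wN : n + size l < N by lia.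
exists (Ordinal wN) => //; apply/setP => v.
have inD (u : V) : (u \in sden F env (SD (SD fullx SX) (row 35))) = (n + size l <= u).
  by rewrite !denE den_full !in_setD in_set in_setT e35 andbT -leqNgt; lia.
rewrite den_first in_first inD in_set1; apply/andP/eqP => [[le /forall_inP/(_ (Ordinal wN))]|->].
  by rewrite inD leqnn => /(_ isT) ge; apply: val_inj; apply/eqP; rewrite eqn_leq le ge.
by split; rewrite /= ?leqnn //; apply/forall_inP => u; rewrite inD.
Qed.

Lemma select_stepP k F l env : env 13 = k -> selection_inv k F l ->
  exists l', selection_inv k.+1 (srun env F select_step) l'.
Proof.
move=> ek inv; have sz := size_selection inv.
case: inv => ul al e35 e0 [e36 cov le].
have [w ew ew'] := free_slot (upd env 0 0) sz e35.
pose P F' := exists l', selection_inv k.+1 F' l'.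
set NEW := [set u in shore k | shore k :\: [set u] :\: F 36 u != set0].
apply: (run_let (P := P) (D := shore k)).
  by move=> i; rewrite [LHS]/= /upd /= ek.
apply: (run_let (P := P) (D := NEW)).
  move=> i; apply/setP => u; rewrite in_sep [RHS]in_set den_and (@bden_in _ _ _ _ _ _ _ u) // !denE.
  rewrite /set_fam /upd /= const0.
  by have -> : [set v : V | v == u :> nat] = [set u] by apply/setP => v; rewrite in_set in_set1.
apply: (run_let (P := P) (D := [set w])); first by move=> i; rewrite -ew'.
apply: (run_rows (P := P)) => G0 eG0; apply: (run_rows (P := P)) => G36 eG36.
have {}eG0 (u : V) : G0 u = if NEW != set0 then
    F 0 u :|: ((if u \in shore k then [set w] else set0) :|: (if u \in [set w] then shore k else set0)) else F 0 u.
  rewrite eG0 !(den_if, den_setU) !(@bden_in _ _ _ _ _ _ _ u) // !denE.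
  by rewrite /set_fam /upd /= !const0.
have {}eG36 (u : V) : G36 u = if (NEW != set0) && (u \in shore k) then F 36 u :|: shore k :\ u else F 36 u.
  rewrite eG36 den_if den_and (@bden_in _ _ _ _ _ _ _ u) // !denE.
  rewrite /set_fam /upd /= !const0.
  by have -> : [set v : V | v == u :> nat] = [set u] by apply/setP => v; rewrite in_set in_set1.
apply: (@run_let1 _ _ _ bound P _ _ _ _ (if NEW != set0 then F 35 0 :|: [set w] else F 35 0)).
  by move=> i; rewrite !denE /set_fam /= !const0.
have sh_n (y : nat) (u : V) : u \in shore y -> u < n := @shore_lt y u.
have joins_w l' (u : V) : w < n -> joins l' u w = false by rewrite ew; lia.
case: eqP => [N0|/eqP Nn0] in eG0 eG36 *; rewrite /= in eG0 eG36.
  exists l; split.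
  - by [].
  - by apply: sub_all al => y /= /ltnW.
  - by move=> v; rewrite /set_fam /= const0 e35.
  - by move=> u v; rewrite /set_fam /= eG0 e0.
  split=> [u v|y u v|//]; first by rewrite /set_fam /= eG36.
  rewrite ltnS leq_eqVlt => /predU1P[->|]; last exact: cov.
  move=> uv uk vk; rewrite -e36; apply: contraT => nF.
  have : u \in NEW by rewrite in_set uk; apply/set0Pn; exists v; rewrite !in_setD in_set1 nF eq_sym uv vk.
  by rewrite N0 in_set0.
have kl : k \notin l by apply/negP => /(allP al); rewrite ltnn.
have covr u v : covered (rcons l k) u v = covered l u v || [&& u != v, u \in shore k & v \in shore k].
  by rewrite /covered has_rcons orbC -andb_orr.
exists (rcons l k); split.
- by rewrite rcons_uniq kl.
- by rewrite all_rcons leqnn /=; apply: sub_all al => y /= /ltnW.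
- move=> v; rewrite /set_fam /= const0 in_setU in_set1 e35 size_rcons -(inj_eq val_inj) /= ew.
  by move: (size l) => sl; lia.
- have jr (u v : V) : joins (rcons l k) u v = joins l u v || (v == w) && (u \in shore k).
    rewrite /joins size_rcons nth_rcons -(inj_eq val_inj) /= ew.
    have [nv|//] := leqP n v; last by case: eqP => // e; lia.
    have -> : (v - n < size l) = (v < n + size l) by lia.
    have -> : (v - n == size l) = (v == n + size l :> nat) by lia.
    have -> : (v < n + (size l).+1) = (v < n + size l) || (v == n + size l :> nat) by lia.
    by case: ltnP => [lt|ge]; case: eqP => //= [e|_]; rewrite ?orbF //; lia.
  move=> u v; rewrite /set_fam /= eG0 !in_setU e0 /selected /= !jr in_set1.
  rewrite -!orbA; congr (_ || _); rewrite [RHS]orbCA; congr (_ || (_ || _)).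
    by case: (u \in shore k); rewrite ?in_set1 ?in_set0 ?andbT ?andbF.
  by case: (u == w); rewrite ?in_set0.
split=> [u v|y u v|].
- rewrite /set_fam /= eG36 covr; case: (u \in shore k); last by rewrite andbF orbF e36.
  by rewrite in_setU e36 in_setD in_set1 eq_sym.
- rewrite ltnS leq_eqVlt covr => /predU1P[->|yk uv uy vy]; last by rewrite (cov y).
  by move=> -> -> ->; rewrite orbT.
rewrite size_rcons; apply: leq_trans (_ : (\sum_(u : V) #|[set v | covered l u v]|).+1 <= _).
  by rewrite ltnS.
have [u] := set0Pn _ Nn0; rewrite in_set => /andP[uk /set0Pn[v]]; rewrite !in_setD in_set1 => /and3P[nF vu vk].
rewrite (bigD1 u) //= [ltnRHS](bigD1 u) //= -addSn leq_add //; last first.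
  apply: leq_sum => u' _; apply/subset_leq_card/subsetP => v'; rewrite !in_set covr => ->; exact: orTb.
apply: proper_card; apply/properP; split.
  by apply/subsetP => v'; rewrite !in_set covr => ->.
by exists v; rewrite in_set ?covr -?e36 // uk vk eq_sym vu orbT.
Qed.

Lemma select_progP F env m : bound 2 = m -> (forall a i, F a i = set0) ->
  exists2 l, selection_inv m (srun env F (SFor 2 13 select_step)) l & size l <= n * n.
Proof.
move=> bm F0; suff [l inv] : exists l, selection_inv m (srun env F (SFor 2 13 select_step)) l.
  by exists l => //; apply: size_selection inv.
rewrite -bm; apply: (srun_for (P := fun k F' => exists l, selection_inv k F' l)).
  exists [::]; split=> //.
  - by move=> v; rewrite F0 in_set0 addn0; lia.
  - by move=> u v; rewrite F0 in_set0 /selected /= /joins /= addn0; lia.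
  by split=> // u v; rewrite F0 in_set0 /covered andbF.
by move=> k F' km [l inv]; apply: select_stepP inv; rewrite updE.
Qed.

End Selection.

(** * Input and output *)

Lemma nth_allpairs (S T U : Type) (f : S -> T -> U) (s : seq S) (t : seq T) x0 y0 z0 i j :
  i < size s -> j < size t ->
  nth z0 [seq f x y | x <- s, y <- t] (i * size t + j) = f (nth x0 s i) (nth y0 t j).
Proof.
elim: s i => // x s IHs [|i] /= si sj; rewrite nth_cat size_map; first by rewrite sj (nth_map y0).
by rewrite mulSn -addnA ltnNge leq_addr addKn IHs.
Qed.

Lemma nth_matrix (a b : nat) (f : 'I_a -> 'I_b -> nat) (i : 'I_a) (j : 'I_b) :
  nth 0 [seq f u v | u <- enum 'I_a, v <- enum 'I_b] (i * b + j) = f i j.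
Proof.
have := @nth_allpairs _ _ _ f (enum 'I_a) (enum 'I_b) i j 0 i j.
by rewrite !size_enum_ord !nth_ord_enum; apply.
Qed.

Lemma size_matrix (a b : nat) (f : 'I_a -> 'I_b -> nat) :
  size [seq f u v | u <- enum 'I_a, v <- enum 'I_b] = a * b.
Proof. by rewrite size_allpairs !size_enum_ord. Qed.

Definition flagx (e : texpr) : texpr := TIf e (TCst 1) (TCst 0).

Definition output_prog : tstmt :=
  TSeq (TOut (TCst 0) (TPar 0)) (TSeq
  (TFor 0 0 (TFor 0 1 (TOut (TAdd (TCst 1) (TAdd (TScale 0 (TVar 0)) (TVar 1)))
     (flagx (TRd 31 (TVar 0) (TVar 1))))))
  (TFor 0 0 (TFor 0 1 (TOut
     (TIf (TSub (TPar 1) (TVar 1))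
        (TAdd (TAdd (TCst 1) (TScale 0 (TPar 0))) (TAdd (TScale 1 (TVar 0)) (TVar 1))) (TPar 3))
     (flagx (TRd 33 (TVar 0) (TVar 1))))))).

Definition main_prog : tstmt :=
  TSeq (lower (SSeq (SFor 2 13 select_step) (SSeq dissect_prog bags_prog))) output_prog.

Lemma main_prog_wf : twf main_prog.
Proof. by vm_compute. Qed.

Lemma main_prog_depth : tdepth main_prog <= 1.
Proof. by vm_compute. Qed.

Section Output.
Variables (p : nat -> nat) (out : nat -> nat).
Local Notation N := (p 0).
Local Notation n := (p 1).

Definition right_at (st : tstate) q := raw st q = out q.
Definition refines st st' := tab st' = tab st /\ forall q, right_at st q -> right_at st' q.

Lemma refines_trans st1 st2 st3 : refines st1 st2 -> refines st2 st3 -> refines st1 st3.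
Proof. by move=> [e1 h1] [e2 h2]; split=> [|q /h1/h2//]; rewrite e2. Qed.

Lemma refines_loop k f st (A : nat -> nat -> Prop) :
  (forall i st', i < k -> tab st' = tab st ->
     refines st' (f i st') /\ forall q, A i q -> right_at (f i st') q) ->
  refines st (iteri k f st) /\ forall i q, i < k -> A i q -> right_at (iteri k f st) q.
Proof.
elim: k => [|k IHk] H; first by split.
have [|[e r] a] := IHk; first by move=> i st' ik; apply: H; apply: ltnW.
have [r' a'] := H k (iteri k f st) (ltnSn k) e; split; first exact: refines_trans (conj e r) r'.
move=> i q; rewrite ltnS leq_eqVlt => /predU1P[->|ik] Aq /=; first exact: a'.
by case: r' => _; apply; apply: a Aq.
Qed.

Lemma refines_out env st a b : (teval p st env a < p 3 -> teval p st env b = out (teval p st env a)) ->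
  refines st (trun p env st (TOut a b)) /\
  (teval p st env a < p 3 -> right_at (trun p env st (TOut a b)) (teval p st env a)).
Proof.
rewrite /= => H; case: ltnP => [lt|//]; rewrite H //; split.
  split=> // q; rewrite /right_at /upd /=; case: eqP => [->//|//].
by move=> _; rewrite /right_at /= updE.
Qed.

Lemma refines_table env st a b (A : nat -> nat -> nat) :
  (forall i j st', teval p st' (upd (upd env 0 i) 1 j) a = A i j) ->
  (forall i j st', i < N -> j < N -> tab st' = tab st -> A i j < p 3 ->
     teval p st' (upd (upd env 0 i) 1 j) b = out (A i j)) ->
  let st1 := trun p env st (TFor 0 0 (TFor 0 1 (TOut a b))) in
  refines st st1 /\ forall i j, i < N -> j < N -> A i j < p 3 -> right_at st1 (A i j).
Proof.
move=> Ha Hb; pose Q i q := exists2 j, j < N & A i j < p 3 /\ q = A i j.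
have H : forall i st', i < N -> tab st' = tab st ->
    refines st' (trun p (upd env 0 i) st' (TFor 0 1 (TOut a b))) /\
    forall q, Q i q -> right_at (trun p (upd env 0 i) st' (TFor 0 1 (TOut a b))) q.
  move=> i st' iN e'.
  have [|r a1] := @refines_loop N (fun j s => trun p (upd (upd env 0 i) 1 j) s (TOut a b)) st'
    (fun j q => A i j < p 3 /\ q = A i j); last by split=> // q [j jN Aq]; exact: a1 jN Aq.
  move=> j s jN es; have [|r1 r2] := @refines_out (upd (upd env 0 i) 1 j) s a b.
    by rewrite Ha; apply: Hb; rewrite ?es.
  by split=> // q [lt ->]; rewrite -(Ha i j s); apply: r2; rewrite Ha.
have [r h] := refines_loop H; split; first exact: r.
by move=> i j iN jN lt; apply: h iN _; exists j.
Qed.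

Lemma output_progP env st : 0 < p 3 -> out 0 = N ->
  (forall s t, s < N -> t < N -> out (1 + (s * N + t)) = (tab st 31 s t != 0)) ->
  n <= N -> (forall t v, t < N -> v < n -> out (1 + N * N + (t * n + v)) = (tab st 33 t v != 0)) ->
  1 + N * N + N * n <= p 3 ->
  forall q, q < 1 + N * N + N * n -> raw (trun p env st output_prog) q = out q.
Proof.
move=> p3 o0 oT nN oB le.
have [|r1 a1] := @refines_out env st (TCst 0) (TPar 0); first by rewrite /= o0.
set st1 := trun p env st (TOut (TCst 0) (TPar 0)) in r1 a1.
have [e1 _] := r1.
have env0 i j : upd (upd env 0 i) 1 j 0 = i by rewrite upd_neq // updE.
have env1 i j : upd (upd env 0 i) 1 j 1 = j by rewrite updE.
have flag (b : bool) : (if b then 1 else 0) = b by case: b.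
have rd st' a i j : i < N -> j < N ->
    teval p st' (upd (upd env 0 i) 1 j) (flagx (TRd a (TVar 0) (TVar 1))) = (tab st' a i j != 0).
  by move=> iN jN; rewrite /= env0 env1 iN jN flag.
have [||r2 a2] := @refines_table env st1 (TAdd (TCst 1) (TAdd (TScale 0 (TVar 0)) (TVar 1)))
    (flagx (TRd 31 (TVar 0) (TVar 1))) (fun i j => 1 + (i * N + j)).
- by move=> i j st'; rewrite /= env0 env1.
- by move=> i j st' iN jN e _; rewrite rd // e e1 oT.
set st2 := trun p env st1 _ in r2 a2; have [e2 _] := r2.
pose A i j := if j < n then 1 + N * N + (i * n + j) else p 3.
have [||r3 a3] := @refines_table env st2 (TIf (TSub (TPar 1) (TVar 1))
        (TAdd (TAdd (TCst 1) (TScale 0 (TPar 0))) (TAdd (TScale 1 (TVar 0)) (TVar 1))) (TPar 3))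
    (flagx (TRd 33 (TVar 0) (TVar 1))) A.
- by move=> i j st'; rewrite /= env0 env1 subn_eq0 -ltnNge.
- move=> i j st' iN jN e; rewrite rd // e e2 e1 /A; case: ifP => [jn _|_]; last by rewrite ltnn.
  by rewrite oB.
set st3 := trun p env st2 _ in r3 a3.
have -> : trun p env st output_prog = st3 by [].
move=> q qb; change (right_at st3 q).
have [q0|q0] := posnP q.
  by rewrite q0; case: r3 => _; apply; case: r2 => _; apply; apply: a1.
have [qT|qB] := ltnP q (1 + N * N).
  case: r3 => _; apply.
  have N0 : 0 < N by rewrite lt0n; apply/eqP => e; rewrite e in qT; lia.
  have eq : q = 1 + (q.-1 %/ N * N + q.-1 %% N) by rewrite -divn_eq; lia.
  rewrite eq; apply: a2; rewrite -?eq ?ltn_pmod //; last exact: leq_trans qb le.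
  by rewrite ltn_divLR //; lia.
pose r := q - (1 + N * N); have rN : r < N * n by lia.
have n0 : 0 < n by rewrite lt0n; apply/eqP => e; rewrite e muln0 in rN.
have eq : q = 1 + N * N + (r %/ n * n + r %% n) by rewrite -divn_eq; lia.
have rn : r %% n < n by rewrite ltn_pmod.
have eA : A (r %/ n) (r %% n) = q by rewrite /A rn -eq.
rewrite -eA; apply: a3; rewrite ?eA.
- by rewrite ltn_divLR.
- exact: leq_trans rn nN.
- exact: leq_trans qb le.
Qed.

End Output.

Section Assembly.
Variables (g n m : nat) (G : sgraph 'I_n) (H : sgraph ('I_n + 'I_m)%type).
Hypothesis GH : witness g G H.
Local Notation p := (params n m).
Local Notation N := (table_dim n).
Local Notation V := 'I_N.
Local Notation X := [set v : V | v < n].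
Local Notation R := (nth 0 (encode_input G H)).
Local Notation inp := (input_bit p R).
Local Notation shore := (@shore N n inp).

Lemma dim_big : n * n + n < N.
Proof. by rewrite /table_dim; lia. Qed.

Lemma dim_gt1 : 1 < N.
Proof. by rewrite /table_dim; lia. Qed.

Lemma n_le_dim : n <= N.
Proof. by rewrite /table_dim; lia. Qed.

Lemma input_H (y : 'I_m) (x : 'I_n) : R (2 + n * n + (y * n + x)) = H (inr y) (inl x).
Proof.
have -> : 2 + n * n + (y * n + x) = (n * n + (y * n + x)).+2 by lia.
by rewrite /encode_input /= nth_cat size_matrix ltnNge leq_addr /= addKn nth_matrix.
Qed.

Lemma size_input : size (encode_input G H) <= p 3.
Proof.
rewrite /= size_cat !size_matrix /table_dim.
have : n * n <= n * n * (n * n) + 1 by nia.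
by nia.
Qed.

Lemma in_shore (y : 'I_m) (u : V) (x : 'I_n) : u = x :> nat -> (u \in shore y) = H (inl x) (inr y).
Proof.
move=> ux; rewrite in_set ux ltn_ord /= /input_bit -addnA input_H adj_sym.
have -> : 2 + n * n + (y * n + x) < p 3.
  apply: leq_trans size_input; rewrite /= size_cat !size_matrix.
  have : y * n + n <= m * n by rewrite -mulSnr leq_mul2r ltn_ord orbT.
  by have := ltn_ord x; lia.
by case: (H _ _).
Qed.

Definition origin (l : seq nat) (u : V) : option ('I_n + 'I_m)%type :=
  if insub (u : nat) is Some x then Some (inl x) else omap inr (insub (nth 0 l (u - n))).

Section SelectedGraph.
Variable l : seq nat.
Hypothesis l_uniq : uniq l.
Hypothesis l_lt : all (fun y => y < m) l.
Hypothesis l_cover : forall y (u v : V), y < m -> u != v -> u \in shore y -> v \in shore y ->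
  covered n inp l u v.
Hypothesis l_size : size l <= n * n.
Local Notation E := (selected n inp l : rel V).
Local Notation wx x := (widen_ord n_le_dim x).

Lemma selected_sym : symmetric E.
Proof. by move=> u v; rewrite /selected /= orbC. Qed.

Lemma selected_X u v : E u v -> (u \in X) || (v \in X).
Proof.
by rewrite !in_set => /orP[] /and3P[_ _ /shore_lt ->]; rewrite ?orbT.
Qed.

Lemma joinsP (u v : V) : joins n inp l u v -> exists (x : 'I_n) (y : 'I_m),
  [/\ u = x :> nat, n <= v, y = nth 0 l (v - n) :> nat & H (inl x) (inr y)].
Proof.
case/and3P=> nv vl us; have un := shore_lt us.
have ym : nth 0 l (v - n) < m by apply: (allP l_lt); apply: mem_nth; rewrite ltn_subLR.
exists (Ordinal un), (Ordinal ym); split=> //.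
by rewrite -(@in_shore (Ordinal ym) u (Ordinal un)).
Qed.

Lemma selected_G x x' : G x x' = (x != x') && [exists w : V, [&& n <= w, E w (wx x) & E w (wx x')]].
Proof.
case: GH => _ _ _ ->; have [//|xx'] := eqVneq x x'; rewrite /=.
have noj (w : V) (z : 'I_n) : joins n inp l w (wx z) = false.
  by rewrite /joins /= leqNgt ltn_ord.
apply/existsP/existsP => [[y /andP[xy x'y]]|[w /and3P[nw]]].
  have xs : wx x \in shore y by rewrite (@in_shore _ _ x).
  have xs' : wx x' \in shore y by rewrite (@in_shore _ _ x').
  have ne : wx x != wx x' by apply: contra xx' => /eqP/(congr1 val)/= e; apply/eqP/val_inj.
  have /andP[_ /hasP[y' y'l /andP[s1 s2]]] := l_cover (ltn_ord y) ne xs xs'.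
  have il : index y' l < size l by rewrite index_mem.
  have wN : n + index y' l < N.
    by apply: leq_ltn_trans dim_big; rewrite addnC leq_add2r (leq_trans (ltnW il)).
  exists (Ordinal wN); rewrite leq_addr /selected /= !noj /joins /= leq_addr ltn_add2l il addKn nth_index //=.
  by rewrite s1 s2.
rewrite /selected /= !noj /= => /joinsP[x1 [y1 [e1 _ ey1 h1]]] /joinsP[x2 [y2 [e2 _ ey2 h2]]].
have ey : y1 = y2 by apply: val_inj; rewrite /= ey1.
have ex1 : x1 = x by apply: val_inj.
have ex2 : x2 = x' by apply: val_inj.
by exists y1; rewrite -ex1 -ex2 h1 ey h2.
Qed.

Lemma origin_inl (u : V) (x : 'I_n) : u = x :> nat -> origin l u = Some (inl x).
Proof. by move=> ux; rewrite /origin ux valK. Qed.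

Lemma origin_inr (u : V) (y : 'I_m) : n <= u -> y = nth 0 l (u - n) :> nat ->
  origin l u = Some (inr y).
Proof. by move=> nu ey; rewrite /origin insubF ?ltnNge ?nu // -ey valK. Qed.

Lemma selected_K3 : K3_bound E (2 * g + 2).
Proof.
case: GH => _ _ [S [gS [f [f_inj f_edge]]]] _.
have /card_gt0P[s0 _] := flag_inhabited S.
apply: (K3_bound_genus (f := fun u => oapp f s0 (origin l u)) selected_sym gS).
  have flip_edge (a b : flag S) : (exists x, connect (@vertex_rel S) a x /\ connect (@vertex_rel S) b (flip0 x)) ->
      exists x, connect (@vertex_rel S) b x /\ connect (@vertex_rel S) a (flip0 x).
    by case=> x [ux vx]; exists (flip0 x); rewrite flip0K.
  move=> u v /orP[] /joinsP[x [y [ex ny ey h]]].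
    by rewrite (origin_inl ex) (origin_inr ny ey); apply: f_edge.
  by rewrite (origin_inl ex) (origin_inr ny ey); apply/flip_edge/f_edge.
have kind u v : E u v -> (exists x : 'I_n, u = x :> nat) \/
    (exists y : 'I_m, [/\ n <= u, y = nth 0 l (u - n) :> nat & u - n < size l]).
  case/orP=> j; have [x [y [ex ny ey h]]] := joinsP j; first by left; exists x.
  by right; exists y; split=> //; case/and3P: j => _ lt _; lia.
move=> u u' v v' /kind k1 /kind k2.
case: k1 k2 => [[x ex]|[y [ny ey sy]]] [[x' ex']|[y' [ny' ey' sy']]].
- rewrite (origin_inl ex) (origin_inl ex') => /f_inj[e].
  by apply: val_inj; rewrite /= ex ex' e.
- by rewrite (origin_inl ex) (origin_inr ny' ey') => /f_inj.
- by rewrite (origin_inl ex') (origin_inr ny ey) => /f_inj.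
rewrite (origin_inr ny ey) (origin_inr ny' ey') => /f_inj[e].
have : u - n == u' - n by rewrite -(nth_uniq 0 sy sy' l_uniq) -ey -ey' e.
by move/eqP => e'; apply: val_inj; rewrite /= -(subnK ny) -(subnK ny') e'.
Qed.

End SelectedGraph.

End Assembly.

Lemma alpha_card (V : finType) (G : sgraph V) (S : {set V}) : alpha G S <= #|V|.
Proof. by apply/bigmax_leqP => A _; apply: max_card. Qed.

Section MainProgram.
Variables (g n m : nat) (G : sgraph 'I_n) (H : sgraph ('I_n + 'I_m)%type).
Hypothesis GH : witness g G H.
Local Notation p := (params n m).
Local Notation N := (table_dim n).
Local Notation V := 'I_N.
Local Notation R := (nth 0 (encode_input G H)).
Local Notation inp := (input_bit p R).

Lemma size_encode_td (T : sgraph V) (B : V -> {set 'I_n}) : size (encode_td T B) = 1 + N * N + N * n.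
Proof. by rewrite /= size_cat !size_matrix. Qed.

Lemma nth_encode_tree (T : sgraph V) (B : V -> {set 'I_n}) (s t : V) :
  nth 0 (encode_td T B) (1 + (s * N + t)) = T s t.
Proof.
rewrite add1n /= nth_cat size_matrix nth_matrix.
have -> // : s * N + t < N * N.
by apply: leq_trans (_ : s.+1 * N <= _); rewrite ?leq_mul2r ?ltn_ord ?orbT // mulSnr ltn_add2l.
Qed.

Lemma nth_encode_bag (T : sgraph V) (B : V -> {set 'I_n}) (t : V) (v : 'I_n) :
  nth 0 (encode_td T B) (1 + N * N + (t * n + v)) = (v \in B t).
Proof. by rewrite -addnA add1n /= nth_cat size_matrix ltnNge leq_addr /= addKn nth_matrix. Qed.

Lemma output_fits : 1 + N * N + N * n <= p 3.
Proof.
have : N * n <= N * N by rewrite leq_mul2l n_le_dim orbT.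
have : 0 < N * N by rewrite muln_gt0 (ltnW (dim_gt1 n)).
by rewrite /=; move: (N * N) (N * n) => a b; lia.
Qed.

Lemma main_prog_ok : exists (T : sgraph V) (B : V -> {set 'I_n}),
  [/\ tree_decomposition G T B,
      forall t, exists2 z, alpha G (B t) <= z + 1 & z ^ 2 <= 25 * 1024 * ((g + 1) * n),
      size (encode_td T B) <= p 3
    & forall q, q < size (encode_td T B) ->
        raw (trun p (fun=> 0) (TState R (fun _ _ _ => 0)) main_prog) q = nth 0 (encode_td T B) q].
Proof.
set st0 := TState R _.
set s := SSeq (SFor 2 13 select_step) (SSeq dissect_prog bags_prog).
pose st1 := trun p (fun=> 0) st0 (lower s).
have fam0 a i : @fam p st0 a i = set0 by apply/setP => v; rewrite !inE andbF.
have [l inv sz] := @select_progP N n inp p (dim_gt1 n) (dim_big n) (@fam p st0) (fun=> 0) m erefl fam0.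
set F1 := srun _ _ _ _ _ _ in inv.
case: inv => ul al _ e0 [_ cov _].
set E := selected n inp l in e0.
have E_sym : symmetric E := @selected_sym n m G H l.
have E_X := @selected_X n m G H l.
have K3 : K3_bound E (2 * g + 2) by exact: (selected_K3 GH ul al sz).
have G_E := @selected_G g n m G H GH l al cov sz.
set F2 := srun n inp p (fun=> 0) F1 dissect_prog.
have e27 i : i < N -> F2 27 i = piece E n i.
  by move=> iN; case: (dissect_progP n inp (bound := p) erefl (dim_gt1 n) (fun=> 0) e0 iN).
have e28 i : i < N -> F2 28 i = cutter E n i.
  by move=> iN; case: (dissect_progP n inp (bound := p) erefl (dim_gt1 n) (fun=> 0) e0 iN).
have e2 : edges_ok E F2 by apply: run_edges.
have N_gt0 : 0 < N := ltnW (dim_gt1 n).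
exists (tree (piece E n) (cutter E n)), (bag E (n_le_dim n) (piece E n) (cutter E n)).
have XN : #|[set v : V | v < n]| < N.
  apply: leq_ltn_trans (card_initial (n_le_dim n)) _.
  by apply: leq_ltn_trans (dim_big n); rewrite leq_addl.
have famE : fam p st1 = srun n inp p (fun=> 0) F2 bags_prog.
  by rewrite /st1 (@lower_ok p R s (fun=> 0)).
have tabE a (i : nat) (v : V) : i < N -> (tab st1 a i v != 0) = (v \in fam p st1 a i).
  by move=> iN; rewrite inE iN.
have bags (t : V) := bags_progP inp p (n_le_dim n) (fun=> 0) t e2 e27 e28.
split.
- apply: (dissection_td E_sym N_gt0 (remaining := remaining E n)) => //.
  + exact: pieceP.
  + by move=> t; apply: cutter_spec K3 t.
  + by move=> t; apply: cutter0.
- move=> t; apply: (alpha_bag_bound N_gt0 (remaining := remaining E n)) => //.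
  + exact: pieceP.
  + by move=> t'; apply: cutter_spec K3 t'.
  + by move=> t'; apply: cutter0.
  + by move=> t'; apply: cutter_bound K3 _ XN.
- by rewrite size_encode_td output_fits.
rewrite size_encode_td.
set T := tree _ _; set B := bag _ _ _ _.
apply: (@output_progP p (nth 0 (encode_td T B)) (fun=> 0) st1) => //.
- by rewrite (leq_trans _ output_fits).
- move=> i j iN jN; rewrite (@nth_encode_tree T B (Ordinal iN) (Ordinal jN)).
  rewrite (tabE _ _ (Ordinal jN) iN) famE; have [-> _] := bags (Ordinal iN).
  by rewrite tree_adj_sym.
- exact: n_le_dim.
- move=> i j iN jn; rewrite (@nth_encode_bag T B (Ordinal iN) (Ordinal jn)).
  rewrite (tabE _ _ (widen_ord (n_le_dim n) (Ordinal jn)) iN) famE.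
  by have [_ ->] := bags (Ordinal iN).
exact: output_fits.
Qed.

Lemma td_alpha_nat (B : V -> {set 'I_n}) :
  (forall t, exists2 z, alpha G (B t) <= z + 1 & z ^ 2 <= 25 * 1024 * ((g + 1) * n)) ->
  exists2 z, td_alpha G B <= z + 1 & z ^ 2 <= 25 * 1024 * ((g + 1) * n).
Proof.
have N_gt0 : 0 < #|V| by rewrite card_ord (ltnW (dim_gt1 n)).
move=> h; have [t e] := eq_bigmax (fun t : V => alpha G (B t)) N_gt0.
by have [z] := h t; rewrite -e; exists z.
Qed.

End MainProgram.

Import Order.TTheory GRing.Theory Num.Theory.

Lemma sqrt_bound (R : realType) (a n g z : nat) : a <= n -> a <= z + 1 ->
  z ^ 2 <= 25 * 1024 * ((g + 1) * n) -> (a%:R <= 161 * Num.sqrt ((g + 1) * n)%N%:R :> R)%R.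
Proof.
move=> an az zz; set K := ((g + 1) * n)%N in zz *.
have [n0|n0] := posnP n.
  by move: an; rewrite n0 leqn0 => /eqP ->; rewrite mulr_ge0 ?sqrtr_ge0.
have K1 : (0 < K)%N by rewrite muln_gt0 addn1.
have s1 : (1 <= Num.sqrt K%:R :> R)%R.
  by rewrite -[leLHS]sqrtr1 ler_wsqrtr // ler1n.
have zs : (z%:R <= 160 * Num.sqrt K%:R :> R)%R.
  have -> : (z%:R = Num.sqrt (z ^ 2)%N%:R :> R)%R by rewrite natrX sqrtr_sqr ger0_norm.
  have -> : (160 = Num.sqrt (160 ^+ 2) :> R)%R by rewrite sqrtr_sqr ger0_norm.
  rewrite -sqrtrM ?sqr_ge0 // ler_wsqrtr // -natrX -natrM ler_nat.
  by apply: leq_trans zz _; rewrite leq_mul2r; apply/orP; right; lia.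
apply: le_trans (_ : (z + 1)%:R <= _)%R; first by rewrite ler_nat.
rewrite natrD; lra.
Qed.

(** * Arbitrary vertex sets *)

Lemma tree_alpha_le (V N : finType) (G : sgraph V) (T : sgraph N) (X : N -> {set V}) :
  tree_decomposition G T X -> tree_alpha G <= td_alpha G X.
Proof.
move=> td; rewrite /tree_alpha; case: ex_minnP => k _; apply.
by apply/asboolP; exists N, T, X.
Qed.

Section Pullback.
Variables (U V : finType) (f : U -> V) (G : sgraph V).

Lemma pullback_sym : symmetric (fun u v => G (f u) (f v)).
Proof. by move=> u v; apply: adj_sym. Qed.

Lemma pullback_irr : irreflexive (fun u v => G (f u) (f v)).
Proof. by move=> u; apply: adj_irr. Qed.

Definition pullback : sgraph U := SGraph pullback_sym pullback_irr.

Lemma pullback_genus g : injective f -> euler_genus_le G g -> euler_genus_le pullback g.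
Proof.
move=> f_inj [S [gS [h [h_inj h_edge]]]]; exists S; split=> //; exists (h \o f).
by split=> [u v /h_inj/f_inj|u v /h_edge].
Qed.

Lemma pullback_tree_alpha (N : finType) (T : sgraph N) (X : N -> {set U}) (f' : V -> U) :
  cancel f' f -> tree_decomposition pullback T X -> tree_alpha G <= td_alpha pullback X.
Proof.
move=> fK [tT cover edge conn]; pose X' t := [set v | f' v \in X t].
have inX' v t : (v \in X' t) = (f' v \in X t) by rewrite inE.
apply: leq_trans (_ : td_alpha G X' <= _).
  apply: (tree_alpha_le (T := T)); split=> //.
  - by move=> v; have [t vt] := cover (f' v); exists t; rewrite inX'.
  - move=> u v uv; have [|t [ut vt]] := edge (f' u) (f' v); first by rewrite /= !fK.
    by exists t; rewrite !inX'.
  move=> u s t; rewrite !inX' => us ut; apply: connect_sub (conn _ _ _ us ut) => a b ab.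
  by apply: connect1; rewrite /= !inX'.
apply/bigmax_leqP => t _; apply: leq_trans (leq_bigmax t).
apply/bigmax_leqP => A /andP[/subsetP sA /forall_inP stA].
have f'_inj := can_inj fK.
rewrite -(card_imset _ f'_inj); apply: (leq_bigmax_cond (F := fun B : {set U} => #|B|)).
apply/andP; split; first by apply/subsetP => _ /imsetP[v vA ->]; rewrite -inX' sA.
apply/forall_inP => _ /imsetP[u uA ->]; apply/forall_inP => _ /imsetP[v vA ->].
by rewrite /= !fK; have /forall_inP := stA u uA; apply.
Qed.

End Pullback.

Section Ordinals.
Variables (g : nat) (X Y : finType) (G : sgraph X) (H : sgraph (X + Y)%type).

Definition sum_val (z : ('I_#|X| + 'I_#|Y|)%type) : (X + Y)%type :=
  match z with inl i => inl (enum_val i) | inr j => inr (enum_val j) end.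

Lemma sum_val_inj : injective sum_val.
Proof. by move=> [i|i] [j|j] // [] /enum_val_inj ->. Qed.

Lemma witness_ordinals : witness g G H ->
  witness g (pullback (@enum_val X xpredT) G) (pullback sum_val H).
Proof.
case=> XX YY gH GH; split.
- by move=> x x'; apply: XX.
- by move=> y y'; apply: YY.
- exact: pullback_genus sum_val_inj gH.
move=> x x'; rewrite /= GH (inj_eq enum_val_inj); congr (_ && _).
apply/existsP/existsP => [[y h]|[j h]]; last by exists (enum_val j).
by exists (enum_rank y); rewrite /= enum_rankK.
Qed.

End Ordinals.

Theorem corollary3p7 (R : realType) :
  exists C : R,
    (forall (g : nat) (V : finType) (G : sgraph V),
       map_graph g G ->
       ((tree_alpha G)%:R <= C * Num.sqrt ((g + 1) * #|V|)%N%:R :> R)%R) /\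
    (exists (P : cmd) (c d : nat),
       forall (g n m : nat) (G : sgraph 'I_n) (H : sgraph ('I_n + 'I_m)%type),
         witness g G H ->
         exists (t : nat) (s : state)
                (k : nat) (T : sgraph 'I_k) (X : 'I_k -> {set 'I_n}),
           [/\ exec P (init_state (encode_input G H)) t s,
               t <= c * (n + g + 1) ^ d * (m + 1),
               has_output s (encode_td T X),
               tree_decomposition G T X
             & ((td_alpha G X)%:R
                  <= C * Num.sqrt ((g + 1) * n)%N%:R :> R)%R]).
Proof.
exists 161%:R%R; split.
  move=> g V G [Y [H GH]].
  have [T [B [td h _ _]]] := main_prog_ok (witness_ordinals GH).
  have [z az zz] := td_alpha_nat h.
  apply: sqrt_bound zz.
    apply: leq_trans (pullback_tree_alpha enum_rankK td) _.
    by apply/bigmax_leqP => t _; rewrite -[leqRHS]card_ord; apply: alpha_card.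
  exact: leq_trans (pullback_tree_alpha enum_rankK td) az.
have [P [c [d HP]]] := table_program main_prog_wf main_prog_depth.
exists P, c, d => g n m G H GH.
have [T [B [td h sz out]]] := main_prog_ok GH.
have [t [s [ex le ms]]] := HP (encode_input G H) n m erefl erefl (size_input G H).
exists t, s, _, T, B; split=> //.
- apply: leq_trans le _; rewrite [m + 1]addn1 !leq_mul //.
  by case: (d) => // e; rewrite leq_exp2r //; lia.
- by move=> i isz; rewrite ms ?out //; apply: leq_trans isz sz.
have [z az zz] := td_alpha_nat h.
apply: sqrt_bound az zz.
by apply/bigmax_leqP => i _; rewrite -[leqRHS]card_ord; apply: alpha_card.
Qed.
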